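(* Denote by $S$ the strip $\{z\in\mathbb{C}:\operatorname{Re}z\in(0,1)\}$. Suppose that $\{\mathcal{T}_z\}_{z\in\bar S}$ is a family of uniformly bounded operators on $L^2(\mu)$ such that $z\mapsto\int_M\mathcal{T}_zf\,g\,d\mu$ is holomorphic in $S$ and continuous in $\bar S$ for all functions $f$ and $g$ in $L^2(\mu)$. Further, assume that there exists a constant $A$ such that for all $s\in\mathbb{R}$ the operator norm of $\mathcal{T}_{is}$ on $L^2(\mu)$ is at most $A$ and the operator norm of $\mathcal{T}_{1+is}$ from $L^\infty(\mu)$ to $BMO(\mu)$ is at most $A$. Then for every $\theta\in(0,1)$ the operator $\mathcal{T}_\theta$ is bounded on $L^{p_\theta}(\mu)$, where $p_\theta=2/(1-\theta)$, and its operator norm on $L^{p_\theta}(\mu)$ is at most $A_\theta$, where $A_\theta$ depends only on $A$ and on $\theta$.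
   Context: Setting. $(M,\rho,\mu)$ is a metric measure space ($\mu$ a Borel measure), $M$ is unbounded, $\mu(M)>0$ and every ball has finite measure. $\mathcal{B}$ is the family of all balls of $M$; $c_B$, $r_B$ are the centre and radius of $B\in\mathcal{B}$, $\kappa B$ is the ball with centre $c_B$ and radius $\kappa r_B$; for $b>0$, $\mathcal{B}_b$ is the family of balls with $r_B\le b$. For $A\subset M$ and $\kappa>0$, $A_\kappa=\{x\in A:\rho(x,A^c)\le\kappa\}$. It is assumed that $M$ has the following three properties. Local doubling property (LDP): for every $b>0$ there is a constant $D_b$ such that $\mu(2B)\le D_b\,\mu(B)$ for all $B\in\mathcal{B}_b$. Isoperimetric property (I): there exist $\kappa_0,C>0$ such that for every bounded open set $A$, $\mu(A_\kappa)\ge C\kappa\,\mu(A)$ for all $\kappa\in(0,\kappa_0]$. Approximate midpoint property (AMP): there exist $R_0\in[0,\infty)$ and $\beta\in(1/2,1)$ such that for every pair of points $x,y\in M$ with $\rho(x,y)>R_0$ there is a ball $B$ containing $x$ and $y$ with $r_B<\beta\,\rho(x,y)$. The constants $R_0,\beta$ are fixed. A constant $b_0>R_0/(1-\beta)$ is fixed. BMO. $BMO(\mu)$ is the space of equivalence classes modulo constants of locally integrable $f$ with $\sup_{B\in\mathcal{B}_{b_0}}\frac1{\mu(B)}\int_B|f-f_B|\,d\mu<\infty$, normed by this quantity, where $f_B$ is the average of $f$ over $B$ (any scale $b>R_0/(1-\beta)$ gives the same space with an equivalent norm). Conventions. The space $(M,\rho,\mu)$ is fixed, so constants may depend on it.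 For an operator $\mathcal{T}$ defined on $L^2(\mu)$, its operator norm from $L^\infty(\mu)$ to $BMO(\mu)$ is at most $A$ when $\|\mathcal{T}f\|_{BMO(\mu)}\le A\|f\|_\infty$ for all $f\in L^2(\mu)\cap L^\infty(\mu)$; boundedness on $L^{p_\theta}(\mu)$ is understood as boundedness of the extension from $L^2(\mu)\cap L^{p_\theta}(\mu)$. *)

(* Defs.v *)
From HB Require Import structures.
From mathcomp Require Import all_boot all_order all_algebra.
From mathcomp Require Import all_classical all_reals all_analysis.
From mathcomp Require Import complex.

Set Implicit Arguments.
Unset Strict Implicit.
Unset Printing Implicit Defensive.

Import Order.TTheory GRing.Theory Num.Theory.
Import numFieldNormedType.Exports.

Local Open Scope classical_set_scope.
Local Open Scope ring_scope.

Notation cnorm := ComplexField.Normc.normc.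

(* Complex-valued functions on a measure space. Functions are handled       *)
(* through representatives of their classes modulo equality a.e.            *)

Section ComplexLp.
Context d (X : measurableType d) (R : realType).
Variable mu : {measure set X -> \bar R}.
Implicit Types (f g : X -> R[i]) (p : \bar R) (D : set X).

Definition cmeasurable f :=
  measurable_fun setT (fun x => complex.Re (f x)) /\
  measurable_fun setT (fun x => complex.Im (f x)).

Definition cintegrable D f :=
  mu.-integrable D (fun x => (complex.Re (f x))%:E) /\
  mu.-integrable D (fun x => (complex.Im (f x))%:E).

Definition cintegral D f : R[i] :=
  Complex (\int[mu]_(x in D) complex.Re (f x))
          (\int[mu]_(x in D) complex.Im (f x)).

Definition cLnorm p f : \bar R := Lnorm mu p (fun x => (cnorm (f x))%:E).

Definition in_Lp p f := cmeasurable f /\ (cLnorm p f < +oo)%E.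

(* [U] induces a linear operator on the quotient space L^p(mu). *)
Definition Lp_operator p (U : (X -> R[i]) -> (X -> R[i])) :=
  [/\ forall f, in_Lp p f -> in_Lp p (U f),
      forall f g, in_Lp p f -> in_Lp p g ->
        (\forall x \ae mu, f x = g x) -> \forall x \ae mu, U f x = U g x &
      forall (a : R[i]) f g, in_Lp p f -> in_Lp p g ->
        \forall x \ae mu, U (fun y => a * f y + g y) x = a * U f x + U g x].

Definition Lp_opnorm_le p (U : (X -> R[i]) -> (X -> R[i])) (K : R) :=
  forall f, in_Lp p f -> (cLnorm p (U f) <= K%:E * cLnorm p f)%E.

(* [T], an operator on L^2(mu), extends from the intersection of L^2(mu) and
   L^p(mu) to an operator on L^p(mu) of norm at most [K]. *)
Definition Lp_extension_opnorm_le p (T : (X -> R[i]) -> (X -> R[i])) (K : R) :=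
  exists U : (X -> R[i]) -> (X -> R[i]),
    [/\ Lp_operator p U,
        forall f, in_Lp 2%:E f -> in_Lp p f -> \forall x \ae mu, U f x = T f x &
        Lp_opnorm_le p U K].

End ComplexLp.


(* The point is only there because [measurableType] demands one: an unbounded
   metric space is nonempty. *)
#[short(type="pointedMetricType")]
HB.structure Definition PointedMetric (K : numDomainType) :=
  {M of Metric K M & isPointed M}.

Definition borel (R : realType) (M : pointedMetricType R) :=
  g_sigma_algebraType (@open M).

Section MetricMeasure.
Context (R : realType) (M : pointedMetricType R).
Variable mu : {measure set (borel M) -> \bar R}.
Implicit Types (A : set M) (f : M -> R[i]).

Definition unbounded_space := forall r : R, exists x y : M, r < mdist x y.

Definition mbounded A := exists (c : M) (r : R), A `<=` ball c r.

(* The infimum is taken in \bar R, so that the distance to the empty set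
   is +oo. *)
Definition dist_to (x : M) A : \bar R :=
  ereal_inf [set (mdist x y)%:E | y in A].

Definition layer A (kappa : R) : set M :=
  [set x | A x /\ (dist_to x (~` A) <= kappa%:E)%E].

(* A ball is a pair (centre, positive radius), denoting an open ball. *)
Definition balls_finite :=
  forall (c : M) (r : R), 0 < r -> (mu (ball c r) < +oo)%E.

Definition locally_doubling := forall b : R, 0 < b ->
  exists D : R, forall (c : M) (r : R), 0 < r -> r <= b ->
    (mu (ball c (2 * r)) <= D%:E * mu (ball c r))%E.

Definition isoperimetric := exists kappa0 C : R,
  [/\ 0 < kappa0, 0 < C &
    forall A, open A -> mbounded A ->
    forall kappa, 0 < kappa -> kappa <= kappa0 ->
      ((C * kappa)%:E * mu A <= mu (layer A kappa))%E].

Definition approximate_midpoint (R0 beta : R) :=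
  forall x y : M, R0 < mdist x y -> exists (c : M) (r : R),
    [/\ 0 < r, ball c r x, ball c r y & r < beta * mdist x y].

Definition average f (B : set M) : R[i] :=
  ((fine (mu B))^-1)%:C%C * cintegral mu B f.

Definition mean_oscillation f (B : set M) : \bar R :=
  (((fine (mu B))^-1)%:E * \int[mu]_(x in B) (cnorm (f x - average f B))%:E)%E.

Definition locally_integrable_on_balls f :=
  forall (c : M) (r : R), 0 < r -> cintegrable mu (ball c r) f.

Definition BMO_norm (b : R) f : \bar R :=
  ereal_sup [set mean_oscillation f (ball B.1 B.2) |
             B in [set B : M * R | 0 < B.2 <= b]].

Definition in_BMO (b : R) f :=
  locally_integrable_on_balls f /\ (BMO_norm b f < +oo)%E.

Definition Linfty_BMO_opnorm_le (b : R)
    (T : (M -> R[i]) -> (M -> R[i])) (K : R) :=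
  forall f, in_Lp mu 2%:E f -> in_Lp mu +oo%E f ->
    in_BMO b (T f) /\ (BMO_norm b (T f) <= K%:E * cLnorm mu +oo f)%E.

End MetricMeasure.

(* [R[i]^o] is the complex plane as a normed space over itself, so that
   [derivable] below is complex differentiability. *)

Definition strip (R : realType) : set R[i]^o :=
  [set z | 0 < complex.Re z < 1].

Definition closed_strip (R : realType) : set R[i]^o := closure (@strip R).

Definition holomorphic_on (R : realType) (D : set R[i]^o)
    (phi : R[i]^o -> R[i]^o) :=
  forall z, D z -> derivable phi z 1.

Definition admissible_family (R : realType) d (X : measurableType d)
    (mu : {measure set X -> \bar R})
    (T : R[i] -> (X -> R[i]) -> (X -> R[i])) :=
  [/\ forall z, @closed_strip R z -> Lp_operator mu 2%:E (T z),
      exists K : R, forall z, @closed_strip R z ->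
        Lp_opnorm_le mu 2%:E (T z) K &
      forall f g, in_Lp mu 2%:E f -> in_Lp mu 2%:E g ->
        let phi : R[i]^o -> R[i]^o :=
          fun z => cintegral mu setT (fun x => T z f x * g x) in
        holomorphic_on (@strip R) phi /\
        {within @closed_strip R, continuous phi}].

(* Main.v *)
(* Let g = T_theta f for a step function f.  Complex interpolation is applied,
   instead of to a sharp maximal operator, to finite sums of oscillations: if
   pieces E_j of balls B_j are disjoint and o_j is the mean oscillation of g on
   B_j, then S = sum_j o_j^p mu(E_j) is the value at theta of
     Phi(z) = sum_j o_j^{p(1+z)/2} mu(E_j) int (T_z f_z) k_j,
   where k_j is a kernel on B_j with int g k_j = o_j and
   f_z = sgn(f) |f|^{p(1-z)/2}.  On Re z = 0 the oscillation is at most twice the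
   average, and the weak type of the maximal function with Cauchy-Schwarz bounds
   |Phi| by C A S^{1/2} |f|_p^{p/2}; on Re z = 1 the BMO bound gives A S.  The
   three lines theorem then yields S <= C A^p |f|_p^p.  A good-lambda inequality
   on level sets turns this into a bound on the p-norm of g: by the isoperimetric
   property a fixed proportion of an open set of finite measure lies within a
   bounded distance of its complement, where Whitney balls are small, so local
   doubling suffices.  Step functions being dense, T_theta then extends to L^p. *)
Require Import Defs.
From HB Require Import structures.
From mathcomp Require Import all_boot all_order all_algebra.
From mathcomp Require Import all_classical all_reals all_analysis.
From mathcomp Require Import complex.
From mathcomp Require Import measurable_realfun ess_sup_inf.
From mathcomp Require Import ring lra.

Set Implicit Arguments.
Unset Strict Implicit.
Unset Printing Implicit Defensive.

Import Order.TTheory GRing.Theory Num.Theory.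
Import numFieldNormedType.Exports.
Import ComplexField.Normc HBNNSimple.

Local Open Scope classical_set_scope.
Local Open Scope ring_scope.

(** * Complex analysis on the strip *)

(** A sharp function is a supremum and therefore not holomorphic in z. Freezing finitely many balls
    and the kernels built from g = T_theta f leaves only f_z and scalar weights varying with z,
    hence a finite sum of pairings with fixed L^2 functions. Finiteness also makes S a number before
    any estimate, so that it may be cancelled: as (1 - theta)p = 2 and theta p = p - 2, the three
    lines theorem gives S^p <= C A^2 |f|_p^p S (A S)^(p-2). The bound has to be uniform in the
    balls, since g dictates them. Doubling is only local, so points deep inside a level set are out
    of reach of Whitney balls of controlled size. What survives is that from level l to level eta l
    a fixed proportion of measure is lost, up to a sharp level set. This proportion may be tiny, so
    eta must be close enough to 1 for eta^p not to outweigh it; levels therefore run along t eta^k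
    and not along powers of 2. The L^2 norm of g starts this recursion with a term of order t^(p-2),
    which vanishes as t tends to 0 because p > 2. *)

Section ComplexNorm.
Variable R : realType.
Implicit Types z w : R[i].

Lemma normrc z : `|z| = (cnorm z)%:C%C.
Proof. by rewrite normc_def; case: z. Qed.

Lemma cnorm_ge0 z : 0 <= cnorm z.
Proof. by case: z => a b; exact: sqrtr_ge0. Qed.

Lemma cnormB z w : cnorm (z - w) = cnorm (w - z).
Proof. by rewrite -normcN opprB. Qed.

Lemma cnormX z n : cnorm (z ^+ n) = cnorm z ^+ n.
Proof. by elim: n => [|n IH]; [exact: normc1 | rewrite !exprS normcM IH]. Qed.

Lemma cnorm_triangle z w : cnorm z <= cnorm w + cnorm (z - w).
Proof. by rewrite -{1}(subrK w z) addrC le_normcD. Qed.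

Lemma normr_Re_le z : `|complex.Re z| <= cnorm z.
Proof. by rewrite -lecR -normrc normc_ge_Re. Qed.

Lemma normr_Im_le z : `|complex.Im z| <= cnorm z.
Proof.
case: z => a b /=; rewrite -sqrtr_sqr ler_wsqrtr// lerDr sqr_ge0//.
Qed.

Lemma cnorm_le_ReIm z : cnorm z <= `|complex.Re z| + `|complex.Im z|.
Proof.
case: z => a b /=; rewrite -(@ger0_norm _ (`|a| + `|b|)) ?addr_ge0//.
rewrite -sqrtr_sqr ler_wsqrtr// sqrrD !real_normK ?num_real//.
by rewrite lerD2r lerDl mulrn_wge0// mulr_ge0.
Qed.

Lemma cnorm_real (x : R) : cnorm x%:C%C = `|x|.
Proof. by rewrite /= expr0n addr0 sqrtr_sqr. Qed.

Lemma cnorm_gt0 z : (0 < cnorm z) = (z != 0).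
Proof.
rewrite lt_neqAle cnorm_ge0 andbT eq_sym; congr negb.
by apply/eqP/eqP => [/eq0_normc|->]; rewrite ?normc0.
Qed.

End ComplexNorm.

Local Arguments normc : simpl never.

(** * Complex limits and derivatives in real epsilon-delta form *)

Section EpsilonDelta.
Variable R : realType.
Implicit Types (phi : R[i]^o -> R[i]^o) (z w : R[i]^o).

(** Radii of balls in [R[i]^o] are themselves elements of [R[i]]; positivity forces them to be real,
    and the passage to real radii is made here. *)
Lemma nbhs_cnormP z (P : set R[i]^o) :
  nbhs z P <-> exists2 d : R, 0 < d & forall w, cnorm (w - z) < d -> P w.
Proof.
split.
  move=> /nbhs_ballP[e e0 H].
  have [k ek] : exists k : R, e = k%:C%C.
    by apply/complex_realP; rewrite ger0_real// ltW.
  exists k => [|w zw]; first by rewrite -ltcR -ek.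
  by apply: H; rewrite -ball_normE /ball_/= distrC normrc ek ltcR.
move=> [d d0 H]; apply/nbhs_ballP; exists (d%:C)%C => /=; first by rewrite ltcR.
by move=> w; rewrite -ball_normE /ball_/= distrC normrc ltcR; exact: H.
Qed.

(** Multiplied out by [w - z], the estimate also holds at [w = z], so that no punctured
    neighbourhood is left to carry along. *)
Lemma derivable_cnormP phi z : derivable phi z 1 <->
  exists l : R[i], forall e : R, 0 < e -> exists2 d : R, 0 < d &
    forall w, cnorm (w - z) < d ->
      cnorm (phi w - phi z - l * (w - z)) <= e * cnorm (w - z).
Proof.
split.
  move=> /cvg_ex[l /cvgrPdist_le H]; exists l => e e0.
  have /H : 0 < (e%:C)%C :> R[i] by rewrite ltcR.
  rewrite near_withinE => /nbhs_cnormP[d d0 Hd]; exists d => // w wz.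
  have [->|wz0] := eqVneq w z.
    by rewrite !subrr mulr0 subrr normc0 mulr0.
  have := Hd (w - z); rewrite subr0 subr_eq0 => /(_ wz wz0) /=.
  rewrite [_ *: 1]mulr1 subrK normrc lecR => Hl.
  have wz1 : w - z != 0 by rewrite subr_eq0.
  have -> : phi w - phi z - l * (w - z) =
      - (l - (w - z)^-1 * (phi w - phi z)) * (w - z).
    by rewrite opprB mulrBl mulrAC mulVf// mul1r.
  rewrite normcM ler_wpM2r ?cnorm_ge0// normcN.
  exact: Hl.
move=> [l H]; apply/cvg_ex; exists l; apply/cvgrPdist_le => e e0.
have [k ek] : exists k : R, e = k%:C%C.
  by apply/complex_realP; rewrite ger0_real// ltW.
have k0 : 0 < k by rewrite -ltcR -ek.
have [d d0 Hd] := H k k0.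
rewrite near_withinE; apply/nbhs_cnormP; exists d => // h.
rewrite subr0 => hd /= h0; have := Hd (h + z).
rewrite addrK => /(_ hd) Hh.
rewrite [_ *: 1]mulr1 normrc ek lecR.
rewrite -(ler_pM2r (x := cnorm h)) ?cnorm_gt0// -normcM.
have -> : (l - h^-1 *: (phi (h + z) - phi z)) * h =
    - (phi (h + z) - phi z - l * h).
  rewrite mulrBl opprB; congr (_ - _).
  by rewrite [_ *: _](mulrC h^-1) mulfVK.
by rewrite normcN.
Qed.

Lemma within_continuous_cnorm (D : set R[i]^o) phi :
  {within D, continuous phi} -> forall z, D z -> forall e : R, 0 < e ->
  exists2 d : R, 0 < d &
    forall w, D w -> cnorm (w - z) < d -> cnorm (phi w - phi z) <= e.
Proof.
move=> /subspace_continuousP H z Dz e e0.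
have /cvgrPdist_le/(_ (e%:C)%C) := H z Dz.
rewrite ltcR => /(_ e0); rewrite near_withinE => /nbhs_cnormP[d d0 Hd].
exists d => // w Dw wz; have := Hd w wz Dw.
by rewrite normrc lecR /= cnormB.
Qed.

Lemma cnorm_within_continuous (D : set R[i]^o) phi :
  (forall z, D z -> forall e : R, 0 < e ->
    exists2 d : R, 0 < d &
      forall w, D w -> cnorm (w - z) < d -> cnorm (phi w - phi z) <= e) ->
  {within D, continuous phi}.
Proof.
move=> H; apply/subspace_continuousP => z Dz; apply/cvgrPdist_le => e e0.
have [k ek] : exists k : R, e = k%:C%C.
  by apply/complex_realP; rewrite ger0_real// ltW.
have k0 : 0 < k by rewrite -ltcR -ek.
have [d d0 Hd] := H z Dz k k0.
rewrite near_withinE; apply/nbhs_cnormP; exists d => // w wz Dw.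
by rewrite normrc ek lecR /= cnormB; exact: Hd.
Qed.

Lemma derivable_cnorm_continuous phi z : derivable phi z 1 ->
  forall e : R, 0 < e -> exists2 d : R, 0 < d &
    forall w, cnorm (w - z) < d -> cnorm (phi w - phi z) <= e.
Proof.
move=> /derivable_cnormP[l Hl] e e0.
have [d d0 Hd] := Hl 1 ltr01.
pose M := 1 + cnorm l; have M0 : 0 < M by rewrite ltr_wpDr ?cnorm_ge0.
exists (Num.min d (e / M)) => [|w]; first by rewrite lt_min d0 divr_gt0.
rewrite lt_min => /andP[/Hd wd we].
apply: (@le_trans _ _ (M * cnorm (w - z))); last first.
  by rewrite mulrC -ler_pdivlMr// ltW.
rewrite mulrDl mul1r -normcM.
rewrite (le_trans (cnorm_triangle _ (l * (w - z))))// addrC lerD2r.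
by rewrite mul1r in wd.
Qed.

End EpsilonDelta.

(** * Complex-valued integrals over real intervals *)

Section ComplexIntervalIntegral.
Variable R : realType.
Implicit Types (F G : R -> R[i]) (a b c : R).
Local Notation leb := (@lebesgue_measure R).

Definition citv_integrable F a b :=
  leb.-integrable `[a, b] (fun x => (complex.Re (F x))%:E) /\
  leb.-integrable `[a, b] (fun x => (complex.Im (F x))%:E).

Definition citv_integral F a b : R[i] :=
  Complex (\int[leb]_(x in `[a, b]) complex.Re (F x))
          (\int[leb]_(x in `[a, b]) complex.Im (F x)).

Lemma ReD (z w : R[i]) : complex.Re (z + w) = complex.Re z + complex.Re w.
Proof. by case: z; case: w. Qed.

Lemma ImD (z w : R[i]) : complex.Im (z + w) = complex.Im z + complex.Im w.
Proof. by case: z; case: w. Qed.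

Lemma ReN (z : R[i]) : complex.Re (- z) = - complex.Re z.
Proof. by case: z. Qed.

Lemma ImN (z : R[i]) : complex.Im (- z) = - complex.Im z.
Proof. by case: z. Qed.

Lemma ReM (z w : R[i]) : complex.Re (z * w) =
  complex.Re z * complex.Re w - complex.Im z * complex.Im w.
Proof. by case: z; case: w. Qed.

Lemma ImM (z w : R[i]) : complex.Im (z * w) =
  complex.Re z * complex.Im w + complex.Im z * complex.Re w.
Proof. by case: z; case: w. Qed.

Lemma citv_integralB F G a b :
  citv_integrable F a b -> citv_integrable G a b ->
  citv_integral (fun x => F x - G x) a b =
  citv_integral F a b - citv_integral G a b.
Proof.
move=> [F1 F2] [G1 G2]; rewrite /citv_integral.
under eq_Rintegral do rewrite ReD ReN.
rewrite RintegralB//.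
by under [X in Complex _ X]eq_Rintegral do rewrite ImD ImN; rewrite RintegralB.
Qed.

Lemma Rintegral_cst_itv (k a b : R) : a <= b ->
  \int[leb]_(x in `[a, b]) k = k * (b - a).
Proof.
move=> ab; rewrite Rintegral_cst//; congr (_ * _).
have := lebesgue_measure_itv `[a, b]; rewrite /= => ->.
by rewrite lte_fin; case: ltgtP ab => // -> _; rewrite subrr.
Qed.

Lemma citv_integral_cst (k : R[i]) a b : a <= b ->
  citv_integral (fun=> k) a b = k * (b - a)%:C%C.
Proof.
move=> ab; rewrite /citv_integral !Rintegral_cst_itv//.
by apply/eqP; rewrite eq_complex ReM ImM /= !mulr0 subr0 add0r !eqxx.
Qed.

Lemma citv_integrable_split F a c b : a <= c -> c <= b ->
  citv_integrable F a b -> citv_integrable F a c /\ citv_integrable F c b.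
Proof.
move=> ac cb [F1 F2].
have S1 : `[a, c] `<=` `[a, b].
  by move=> x /=; rewrite !in_itv/= => /andP[-> /le_trans]; apply.
have S2 : `[c, b] `<=` `[a, b].
  by move=> x /=; rewrite !in_itv/= => /andP[/(le_trans ac) -> ->].
by split; split; [exact: integrableS F1|exact: integrableS F2
  |exact: integrableS F1|exact: integrableS F2].
Qed.

Lemma citv_integral_split F a c b : a <= c -> c <= b ->
  citv_integrable F a b ->
  citv_integral F a b = citv_integral F a c + citv_integral F c b.
Proof.
move=> ac cb Fab.
have [_ [F3 F4]] := citv_integrable_split ac cb Fab.
case: Fab => F1 F2.
rewrite /citv_integral.
have H f : leb.-integrable `[a, b] (EFin \o f) ->
    leb.-integrable `[c, b] (EFin \o f) ->
  \int[leb]_(x in `[a, b]) f x = \int[leb]_(x in `[a, c]) f x +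
  \int[leb]_(x in `[c, b]) f x.
  move=> If Ifc; have := @Rintegral_itvB R f (BLeft a) (BRight b) c If.
  rewrite !bnd_simp => /(_ ac cb) E.
  rewrite -(@Rintegral_itv_obnd_cbnd _ c) -?E; first by rewrite subrKC.
  by apply: integrableS Ifc => // x /=; rewrite !in_itv/= => /andP[/ltW -> ->].
by rewrite !H.
Qed.

(** Real and imaginary parts are bounded separately, whence the factor 2. Such constants are
    harmless: [goursat] absorbs them into its choice of [e], and [maximum_modulus] removes them by
    taking powers. *)
Lemma citv_integral_le F a b M : a <= b -> citv_integrable F a b ->
  (forall x, a <= x <= b -> cnorm (F x) <= M) ->
  cnorm (citv_integral F a b) <= M * (b - a) *+ 2.
Proof.
move=> ab [F1 F2] H; apply: le_trans (cnorm_le_ReIm _) _ => /=.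
have K (f : R -> R) : leb.-integrable `[a, b] (EFin \o f) ->
    (forall x, a <= x <= b -> `|f x| <= M) ->
    `|\int[leb]_(x in `[a, b]) f x| <= M * (b - a).
  move=> If fM; apply: le_trans (le_normr_Rintegral _ If) _ => //.
  rewrite -Rintegral_cst_itv//.
  apply: le_Rintegral => //.
  - by apply/integrable_norm.
  - by apply: continuous_compact_integrable;
      [exact: segment_compact|apply: continuous_subspaceT => x; exact: cst_continuous].
by rewrite mulr2n lerD// K// => x /H; apply: le_trans;
  rewrite ?normr_Re_le ?normr_Im_le.
Qed.

End ComplexIntervalIntegral.

(** * Boundary integrals over rectangles and Goursat's theorem *)

Section Goursat.
Variable R : realType.
Implicit Types (F G : R[i]^o -> R[i]^o) (x y e : R) (a z w : R[i]).
Local Notation leb := (@lebesgue_measure R).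

Definition rectangle x0 x1 y0 y1 : set R[i]^o :=
  [set z | x0 <= complex.Re z <= x1 /\ y0 <= complex.Im z <= y1].

Definition continuous_on_cnorm (D : set R[i]^o) F := forall z, D z ->
  forall e, 0 < e -> exists2 d : R, 0 < d &
    forall w, D w -> cnorm (w - z) < d -> cnorm (F w - F z) <= e.

(** The counterclockwise integral over the boundary of the rectangle. Opposite sides share one
    integrand, and the factor i comes from dz = i dy on the vertical sides. *)
Definition contour_integral F x0 x1 y0 y1 : R[i] :=
  citv_integral (fun x => F (Complex x y0) - F (Complex x y1)) x0 x1 +
  Complex 0 1 *
  citv_integral (fun y => F (Complex x1 y) - F (Complex x0 y)) y0 y1.

Lemma derivable_continuous_on (D : set R[i]^o) F :
  (forall z, D z -> derivable F z 1) -> continuous_on_cnorm D F.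
Proof.
move=> dF z Dz e e0; have [d d0 Hd] := derivable_cnorm_continuous (dF z Dz) e0.
by exists d => // w _; exact: Hd.
Qed.

Lemma citv_integrable_continuous (u : R -> R[i]^o) F (D : set R[i]^o) s t :
  (forall r r', cnorm (u r - u r') <= `|r - r'|) ->
  (forall r, s <= r <= t -> D (u r)) ->
  continuous_on_cnorm D F -> citv_integrable (fun r => F (u r)) s t.
Proof.
move=> u1 uD cF.
have H (p : R[i] -> R) : (forall z w, `|p z - p w| <= cnorm (z - w)) ->
    {within `[s, t], continuous (fun r => p (F (u r)))}.
  move=> pl; apply/subspace_continuousP => r /= rst; apply/cvgrPdist_le => e e0.
  rewrite in_itv/= in rst.
  have [d d0 Hd] := cF _ (uD _ rst) e e0.
  rewrite near_withinE; apply/nbhs_ballP; exists d => //= r' rr'.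
  rewrite in_itv/= => r'st; rewrite (le_trans (pl _ _))// cnormB Hd//.
    exact: uD.
  by rewrite (le_lt_trans (u1 _ _))// distrC.
split; apply: (continuous_compact_integrable (f := fun r => _ (F (u r))));
  try exact: segment_compact; apply: H => z w; rewrite -?ReN -?ImN -?ReD -?ImD;
  by rewrite ?normr_Re_le ?normr_Im_le.
Qed.

Lemma cnorm_hline x x' y : cnorm (Complex x y - Complex x' y) <= `|x - x'|.
Proof. by rewrite -cnorm_real /normc/= subrr. Qed.

Lemma cnorm_vline x y y' : cnorm (Complex x y - Complex x y') <= `|y - y'|.
Proof. by rewrite /normc/= subrr expr0n add0r sqrtr_sqr. Qed.

Lemma rectangle_hintegrable F x0 x1 y0 y1 y : y0 <= y <= y1 ->
  continuous_on_cnorm (rectangle x0 x1 y0 y1) F ->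
  citv_integrable (fun x => F (Complex x y)) x0 x1.
Proof.
move=> yy cF; apply: (citv_integrable_continuous (u := fun r => Complex r y) _ _ cF) => //.
by move=> r r'; exact: cnorm_hline.
Qed.

Lemma rectangle_vintegrable F x0 x1 y0 y1 x : x0 <= x <= x1 ->
  continuous_on_cnorm (rectangle x0 x1 y0 y1) F ->
  citv_integrable (fun y => F (Complex x y)) y0 y1.
Proof.
move=> xx cF; apply: (citv_integrable_continuous (u := fun r => Complex x r) _ _ cF) => //.
by move=> r r'; exact: cnorm_vline.
Qed.

Lemma citv_integrableB (f g : R -> R[i]) s t : citv_integrable f s t ->
  citv_integrable g s t -> citv_integrable (fun r => f r - g r) s t.
Proof.
move=> [f1 f2] [g1 g2]; split.
  have -> : (fun x => (complex.Re (f x - g x))%:E) =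
      (fun x => (complex.Re (f x))%:E - (complex.Re (g x))%:E)%E.
    by apply/funext => x; rewrite ReD ReN.
  exact: (integrableB _ f1 g1).
have -> : (fun x => (complex.Im (f x - g x))%:E) =
      (fun x => (complex.Im (f x))%:E - (complex.Im (g x))%:E)%E.
    by apply/funext => x; rewrite ImD ImN.
  exact: (integrableB _ f2 g2).
Qed.

Lemma continuous_on_sub (D D' : set R[i]^o) F : D' `<=` D ->
  continuous_on_cnorm D F -> continuous_on_cnorm D' F.
Proof.
move=> DD' cF z D'z e e0; have [d d0 Hd] := cF z (DD' _ D'z) e e0.
by exists d => // w /DD'; exact: Hd.
Qed.

Lemma contour_integral_hsplit F x0 x x1 y0 y1 : x0 <= x -> x <= x1 -> y0 <= y1 ->
  continuous_on_cnorm (rectangle x0 x1 y0 y1) F ->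
  contour_integral F x0 x1 y0 y1 =
  contour_integral F x0 x y0 y1 + contour_integral F x x1 y0 y1.
Proof.
move=> xl xr yy cF; rewrite /contour_integral.
have x01 := le_trans xl xr.
have iv (z : R) : x0 <= z <= x1 -> citv_integrable (fun r => F (Complex z r)) y0 y1.
  by move=> ?; apply: rectangle_vintegrable cF.
have ih (z : R) : y0 <= z <= y1 -> citv_integrable (fun r => F (Complex r z)) x0 x1.
  by move=> ?; apply: rectangle_hintegrable cF.
rewrite (citv_integral_split xl xr); last first.
  by apply: citv_integrableB; apply: ih; rewrite ?lexx ?yy.
have i0 : citv_integrable (fun r => F (Complex x0 r)) y0 y1.
  by apply: iv; rewrite lexx.
have i1 : citv_integrable (fun r => F (Complex x1 r)) y0 y1.
  by apply: iv; rewrite lexx x01.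
have ix : citv_integrable (fun r => F (Complex x r)) y0 y1.
  by apply: iv; rewrite xl.
rewrite (citv_integralB i1 i0) (citv_integralB ix i0) (citv_integralB i1 ix).
set a := citv_integral _ x0 x; set b := citv_integral _ x x1.
by ring.
Qed.

Lemma contour_integral_vsplit F x0 x1 y0 y y1 : x0 <= x1 -> y0 <= y -> y <= y1 ->
  continuous_on_cnorm (rectangle x0 x1 y0 y1) F ->
  contour_integral F x0 x1 y0 y1 =
  contour_integral F x0 x1 y0 y + contour_integral F x0 x1 y y1.
Proof.
move=> xx yl yr cF; rewrite /contour_integral.
have y01 := le_trans yl yr.
have iv (z : R) : x0 <= z <= x1 -> citv_integrable (fun r => F (Complex z r)) y0 y1.
  by move=> ?; apply: rectangle_vintegrable cF.
have ih (z : R) : y0 <= z <= y1 -> citv_integrable (fun r => F (Complex r z)) x0 x1.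
  by move=> ?; apply: rectangle_hintegrable cF.
rewrite (citv_integral_split yl yr); last first.
  by apply: citv_integrableB; apply: iv; rewrite ?lexx ?xx.
have i0 : citv_integrable (fun r => F (Complex r y0)) x0 x1.
  by apply: ih; rewrite lexx.
have i1 : citv_integrable (fun r => F (Complex r y1)) x0 x1.
  by apply: ih; rewrite lexx y01.
have ix : citv_integrable (fun r => F (Complex r y)) x0 x1.
  by apply: ih; rewrite yl.
rewrite (citv_integralB i0 i1) (citv_integralB i0 ix) (citv_integralB ix i1).
set a := citv_integral _ y0 y; set b := citv_integral _ y y1.
by ring.
Qed.

Definition rectangle_boundary x0 x1 y0 y1 : set R[i]^o :=
  [set z | rectangle x0 x1 y0 y1 z /\
    [\/ complex.Re z = x0, complex.Re z = x1, complex.Im z = y0 |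
      complex.Im z = y1]].

Lemma rectangle_boundary_integrable F x0 x1 y0 y1 : x0 <= x1 -> y0 <= y1 ->
  continuous_on_cnorm (rectangle_boundary x0 x1 y0 y1) F ->
  (citv_integrable (fun x => F (Complex x y0)) x0 x1 /\
   citv_integrable (fun x => F (Complex x y1)) x0 x1) /\
  (citv_integrable (fun y => F (Complex x0 y)) y0 y1 /\
   citv_integrable (fun y => F (Complex x1 y)) y0 y1).
Proof.
move=> xx yy cF; split; split.
- apply: (citv_integrable_continuous (u := fun r => Complex r y0) _ _ cF).
    by move=> r r'; exact: cnorm_hline.
  by move=> r rr; split; [split; rewrite //= lexx|exact: Or43].
- apply: (citv_integrable_continuous (u := fun r => Complex r y1) _ _ cF).
    by move=> r r'; exact: cnorm_hline.
  by move=> r rr; split; [split; rewrite //= lexx yy|exact: Or44].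
- apply: (citv_integrable_continuous (u := fun r => Complex x0 r) _ _ cF).
    by move=> r r'; exact: cnorm_vline.
  by move=> r rr; split; [split; rewrite //= lexx|exact: Or41].
- apply: (citv_integrable_continuous (u := fun r => Complex x1 r) _ _ cF).
    by move=> r r'; exact: cnorm_vline.
  by move=> r rr; split; [split; rewrite //= lexx xx|exact: Or42].
Qed.

Lemma contour_integralB F G x0 x1 y0 y1 : x0 <= x1 -> y0 <= y1 ->
  continuous_on_cnorm (rectangle_boundary x0 x1 y0 y1) F ->
  continuous_on_cnorm (rectangle_boundary x0 x1 y0 y1) G ->
  contour_integral (fun z => F z - G z) x0 x1 y0 y1 =
  contour_integral F x0 x1 y0 y1 - contour_integral G x0 x1 y0 y1.
Proof.
move=> xx yy cF cG; rewrite /contour_integral.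
have [[F1 F2] [F3 F4]] := rectangle_boundary_integrable xx yy cF.
have [[G1 G2] [G3 G4]] := rectangle_boundary_integrable xx yy cG.
transitivity (
  citv_integral (fun x => F (x +i* y0)%C - F (x +i* y1)%C -
    (G (x +i* y0)%C - G (x +i* y1)%C)) x0 x1 +
  'i%C * citv_integral (fun y => F (x1 +i* y)%C - F (x0 +i* y)%C -
    (G (x1 +i* y)%C - G (x0 +i* y)%C)) y0 y1).
  have sub4 (c d c' d' : R[i]) : c - d - (c' - d') = c - c' - (d - d').
    by rewrite !opprD !opprK addrACA.
  by congr (_ + _ * _); congr citv_integral; apply/funext => r; rewrite sub4.
rewrite (citv_integralB (F := fun x => F (x +i* y0)%C - F (x +i* y1)%C)
  (G := fun x => G (x +i* y0)%C - G (x +i* y1)%C)); try exact: citv_integrableB.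
rewrite (citv_integralB (F := fun y => F (x1 +i* y)%C - F (x0 +i* y)%C)
  (G := fun y => G (x1 +i* y)%C - G (x0 +i* y)%C)); try exact: citv_integrableB.
set a := citv_integral _ x0 x1; set b := citv_integral _ y0 y1.
by rewrite mulrBr addrACA opprD.
Qed.

Lemma contour_integral_le F x0 x1 y0 y1 M : x0 <= x1 -> y0 <= y1 ->
  continuous_on_cnorm (rectangle_boundary x0 x1 y0 y1) F ->
  (forall z, rectangle_boundary x0 x1 y0 y1 z -> cnorm (F z) <= M) ->
  cnorm (contour_integral F x0 x1 y0 y1) <= M * ((x1 - x0) + (y1 - y0)) *+ 4.
Proof.
move=> xx yy cF FM; rewrite /contour_integral.
apply: le_trans (le_normcD _ _) _; rewrite normcM.
have -> : cnorm (Complex 0 1) = 1 :> R by rewrite /normc expr0n add0r expr1n sqrtr1.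
rewrite mul1r mulrDr mulrnDl.
have [[F1 F2] [F3 F4]] := rectangle_boundary_integrable xx yy cF.
have MM (f g : R[i]) : cnorm f <= M -> cnorm g <= M -> cnorm (f - g) <= M *+ 2.
  by move=> ? ?; apply: le_trans (le_normcD _ _) _; rewrite normcN mulr2n lerD.
rewrite lerD//.
  apply: le_trans (citv_integral_le (M := M *+ 2) _ _ _) _ => //.
  - exact: citv_integrableB.
  - move=> r rr; apply: MM; apply: FM; split; try by split; rewrite //= lexx ?yy.
      exact: Or43.
    exact: Or44.
  - by rewrite mulrnAl -mulrnA.
apply: le_trans (citv_integral_le (M := M *+ 2) _ _ _) _ => //.
- exact: citv_integrableB.
- move=> r rr; apply: MM; apply: FM; split; try by split; rewrite //= lexx ?xx.
    exact: Or42.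
  exact: Or41.
- by rewrite mulrnAl -mulrnA.
Qed.

(* The integral of an affine function vanishes, so near a point of
   differentiability only the remainder contributes. *)
Lemma contour_integral_subaffine F (k l : R[i]) x0 x1 y0 y1 :
  x0 <= x1 -> y0 <= y1 -> continuous_on_cnorm (rectangle x0 x1 y0 y1) F ->
  contour_integral (fun z => F z - (k + l * z)) x0 x1 y0 y1 =
  contour_integral F x0 x1 y0 y1.
Proof.
move=> xx yy cF; rewrite /contour_integral.
have y0y : y0 <= y0 <= y1 by rewrite lexx.
have y1y : y0 <= y1 <= y1 by rewrite lexx yy.
have x0x : x0 <= x0 <= x1 by rewrite lexx.
have x1x : x0 <= x1 <= x1 by rewrite lexx xx.
have Ic (c : R[i]) s t : citv_integrable (fun=> c) s t.
  by split; apply: continuous_compact_integrable;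
    [exact: segment_compact|apply: continuous_subspaceT => x; exact: cst_continuous
    |exact: segment_compact|apply: continuous_subspaceT => x; exact: cst_continuous].
under [in LHS]eq_fun => x.
  have -> : F (x +i* y0)%C - (k + l * (x +i* y0)%C) -
    (F (x +i* y1)%C - (k + l * (x +i* y1)%C)) =
    F (x +i* y0)%C - F (x +i* y1)%C - l * (0 +i* (y0 - y1))%C.
    have -> : (0 +i* (y0 - y1) = x +i* y0 - x +i* y1)%C.
      by apply/eqP; rewrite eq_complex /= subrr !eqxx.
    by ring.
  over.
under [X in _ + _ * citv_integral X _ _ = _]eq_fun => y.
  have -> : F (x1 +i* y)%C - (k + l * (x1 +i* y)%C) -
    (F (x0 +i* y)%C - (k + l * (x0 +i* y)%C)) =
    F (x1 +i* y)%C - F (x0 +i* y)%C - l * (x1 - x0)%:C%C.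
    have -> : (x1 - x0)%:C%C = ((x1 +i* y) - x0 +i* y)%C.
      by apply/eqP; rewrite eq_complex /= subrr !eqxx.
    by ring.
  over.
rewrite (citv_integralB (F := fun x => F (x +i* y0)%C - F (x +i* y1)%C)
  (G := fun=> _)) ?citv_integral_cst//; last first.
  by apply: citv_integrableB; [exact: (rectangle_hintegrable y0y cF)|
    exact: (rectangle_hintegrable y1y cF)].
rewrite (citv_integralB (F := fun y => F (x1 +i* y)%C - F (x0 +i* y)%C)
  (G := fun=> _)) ?citv_integral_cst//; last first.
  by apply: citv_integrableB; [exact: (rectangle_vintegrable x1x cF)|
    exact: (rectangle_vintegrable x0x cF)].
set a := citv_integral _ _ _; set b := citv_integral _ _ _.
have -> : (0 +i* (y0 - y1))%C = - ('i%C * (y1 - y0)%:C%C).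
  by apply/eqP; rewrite eq_complex /= !mul0r !mul1r subrr add0r oppr0 opprB !eqxx.
by ring.
Qed.

End Goursat.

Section GoursatTheorem.
Variable R : realType.
Implicit Types (F : R[i]^o -> R[i]^o) (x y e : R).

Lemma exists_quarter (c : R) (a b d e : R[i]) :
  c <= cnorm (a + b + (d + e)) ->
  exists i j : bool, c / 4 <= cnorm (if i then if j then a else b
                                     else if j then d else e).
Proof.
move=> H; apply: contrapT => /forallNP K.
have K' i j : cnorm (if i then if j then a else b
                     else if j then d else e) < c / 4.
  by rewrite ltNge; apply/negP => ?; apply: (K i); exists j.
have := K' true true; have := K' true false.
have := K' false true; have := K' false false => /=.
have := le_normcD (a + b) (d + e); have := le_normcD a b.
have := le_normcD d e; lra.
Qed.

(** Cutting in the middle in both directions gives four integrals adding up to the whole one, so one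
    of them keeps a quarter of its modulus. *)
Lemma contour_integral_quarter F x y u v : 0 <= u -> 0 <= v ->
  continuous_on_cnorm (rectangle x (x + u) y (y + v)) F ->
  exists i j : bool,
   let x' := x + i%:R * (u / 2) in let y' := y + j%:R * (v / 2) in
   cnorm (contour_integral F x (x + u) y (y + v)) / 4 <=
   cnorm (contour_integral F x' (x' + u / 2) y' (y' + v / 2)).
Proof.
move=> u0 v0 cF.
have xE : x + u / 2 + u / 2 = x + u by lra.
have yE : y + v / 2 + v / 2 = y + v by lra.
have cF1 : continuous_on_cnorm (rectangle x (x + u / 2) y (y + v)) F.
  apply: continuous_on_sub cF => z [/andP[? ?] /andP[? ?]].
  by split; apply/andP; split; lra.
have cF2 : continuous_on_cnorm (rectangle (x + u / 2) (x + u) y (y + v)) F.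
  apply: continuous_on_sub cF => z [/andP[? ?] /andP[? ?]].
  by split; apply/andP; split; lra.
have := lexx (cnorm (contour_integral F x (x + u) y (y + v))).
rewrite {2}(contour_integral_hsplit (x := x + u / 2) _ _ _ cF); try lra.
rewrite (contour_integral_vsplit (y := y + v / 2) _ _ _ cF1); try lra.
rewrite (contour_integral_vsplit (y := y + v / 2) _ _ _ cF2); try lra.
move=> /exists_quarter[i [j H]].
(* In [exists_quarter] the value [true] selects the left or lower half, whereas here the offset 1
   selects the right or upper one. *)
exists (~~ i), (~~ j); apply: le_trans H _.
by case: i; case: j; rewrite /= ?mul0r ?addr0 ?mul1r ?xE ?yE.
Qed.

Lemma half_itv x (w : R) (i : bool) : 0 <= w / 2 ->
  x <= x + i%:R * (w / 2) /\ x + i%:R * (w / 2) + w / 2 <= x + w.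
Proof. by move=> ?; case: i; rewrite ?mul0r ?mul1r; split; lra. Qed.

(** Bisection: after [n] halvings some rectangle still carries [4 ^- n] of the integral. Near the
    point common to these rectangles [F] is affine up to [e] times the distance. Distance and
    perimeter both scale like [2 ^- n], so the integral is at most a fixed multiple of [e * 4 ^- n],
    with [e] arbitrary. *)
Lemma goursat F x0 x1 y0 y1 : x0 <= x1 -> y0 <= y1 ->
  (forall z, rectangle x0 x1 y0 y1 z -> derivable F z 1) ->
  contour_integral F x0 x1 y0 y1 = 0.
Proof.
move=> xx yy dF; have cF := derivable_continuous_on dF.
pose u := x1 - x0; pose v := y1 - y0.
have u0 : 0 <= u by rewrite subr_ge0.
have v0 : 0 <= v by rewrite subr_ge0.
have x1E : x1 = x0 + u by rewrite /u; lra.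
have y1E : y1 = y0 + v by rewrite /v; lra.
pose h (n : nat) := 2^-1 ^+ n : R.
have h0 n : 0 < h n by rewrite exprn_gt0// invr_gt0.
have hS n : h n.+1 = h n / 2 by rewrite /h exprSr.
pose I (n : nat) (p : R * R) := cnorm (contour_integral F p.1 (p.1 + u * h n)
  p.2 (p.2 + v * h n)).
pose ok n (p : R * R) := [/\ x0 <= p.1, p.1 + u * h n <= x1, y0 <= p.2 &
  p.2 + v * h n <= y1].
have okS n p : ok n p -> forall z,
    rectangle p.1 (p.1 + u * h n) p.2 (p.2 + v * h n) z ->
    rectangle x0 x1 y0 y1 z.
  move=> [? ? ? ?] z [/andP[? ?] /andP[? ?]].
  by split; apply/andP; split; lra.
have step n p : ok n p -> { q : R * R | [/\ ok n.+1 q, I n p / 4 <= I n.+1 q,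
    p.1 <= q.1 /\ q.1 + u * h n.+1 <= p.1 + u * h n &
    p.2 <= q.2 /\ q.2 + v * h n.+1 <= p.2 + v * h n]}.
  move=> okp; apply: cid.
  have [] := @contour_integral_quarter F p.1 p.2 (u * h n) (v * h n).
  - by rewrite mulr_ge0// ltW.
  - by rewrite mulr_ge0// ltW.
  - by apply: continuous_on_sub cF => z; exact: okS.
  move=> i [j H]; exists (p.1 + i%:R * (u * h n / 2), p.2 + j%:R * (v * h n / 2)).
  have uh : 0 <= u * h n / 2 by rewrite mulr_ge0// mulr_ge0// ltW.
  have vh : 0 <= v * h n / 2 by rewrite mulr_ge0// mulr_ge0// ltW.
  have uS : u * h n.+1 = u * h n / 2 by rewrite hS mulrA.
  have vS : v * h n.+1 = v * h n / 2 by rewrite hS mulrA.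
  case: okp => o1 o2 o3 o4.
  have [a1 a2] := half_itv p.1 i uh; have [b1 b2] := half_itv p.2 j vh.
  rewrite /ok /I uS vS /=; split => //.
  by split; [exact: le_trans a1|exact: le_trans o2|exact: le_trans b1
    |exact: le_trans o4].
have ok0 : ok 0%N (x0, y0).
  by rewrite /ok /h /= expr0 !mulr1 -x1E -y1E; split.
pose st n := { p : R * R | ok n p}.
(* The lower left corners are chosen recursively, each together with its proof of [ok], which [step]
   requires in order to continue. *)
pose fix P n : st n := match n with 0%N => exist _ (x0, y0) ok0
  | n'.+1 => let s := P n' in let t := step n' (sval s) (svalP s) in
     exist _ (sval t) (let: And4 a _ _ _ := svalP t in a) end.
pose p n := sval (P n).
have pok n : ok n (p n) by exact: svalP.
have pS n : [/\ I n (p n) / 4 <= I n.+1 (p n.+1),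
    (p n).1 <= (p n.+1).1 /\ (p n.+1).1 + u * h n.+1 <= (p n).1 + u * h n &
    (p n).2 <= (p n.+1).2 /\ (p n.+1).2 + v * h n.+1 <= (p n).2 + v * h n].
  by rewrite /p /=; case: (step _ _ _) => q [].
have I0 n : I 0%N (x0, y0) / 4 ^+ n <= I n (p n).
  elim: n => [|n IH]; first by rewrite expr0 divr1.
  have [+ _ _] := pS n; apply: le_trans.
  by rewrite exprSr invfM mulrA ler_wpM2r.
have lim (q : R * R -> R) w : 0 <= w ->
   (forall n, q (p n) <= q (p n.+1) /\ q (p n.+1) + w * h n.+1 <= q (p n) + w * h n) ->
   exists X, forall n, q (p n) <= X <= q (p n) + w * h n.
  move=> w0 H.
  have A n k : q (p n) <= q (p (n + k)%N) /\
      q (p (n + k)%N) + w * h (n + k)%N <= q (p n) + w * h n.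
    elim: k => [|k [IH1 IH2]]; first by rewrite addn0.
    rewrite addnS; have [a1 a2] := H (n + k)%N.
    by split; [exact: le_trans a1|exact: le_trans IH2].
  pose X := sup (range (fun n => q (p n))).
  have ub n : ubound (range (fun n => q (p n))) (q (p n) + w * h n).
    move=> _ [m _ <-].
    have wh k : 0 <= w * h k by rewrite mulr_ge0// ltW.
    have [mn|nm] := leqP m n.
      have [+ _] := A m (n - m)%N; rewrite subnKC// => /le_trans; apply.
      by rewrite lerDl.
    have [_] := A n (m - n)%N; rewrite subnKC ?(ltnW nm)//; apply: le_trans.
    by rewrite lerDl.
  exists X => n; apply/andP; split.
    by apply: ub_le_sup; [exists (q (p 0%N) + w * h 0%N); exact: ub|exists n].
  by apply: ge_sup => //; exists (q (p 0%N)), 0%N.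
have [X HX] : exists X, forall n, (p n).1 <= X <= (p n).1 + u * h n.
  by apply: (lim fst) => // n; have [] := pS n.
have [Y HY] : exists Y, forall n, (p n).2 <= Y <= (p n).2 + v * h n.
  by apply: (lim snd) => // n; have [] := pS n.
pose a : R[i]^o := Complex X Y.
have /derivable_cnormP[l Hl] : derivable F a 1.
  apply: dF; split => /=.
    by have := HX 0%N; rewrite /h expr0 mulr1 /p/= -x1E.
  by have := HY 0%N; rewrite /h expr0 mulr1 /p/= -y1E.
have hlim e : 0 < e -> exists n, (u + v) * h n < e.
  move=> e0; have uv0 : 0 <= u + v by rewrite addr_ge0.
  have /cvgrPdist_lt/(_ (e / (u + v + 1))) : (h n @[n --> \oo] --> (0:R)).
    by apply: cvg_expr; rewrite ger0_norm ?invr_ge0// invf_lt1// ltr1n.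
  rewrite divr_gt0 ?ltr_wpDl// => /(_ isT)[N _ /(_ N (leqnn N))].
  rewrite sub0r normrN /= gtr0_norm// ltr_pdivlMr ?ltr_wpDl// => H.
  by exists N; apply: le_lt_trans H; rewrite mulrC ler_wpM2l ?(ltW (h0 _))// lerDl.
have D2 n z : rectangle (p n).1 ((p n).1 + u * h n) (p n).2 ((p n).2 + v * h n) z ->
    cnorm (z - a) <= (u + v) * h n.
  move=> [xz yz]; apply: le_trans (cnorm_le_ReIm _) _.
  rewrite ReD ReN ImD ImN mulrDl.
  have W (r s t w : R) : s <= r <= s + w -> s <= t <= s + w -> `|r - t| <= w.
    move=> /andP[A B] /andP[A' B']; rewrite ler_norml; apply/andP; split; lra.
  by apply: lerD; [exact: W (HX n)|exact: W (HY n)].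
apply/eqP; apply: contraT; rewrite -(cnorm_gt0 (contour_integral F _ _ _ _)) => c0.
set c := cnorm _ in c0.
(* The added 1 keeps the denominator positive for a degenerate rectangle and makes
   [4 * e * (u + v) ^+ 2] strictly smaller than [c], which is the contradiction sought. *)
pose e := c / (4 * (u + v) ^+ 2 + 1).
have K0 : 0 < 4 * (u + v) ^+ 2 + 1.
  by rewrite ltr_wpDl// mulr_ge0// sqr_ge0.
have e0 : 0 < e by rewrite divr_gt0.
have [d d0 Hd] := Hl e e0.
have [n nd] := hlim d d0.
have [ok1 ok2 ok3 ok4] := pok n.
have uh : 0 <= u * h n by rewrite mulr_ge0// ltW.
have vh : 0 <= v * h n by rewrite mulr_ge0// ltW.
have In : I n (p n) <= 4 * e * ((u + v) * h n) ^+ 2.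
  rewrite /I -(@contour_integral_subaffine _ _ (F a - l * a) l); first last.
  - by apply: continuous_on_sub cF => z; apply: okS.
  - by rewrite lerDl.
  - by rewrite lerDl.
  apply: le_trans (contour_integral_le (M := e * ((u + v) * h n)) _ _ _ _) _.
  - by rewrite lerDl.
  - by rewrite lerDl.
  - apply: derivable_continuous_on => z [/(okS _ _ (pok n)) zr _].
    apply: derivableB; first exact: dF.
    apply: derivableD; first exact: derivable_cst.
    by apply: derivableM; [exact: derivable_cst|exact: derivable_id].
  - move=> z [/D2 Dz _].
    have -> : F z - (F a - l * a + l * z) = F z - F a - l * (z - a) by ring.
    apply: le_trans (Hd _ (le_lt_trans Dz nd)) _.
    by rewrite ler_wpM2l// ltW.
  - rewrite !(addrC _ (_ * h n)) !addrK -mulrDl -mulr_natr.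
    by rewrite le_eqVlt; apply/orP; left; apply/eqP; ring.
have := le_trans (I0 n) In.
have -> : I 0%N (x0, y0) = c.
  by rewrite /I /c /h /= expr0 !mulr1 -x1E -y1E.
have -> : ((u + v) * h n) ^+ 2 = (u + v) ^+ 2 / 4 ^+ n.
  rewrite exprMn /h -exprM mulnC exprM -exprVn; congr (_ * _ ^+ _).
  by rewrite exprVn; congr (_^-1); ring.
rewrite mulrA ler_pM2r ?invr_gt0 ?exprn_gt0//.
have : e * (4 * (u + v) ^+ 2 + 1) = c by rewrite divfK// gt_eqF.
by move: e0; clear; move: ((u + v) ^+ 2) => k e0 <-; rewrite mulrDr mulr1; lra.
Qed.

End GoursatTheorem.

Section PointwiseDerivable.
Variable R : realType.
Implicit Types (F G : R[i]^o -> R[i]^o) (z : R[i]^o).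

Lemma cderivableD F G z : derivable F z 1 -> derivable G z 1 ->
  derivable (fun w => F w + G w : R[i]^o) z 1.
Proof. by move=> dF dG; exact: (derivableD dF dG). Qed.

Lemma cderivableB F G z : derivable F z 1 -> derivable G z 1 ->
  derivable (fun w => F w - G w : R[i]^o) z 1.
Proof. by move=> dF dG; exact: (derivableB dF dG). Qed.

Lemma cderivableM F G z : derivable F z 1 -> derivable G z 1 ->
  derivable (fun w => F w * G w : R[i]^o) z 1.
Proof. by move=> dF dG; exact: (derivableM dF dG). Qed.

Lemma cderivableV F z : F z != 0 -> derivable F z 1 ->
  derivable (fun w => (F w)^-1 : R[i]^o) z 1.
Proof. by move=> F0 dF; exact: (derivableV F0 dF). Qed.

Lemma cderivableX F z n : derivable F z 1 ->
  derivable (fun w => F w ^+ n : R[i]^o) z 1.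
Proof.
move=> dF; elim: n => [|n IH].
  by under eq_fun do rewrite expr0; exact: derivable_cst.
by under eq_fun do rewrite exprS; exact: cderivableM.
Qed.

Lemma cderivable_cst (c : R[i]) z : derivable (fun=> c : R[i]^o) z 1.
Proof. exact: derivable_cst. Qed.

Lemma cderivable_subr (c : R[i]) z : derivable (fun w : R[i]^o => w - c : R[i]^o) z 1.
Proof.
by apply: cderivableB; [exact: derivable_id|exact: cderivable_cst].
Qed.

Lemma cderivable_div_subr F (a : R[i]) z : z - a != 0 -> derivable F z 1 ->
  derivable (fun w : R[i]^o => F w / (w - a) : R[i]^o) z 1.
Proof.
move=> za dF; apply: (cderivableM dF).
exact: (@cderivableV (fun w : R[i]^o => w - a) z za (@cderivable_subr a z)).
Qed.

End PointwiseDerivable.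

(** * Cauchy's estimate and the maximum modulus principle on rectangles *)

Section MaximumModulus.
Variable R : realType.
Implicit Types (F : R[i]^o -> R[i]^o) (e r : R) (a z w : R[i]).

Definition difference_quotient F a (l : R[i]) (z : R[i]^o) : R[i]^o :=
  if z == a then l else (F z - F a) / (z - a).

Lemma derivable_difference_quotient F a l z : z != a -> derivable F z 1 ->
  derivable (difference_quotient F a l) z 1.
Proof.
move=> za dF; have za0 : 0 < cnorm (z - a) by rewrite cnorm_gt0 subr_eq0.
have za' : z - a != 0 by rewrite subr_eq0.
have /derivable_cnormP[m Hm] : derivable (fun w : R[i]^o => (F w - F a) * (w - a)^-1 : R[i]^o) z 1.
  have d1 := cderivableB dF (@cderivable_cst _ (F a) z).
  exact: (cderivable_div_subr za' d1).
apply/derivable_cnormP; exists m => e e0; have [d d0 Hd] := Hm e e0.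
exists (Num.min d (cnorm (z - a))) => [|w]; first by rewrite lt_min d0.
rewrite lt_min => /andP[wd wa]; rewrite /difference_quotient (negbTE za).
case: eqP => [wE|_]; last exact: Hd.
by move: wa; rewrite wE cnormB ltxx.
Qed.

Lemma continuous_difference_quotient F a l (D : set R[i]^o) :
  (forall e, 0 < e -> exists2 d : R, 0 < d &
    forall w, cnorm (w - a) < d ->
      cnorm (F w - F a - l * (w - a)) <= e * cnorm (w - a)) ->
  (forall z, D z -> derivable F z 1) ->
  continuous_on_cnorm D (difference_quotient F a l).
Proof.
move=> Hl dF z Dz e e0; have [->|za] := eqVneq z a; last first.
  have dG := derivable_difference_quotient (l := l) za (dF z Dz).
  have [d d0 Hd] := derivable_cnorm_continuous dG e0.
  by exists d => // w _; exact: Hd.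
have [d d0 Hd] := Hl e e0; exists d => // w _ /Hd.
rewrite /difference_quotient eqxx; case: eqP => [->|/eqP wa].
  by move=> _; rewrite subrr normc0 ltW.
have wa0 : w - a != 0 by rewrite subr_eq0.
have -> : (F w - F a) / (w - a) - l = (F w - F a - l * (w - a)) / (w - a).
  by rewrite [RHS]mulrBl mulfK.
by rewrite normcM normcV ler_pdivrMr ?cnorm_gt0.
Qed.


(** The quotient is only known to be continuous at [a], so [goursat] is applied to rectangles
    avoiding [a]. They fill everything but a square of side [2 * r] about [a], on which the quotient
    is within 1 of [l]; its integral there is at most [M * r *+ 16], with [r] arbitrarily small. *)
Lemma contour_integral_difference_quotient F a l x0 x1 y0 y1 :
  (forall e, 0 < e -> exists2 d : R, 0 < d &
    forall w, cnorm (w - a) < d ->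
      cnorm (F w - F a - l * (w - a)) <= e * cnorm (w - a)) ->
  (forall z, rectangle x0 x1 y0 y1 z -> derivable F z 1) ->
  x0 < complex.Re a < x1 -> y0 < complex.Im a < y1 ->
  contour_integral (difference_quotient F a l) x0 x1 y0 y1 = 0.
Proof.
move=> Hl dF ax ay; set G := difference_quotient F a l.
move: ax ay; set p := complex.Re a; set q := complex.Im a.
move=> /andP[ax0 ax1] /andP[ay0 ay1].
have cG := continuous_difference_quotient Hl dF.
have [d d0 Hd] := cG a (conj (introT andP (conj (ltW ax0) (ltW ax1)))
  (introT andP (conj (ltW ay0) (ltW ay1)))) 1 ltr01.
pose M := cnorm l + 1.
have M0 : 0 < M by rewrite ltr_wpDl ?cnorm_ge0.
have Goff s t s' t' : x0 <= s -> s <= t -> t <= x1 -> y0 <= s' -> s' <= t' ->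
    t' <= y1 -> [|| p < s, t < p, q < s' | t' < q] ->
    contour_integral G s t s' t' = 0.
  move=> xs st tx ys st' ty off; apply: goursat => // z [/andP[z1 z2] /andP[z3 z4]].
  apply: derivable_difference_quotient; last first.
    by apply: dF; split; apply/andP; split; [exact: le_trans z1|exact: le_trans tx
      |exact: le_trans z3|exact: le_trans ty].
  by apply: contraTneq off => za; rewrite /p /q -za !negb_or -!leNgt z1 z2 z3 z4.
pose r0 := Num.min (Num.min (p - x0) (x1 - p)) (Num.min (q - y0) (y1 - q)).
have r00 : 0 < r0 by rewrite /r0 !lt_min !subr_gt0 ax0 ax1 ay0 ay1.
have small r : 0 < r -> r < r0 -> r *+ 2 < d ->
    cnorm (contour_integral G x0 x1 y0 y1) <= M * r *+ 16.
  move=> rpos; rewrite /r0 !lt_min => /andP[/andP[r1 r2] /andP[r3 r4]] rd.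
  have [P1 P2 P3] : [/\ x0 <= p - r, p - r <= p + r & p + r <= x1].
    by clear -rpos r1 r2; split; lra.
  have [Q1 Q2 Q3] : [/\ y0 <= q - r, q - r <= q + r & q + r <= y1].
    by clear -rpos r3 r4; split; lra.
  have [pr rp qr rq] : [/\ p - r < p, p < p + r, q - r < q & q < q + r].
    by clear -rpos; split; lra.
  have P12 := le_trans P1 P2; have P23 := le_trans P2 P3; have P13 := le_trans P1 P23.
  have Q12 := le_trans Q1 Q2; have Q23 := le_trans Q2 Q3; have Q13 := le_trans Q1 Q23.
  have Gs s t s' t' : x0 <= s -> t <= x1 -> y0 <= s' -> t' <= y1 ->
      continuous_on_cnorm (rectangle s t s' t') G.
    move=> xs tx ys ty; apply: continuous_on_sub cG => z [/andP[z1 z2] /andP[z3 z4]].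
    by split; apply/andP; split; [exact: le_trans z1|exact: le_trans tx
      |exact: le_trans z3|exact: le_trans ty].
  rewrite (@contour_integral_hsplit _ G x0 (p - r) x1)//.
  rewrite (@contour_integral_hsplit _ G (p - r) (p + r) x1)//; last exact: Gs.
  rewrite (@Goff x0 (p - r) y0 y1)// ?pr ?orbT//.
  rewrite (@Goff (p + r) x1 y0 y1)// ?rp// add0r addr0.
  rewrite (@contour_integral_vsplit _ G _ _ y0 (q - r) y1)//; last exact: Gs.
  rewrite (@contour_integral_vsplit _ G _ _ (q - r) (q + r) y1)//; last exact: Gs.
  rewrite (@Goff _ _ y0 (q - r))// ?qr ?orbT//.
  rewrite (@Goff _ _ (q + r) y1)// ?rq ?orbT// add0r addr0.
  apply: le_trans (contour_integral_le (M := M) _ _ _ _) _ => //.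
  - by apply: continuous_on_sub (Gs _ _ _ _ P1 P3 Q1 Q3) => z [].
  - move=> z [[/andP[z1 z2] /andP[z3 z4]] _].
    apply: le_trans (cnorm_triangle _ l) _; rewrite lerD2l.
    have <- : G a = l by rewrite /G /difference_quotient eqxx.
    apply: Hd; first by split; apply/andP; split; [exact: le_trans z1|exact: le_trans P3
      |exact: le_trans z3|exact: le_trans Q3].
    apply: le_lt_trans (cnorm_le_ReIm _) _; rewrite ReD ReN ImD ImN.
    apply: le_lt_trans rd; rewrite mulr2n; apply: lerD; rewrite ler_norml -/p -/q.
      by clear -z1 z2; apply/andP; split; lra.
    by clear -z3 z4; apply/andP; split; lra.
  - by clear; rewrite le_eqVlt; apply/orP; left; apply/eqP; ring.
apply/eqP; apply: contraT; rewrite -(cnorm_gt0 (contour_integral G _ _ _ _)) => c0.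
set c := cnorm _ in small c0.
(* The last of these bounds makes [M * r *+ 16] at most half of [c]. *)
pose r := Num.min (Num.min (r0 / 2) (d / 4)) (c / (M * 32)).
have rpos : 0 < r.
  by rewrite /r !lt_min; rewrite !divr_gt0// mulr_gt0.
have /andP[/andP[rr0 rd] rc] : (r <= r0 / 2) && (r <= d / 4) && (r <= c / (M * 32)).
  by rewrite -!le_min.
have := small r rpos; have -> : r < r0 by lra.
have -> : r *+ 2 < d by rewrite mulr2n; lra.
move=> /(_ isT isT); rewrite ler_pdivlMr ?mulr_gt0// in rc.
rewrite -mulr_natr -mulrA (mulrC M) -mulrA => H.
have : c *+ 2 <= c by apply: le_trans rc; rewrite mulr2n; move: H; lra.
by rewrite mulr2n gerDl leNgt c0.
Qed.

End MaximumModulus.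

Section RectangleMaximum.
Variable R : realType.
Implicit Types (F : R[i]^o -> R[i]^o) (x y e r : R).

Local Arguments contour_integral : simpl never.

Lemma citv_integralZ (k : R[i]) (u : R -> R[i]) s t : citv_integrable u s t ->
  citv_integral (fun x => k * u x) s t = k * citv_integral u s t.
Proof.
move=> [u1 u2]; rewrite /citv_integral.
have I1 c : lebesgue_measure.-integrable `[s, t]
  (EFin \o (fun x => c * complex.Re (u x))).
  rewrite (_ : _ \o _ = fun x => c%:E * (complex.Re (u x))%:E)%E; last first.
    by apply/funext => x; rewrite /= EFinM.
  exact: (integrableZl _ c u1).
have I2 c : lebesgue_measure.-integrable `[s, t]
  (EFin \o (fun x => c * complex.Im (u x))).
  rewrite (_ : _ \o _ = fun x => c%:E * (complex.Im (u x))%:E)%E; last first.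
    by apply/funext => x; rewrite /= EFinM.
  exact: (integrableZl _ c u2).
under eq_Rintegral do rewrite ReM.
under [X in Complex _ X = _]eq_Rintegral do rewrite ImM.
rewrite RintegralB// RintegralD// !RintegralZl//.
by apply/eqP; rewrite eq_complex ReM ImM /= !eqxx.
Qed.

Lemma contour_integralZ (k : R[i]) F x0 x1 y0 y1 : x0 <= x1 -> y0 <= y1 ->
  continuous_on_cnorm (rectangle_boundary x0 x1 y0 y1) F ->
  contour_integral (fun z => k * F z) x0 x1 y0 y1 =
  k * contour_integral F x0 x1 y0 y1.
Proof.
move=> xx yy cF; have [[F1 F2] [F3 F4]] := rectangle_boundary_integrable xx yy cF.
rewrite /contour_integral; transitivity (
  citv_integral (fun x => k * (F (x +i* y0)%C - F (x +i* y1)%C)) x0 x1 +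
  'i%C * citv_integral (fun y => k * (F (x1 +i* y)%C - F (x0 +i* y)%C)) y0 y1).
  by congr (_ + _ * _); congr citv_integral; apply/funext => r; rewrite mulrBr.
rewrite (citv_integralZ _ (citv_integrableB F1 F2)).
by rewrite (citv_integralZ _ (citv_integrableB F4 F3)) mulrDr (mulrCA k).
Qed.

Lemma eq_contour_integral F G x0 x1 y0 y1 : x0 <= x1 -> y0 <= y1 ->
  (forall z, rectangle_boundary x0 x1 y0 y1 z -> F z = G z) ->
  contour_integral F x0 x1 y0 y1 = contour_integral G x0 x1 y0 y1.
Proof.
move=> xx yy FG.
have E (u v : R -> R[i]) s t : (forall x, s <= x <= t -> u x = v x) ->
    citv_integral u s t = citv_integral v s t.
  move=> uv; rewrite /citv_integral; congr Complex; apply: eq_Rintegral => x;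
    by rewrite inE/= in_itv/= => /uv ->.
rewrite /contour_integral; congr (_ + _ * _); apply: E => r rr;
  congr (_ - _); apply: FG.
- by split; [split; rewrite //= lexx|exact: Or43].
- by split; [split; rewrite //= lexx yy|exact: Or44].
- by split; [split; rewrite //= lexx xx|exact: Or42].
- by split; [split; rewrite //= lexx|exact: Or41].
Qed.

Lemma ReV (z : R[i]) : complex.Re z^-1 =
  complex.Re z / (complex.Re z ^+ 2 + complex.Im z ^+ 2).
Proof. by case: z. Qed.

Lemma Im_contour_integral F x0 x1 y0 y1 :
  complex.Im (contour_integral F x0 x1 y0 y1) =
  \int[lebesgue_measure]_(x in `[x0, x1])
    complex.Im (F (Complex x y0) - F (Complex x y1)) +
  \int[lebesgue_measure]_(y in `[y0, y1])
    complex.Re (F (Complex x1 y) - F (Complex x0 y)).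
Proof. by rewrite /contour_integral ImD ImM /= mul0r mul1r add0r. Qed.

Lemma rectangle_boundary_neq (a : R[i]) x0 x1 y0 y1 z :
  x0 < complex.Re a < x1 -> y0 < complex.Im a < y1 ->
  rectangle_boundary x0 x1 y0 y1 z -> z - a != 0.
Proof.
move=> ax ay [_ bz]; rewrite subr_eq0; apply: contraTneq ax => za.
move: bz ay; rewrite za; case: (a) => p q /=.
by case=> ->; rewrite ?ltxx ?andbF// => ->.
Qed.

(** Only non-vanishing is used, so the value 2 pi i is not computed: all four sides contribute a
    nonnegative imaginary part, and on the lower side the integrand is bounded below by a positive
    constant. *)
Lemma contour_integral_inv_gt0 (a : R[i]) x0 x1 y0 y1 :
  x0 < complex.Re a < x1 -> y0 < complex.Im a < y1 ->
  0 < complex.Im (contour_integral (fun z : R[i]^o => (z - a)^-1 : R[i]^o) x0 x1 y0 y1).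
Proof.
move=> ax ay.
have cI : continuous_on_cnorm (rectangle_boundary x0 x1 y0 y1)
    (fun z : R[i]^o => (z - a)^-1 : R[i]^o).
  apply: derivable_continuous_on => z bz.
  apply: (@cderivableV _ (fun w : R[i]^o => w - a) z).
    exact: rectangle_boundary_neq ax ay bz.
  exact: cderivable_subr.
rewrite Im_contour_integral; move: ax ay; case: a cI => p q cI.
rewrite [complex.Re (p +i* q)%C]/= [complex.Im (p +i* q)%C]/=.
move=> /andP[px0 px1] /andP[qy0 qy1].
have xx : x0 <= x1 by lra.
have yy : y0 <= y1 by lra.
have [[F1 F2] [F3 F4]] := rectangle_boundary_integrable xx yy cI.
have [_ Ih] := citv_integrableB F1 F2.
have [Iv _] := citv_integrableB F4 F3.
rewrite ltr_pwDl//; last first.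
  apply: Rintegral_ge0 => y _.
  rewrite ReD ReN !ReV !ReD !ReN /= subr_ge0.
  apply: (@le_trans _ _ 0).
    by rewrite mulr_le0_ge0 ?invr_ge0 ?addr_ge0 ?sqr_ge0// subr_le0 ltW.
  by apply: divr_ge0; [rewrite subr_ge0 ltW|rewrite addr_ge0 ?sqr_ge0].
pose P := (x1 - x0) ^+ 2 + (y1 - y0) ^+ 2.
have P0 : 0 < P by rewrite ltr_pwDl ?sqr_ge0// exprn_even_gt0//= subr_eq0; apply/eqP; lra.
apply: (@lt_le_trans _ _ ((q - y0) / P * (x1 - x0))).
  by rewrite mulr_gt0 ?divr_gt0 ?subr_gt0//; lra.
rewrite -Rintegral_cst_itv//; apply: le_Rintegral => //.
  by apply: continuous_compact_integrable;
    [exact: segment_compact|apply: continuous_subspaceT => x; exact: cst_continuous].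
move=> x; rewrite /= in_itv/= => /andP[xl xr].
rewrite opprK -mulNr opprB ler_wpDr//.
  by apply: divr_ge0; [rewrite subr_ge0 ltW|rewrite addr_ge0 ?sqr_ge0].
rewrite ler_pM2l ?subr_gt0// lef_pV2 ?posrE//; last first.
  by rewrite ltr_wpDl ?sqr_ge0// exprn_even_gt0//= subr_eq0 lt_eqF.
have sq (s t : R) : - t <= s <= t -> s ^+ 2 <= t ^+ 2.
  move=> st; rewrite -(real_normK (num_real s)) lerXn2r ?nnegrE ?ler_norml//.
  by move: st => /andP[]; lra.
by apply: lerD; apply: sq; clear - px0 px1 qy0 qy1 xl xr; apply/andP; split; lra.
Qed.

(** Cauchy's formula with an unevaluated factor: the integral of F(z)/(z - a) is [F a] times that of
    1/(z - a), because the difference quotient integrates to 0. The constant is crude, but it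
    depends only on [a] and the rectangle and so serves all powers of a function at once. *)
Lemma cauchy_bound (a : R[i]) x0 x1 y0 y1 :
  x0 < complex.Re a < x1 -> y0 < complex.Im a < y1 ->
  exists2 C : R, 0 <= C & forall F M,
    (forall z, rectangle x0 x1 y0 y1 z -> derivable F z 1) -> 0 <= M ->
    (forall z, rectangle_boundary x0 x1 y0 y1 z -> cnorm (F z) <= M) ->
    cnorm (F a) <= C * M.
Proof.
move=> ax ay.
have /andP[ax0 ax1] := ax; have /andP[ay0 ay1] := ay.
have xx : x0 <= x1 by lra.
have yy : y0 <= y1 by lra.
pose J := contour_integral (fun z : R[i]^o => (z - a)^-1 : R[i]^o) x0 x1 y0 y1.
have J0 : 0 < cnorm J.
  apply: lt_le_trans (normr_Im_le J); rewrite normr_gt0 gt_eqF//.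
  exact: contour_integral_inv_gt0.
pose rho := Num.min (Num.min (complex.Re a - x0) (x1 - complex.Re a))
  (Num.min (complex.Im a - y0) (y1 - complex.Im a)).
have rho0 : 0 < rho by rewrite /rho !lt_min !subr_gt0 ax0 ax1 ay0 ay1.
have zrho z : rectangle_boundary x0 x1 y0 y1 z -> rho <= cnorm (z - a).
  move=> [_ bz]; have HR := normr_Re_le (z - a); have HI := normr_Im_le (z - a).
  rewrite ReD ReN in HR; rewrite ImD ImN in HI.
  have [] : rho <= complex.Re a - x0 /\ rho <= x1 - complex.Re a.
    by rewrite /rho !ge_min !lexx !orbT.
  have [] : rho <= complex.Im a - y0 /\ rho <= y1 - complex.Im a.
    by rewrite /rho !ge_min !lexx !orbT.
  move=> b1 b2 b3 b4.
  case: bz => E; rewrite E in HR HI; move: HR HI; rewrite !ler_norml => /andP[? ?] /andP[? ?]; lra.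
exists (((x1 - x0) + (y1 - y0)) *+ 4 / (rho * cnorm J)) => [|F M dF M0 FM].
  apply: divr_ge0; last by apply: mulr_ge0; exact: ltW.
  by apply: mulrn_wge0; apply: addr_ge0; rewrite subr_ge0.
have /derivable_cnormP[l Hl] : derivable F a 1.
  by apply: dF; split; rewrite ?ax0 ?ax1 ltW//= ltW.
have G0 := contour_integral_difference_quotient Hl dF ax ay.
have dFz z : rectangle_boundary x0 x1 y0 y1 z ->
    derivable (fun w : R[i]^o => F w / (w - a) : R[i]^o) z 1.
  move=> bz; apply: (cderivable_div_subr (rectangle_boundary_neq ax ay bz)).
  by apply: dF; case: bz.
have dI z : rectangle_boundary x0 x1 y0 y1 z ->
    derivable (fun w : R[i]^o => (w - a)^-1 : R[i]^o) z 1.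
  move=> bz; apply: (@cderivableV _ (fun w : R[i]^o => w - a) z).
    exact: rectangle_boundary_neq ax ay bz.
  exact: cderivable_subr.
have cI := derivable_continuous_on dI.
have cQ := derivable_continuous_on dFz.
have cIa : continuous_on_cnorm (rectangle_boundary x0 x1 y0 y1)
    (fun w : R[i]^o => F a * (w - a)^-1 : R[i]^o).
  apply: derivable_continuous_on => z bz; apply: cderivableM (dI z bz).
  exact: cderivable_cst.
have E : contour_integral (fun w : R[i]^o => F w / (w - a) : R[i]^o) x0 x1 y0 y1 =
    F a * J.
  rewrite -contour_integralZ//; apply/eqP; rewrite -subr_eq0 -contour_integralB//.
  rewrite -[X in _ == X]G0; apply/eqP; apply: eq_contour_integral => // z bz.
  have za := rectangle_boundary_neq ax ay bz.
  by rewrite /difference_quotient -subr_eq0 (negbTE za) mulrBl.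
rewrite -(ler_pM2r J0) -normcM -E.
apply: le_trans (contour_integral_le (M := M / rho) xx yy cQ _) _.
  move=> z bz; rewrite normcM normcV ler_pM ?cnorm_ge0 ?invr_ge0 ?cnorm_ge0//.
    exact: FM.
  by rewrite lef_pV2 ?posrE ?zrho// (lt_le_trans rho0)// zrho.
rewrite le_eqVlt; apply/orP; left; apply/eqP.
rewrite invfM mulrnAl !mulrnAl; congr (_ *+ 4).
rewrite mulrC -!mulrA; congr (_ * _).
by rewrite mulrC; congr (_ * _); rewrite mulrCA mulVf ?mulr1// gt_eqF.
Qed.

(** The power trick: [cauchy_bound] applied to the n-th power of [F] keeps its constant, so |F a|^n
    <= C M^n for every n. If |F a| exceeded M, the left side would outgrow the right one. *)
Lemma maximum_modulus (a : R[i]) x0 x1 y0 y1 F M :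
  x0 < complex.Re a < x1 -> y0 < complex.Im a < y1 ->
  (forall z, rectangle x0 x1 y0 y1 z -> derivable F z 1) -> 0 <= M ->
  (forall z, rectangle_boundary x0 x1 y0 y1 z -> cnorm (F z) <= M) ->
  cnorm (F a) <= M.
Proof.
move=> ax ay dF M0 FM; have [C C0 HC] := cauchy_bound ax ay.
rewrite leNgt; apply/negP => MF.
have Fa0 : 0 < cnorm (F a) by exact: le_lt_trans MF.
have H n : 1 <= C * (M / cnorm (F a)) ^+ n.
  rewrite expr_div_n mulrA ler_pdivlMr ?exprn_gt0// mul1r -cnormX.
  apply: (HC (fun z => F z ^+ n)) => [z rz||z bz].
  - by apply: cderivableX; exact: dF.
  - exact: exprn_ge0.
  - by rewrite cnormX lerXn2r ?nnegrE ?cnorm_ge0// FM.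
have q1 : `|M / cnorm (F a)| < 1.
  by rewrite ger0_norm ?divr_ge0 ?cnorm_ge0// ltr_pdivrMr// mul1r.
have C1 : 0 < C + 1 by rewrite ltr_wpDl.
have /cvgrPdist_lt/(_ (C + 1)^-1) := cvg_expr q1.
rewrite invr_gt0 => /(_ C1)[N _ /(_ N (leqnn N))] /=.
rewrite sub0r normrN ger0_norm ?exprn_ge0 ?divr_ge0 ?cnorm_ge0// => Hq.
have := H N; rewrite leNgt => /negP; apply.
apply: (@le_lt_trans _ _ (C * (C + 1)^-1)); first by rewrite ler_wpM2l// ltW.
by rewrite ltr_pdivrMr// mul1r ltrDl.
Qed.

End RectangleMaximum.

(** * The maximum principle for bounded functions on the strip *)

Section StripMaximum.
Variable R : realType.
Implicit Types (phi : R[i]^o -> R[i]^o) (x y e r : R).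

Lemma closed_strip_ReP (z : R[i]^o) :
  0 <= complex.Re z <= 1 -> @closed_strip R z.
Proof.
move=> /andP[z0 z1] B /nbhs_cnormP[d d0 Bd].
pose t := Num.min (d / 2) 2^-1.
have t0 : 0 < t by rewrite lt_min divr_gt0//= invr_gt0.
have td : t < d by rewrite /t gt_min; apply/orP; left; lra.
have t1 : t < 1 by rewrite /t gt_min; apply/orP; right; lra.
(* A displacement towards the line Re = 1/2 enters the open strip from either side. *)
pose s := t * (2^-1 - complex.Re z).
exists (z + s%:C%C); split.
  rewrite /strip/= ReD /= /s; apply/andP; split; nra.
apply: Bd; rewrite addrAC subrr add0r cnorm_real.
apply: le_lt_trans td; rewrite /s normrM gtr0_norm//.
by rewrite ler_piMr ?(ltW t0)// ler_norml; apply/andP; split; lra.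
Qed.

(* Compactness of the vertical segment turns continuity on the closed strip
   into a bound which is uniform near the boundary line. *)
Lemma near_boundary_bound phi (u : R -> R) (N e : R) :
  (forall z : R[i]^o, 0 <= complex.Re z <= 1 -> forall e, 0 < e ->
    exists2 d : R, 0 < d & forall w : R[i]^o, 0 <= complex.Re w <= 1 ->
      cnorm (w - z) < d -> cnorm (phi w - phi z) <= e) ->
  (forall s, 0 <= s <= 1 -> 0 <= u s <= 1 /\ `|u s - u 0| <= s) ->
  (forall y, cnorm (phi (Complex (u 0) y)) <= 1) -> 0 < e ->
  exists2 d : R, 0 < d & forall s, 0 <= s < d -> forall y, - N <= y <= N ->
    cnorm (phi (Complex (u s) y)) <= 1 + e.
Proof.
move=> cphi Hu Hphi e0.
have /compact_near_coveringP/(_ R (nbhs (0:R)) (fun s y => 0 <= s <= 1 ->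
  cnorm (phi (Complex (u s) y)) <= 1 + e)) := @segment_compact R (- N) N.
have u01 : 0 <= u 0 <= 1 by apply: (proj1 (Hu 0 _)); rewrite lexx ler01.
case.
  move=> y _; have [d d0 Hd] := cphi (Complex (u 0) y) u01 e e0.
  exists (ball y (d / 2), ball (0:R) (d / 2)) => /=.
    by split; apply: nbhsx_ballx; rewrite divr_gt0.
  move=> [y' s] [/= yy' ss] s01; have [us0 us1] := Hu s s01.
  apply: le_trans (cnorm_triangle _ (phi (Complex (u 0) y))) _.
  rewrite lerD//; apply: Hd => //.
  apply: le_lt_trans (cnorm_le_ReIm _) _; rewrite /= [ltRHS](splitr d).
  apply: ltrD; last by rewrite distrC.
  apply: le_lt_trans us1 _; move: ss; rewrite /ball/= sub0r normrN.
  by apply: le_lt_trans; exact: ler_norm.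
move=> d /= d0 H; exists (Num.min d 1) => [|s /andP[s0]]; first by rewrite lt_min d0/=.
rewrite lt_min => /andP[sd s1] y yN; apply: (H s) => //.
  by rewrite /= sub0r normrN ger0_norm.
by rewrite s0 ltW.
Qed.

(** Division by [q z = 1 + t z], whose modulus grows with the height, makes [phi] harmless on the
    horizontal sides of a tall rectangle; it costs a factor [1 + t] at the end. The vertical sides
    are moved inwards by [dl], because [phi] is holomorphic in the open strip only; this costs
    another [1 + t]. Then [t] tends to 0. *)
Lemma strip_maximum phi (K : R) : holomorphic_on (@strip R) phi ->
  {within @closed_strip R, continuous phi} ->
  (forall z, @closed_strip R z -> cnorm (phi z) <= K) ->
  (forall s : R, cnorm (phi (Complex 0 s)) <= 1) ->
  (forall s : R, cnorm (phi (Complex 1 s)) <= 1) ->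
  forall theta : R, 0 < theta < 1 -> cnorm (phi (Complex theta 0)) <= 1.
Proof.
move=> hphi cphi phiK phi0 phi1 th /andP[th0 th1].
have cphi' (z : R[i]^o) : 0 <= complex.Re z <= 1 -> forall e, 0 < e ->
    exists2 d : R, 0 < d & forall w : R[i]^o, 0 <= complex.Re w <= 1 ->
      cnorm (w - z) < d -> cnorm (phi w - phi z) <= e.
  move=> /closed_strip_ReP zS e e0.
  have [d d0 Hd] := within_continuous_cnorm cphi zS e0.
  by exists d => // w /closed_strip_ReP; exact: Hd.
suff main t : 0 < t -> cnorm (phi (Complex th 0)) <= (1 + t) * (1 + t).
  apply/ler_addgt0Pr => e e0.
  (* For [t <= 1] the square of [1 + t] is at most [1 + 3 * t]. *)
  pose t := Num.min 1 (e / 3).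
  have t0 : 0 < t by rewrite lt_min ltr01 divr_gt0.
  apply: le_trans (main t t0) _.
  have /andP[t1 te] : (t <= 1) && (t <= e / 3) by rewrite -le_min.
  by nra.
move=> t0.
have K0 : 0 <= K.
  apply: le_trans (phiK 0 _); first exact: cnorm_ge0.
  by apply: closed_strip_ReP; rewrite /= lexx ler01.
(* At height [N] the modulus of [q] is at least [t * N = t + K], hence above [K]. *)
pose N := 1 + K / t.
have N0 : 0 < N by rewrite ltr_wpDr// divr_ge0// ltW.
have [|d1 d10 H1] := @near_boundary_bound phi id N t cphi' _ phi0 t0.
  by move=> s /andP[s0 s1]; rewrite subr0 ger0_norm// s0 s1 lexx.
have [||d2 d20 H2] := @near_boundary_bound phi (fun s => 1 - s) N t cphi' _ _ t0.
- move=> s /andP[s0 s1]; rewrite subr0 (addrC 1) addrK normrN ger0_norm// lexx.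
  by split => //; apply/andP; split; lra.
- by move=> y; rewrite subr0.
pose dl := Num.min (Num.min (d1 / 2) (d2 / 2)) (Num.min (th / 2) ((1 - th) / 2)).
have dl0 : 0 < dl.
  by rewrite /dl !lt_min !divr_gt0// subr_gt0.
have : (dl <= d1 / 2) && (dl <= d2 / 2) && ((dl <= th / 2) && (dl <= (1 - th) / 2)).
  by rewrite -!le_min.
move=> /andP[/andP[dd1 dd2] /andP[dth dth1]].
pose q (z : R[i]^o) : R[i]^o := 1 + t%:C%C * z.
have qE z : q z = Complex (1 + t * complex.Re z) (t * complex.Im z).
  by apply/eqP; rewrite eq_complex /q ReD ImD ReM ImM /= !mul0r subr0 addr0 add0r !eqxx.
have qge z : 0 <= complex.Re z -> 1 <= cnorm (q z) /\ t * `|complex.Im z| <= cnorm (q z).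
  move=> z0; split.
    apply: le_trans (normr_Re_le _); rewrite qE /= ger0_norm ?addr_ge0//.
      by rewrite lerDl mulr_ge0// ltW.
    by rewrite mulr_ge0// ltW.
  by apply: le_trans (normr_Im_le _); rewrite qE /= normrM gtr0_norm.
have dq z : derivable q z 1.
  apply: (@cderivableD _ (fun=> 1) (fun z => t%:C%C * z)); first exact: cderivable_cst.
  by apply: (@cderivableM _ (fun=> t%:C%C) id); [exact: cderivable_cst|exact: derivable_id].
have t1 : 1 <= 1 + t by rewrite lerDl ltW.
have tp : 0 <= 1 + t by exact: le_trans t1.
have psi_le : cnorm (phi (Complex th 0) / q (Complex th 0)) <= 1 + t.
  apply: (@maximum_modulus _ _ dl (1 - dl) (- N) N (fun z => phi z / q z)).
  - by rewrite /=; apply/andP; split; lra.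
  - by rewrite /= oppr_lt0 N0.
  - move=> z [/andP[z1 z2] _].
    have z0 : 0 <= complex.Re z by lra.
    have q0 : q z != 0 by rewrite -cnorm_gt0; have [] := qge z z0; lra.
    apply: cderivableM; last exact: (cderivableV q0 (dq z)).
    by apply: hphi; rewrite /strip/=; apply/andP; split; lra.
  - exact: tp.
  - move=> z [[/andP[z1 z2] zI] bz].
    have z0 : 0 <= complex.Re z by lra.
    have [qz1 qz2] := qge z z0; have qz0 := lt_le_trans ltr01 qz1.
    rewrite normcM normcV ler_pdivrMr//.
    have zS : @closed_strip R z by apply: closed_strip_ReP; apply/andP; split; lra.
    have horiz : `|complex.Im z| = N -> cnorm (phi z) <= (1 + t) * cnorm (q z).
      move=> E; rewrite E in qz2; apply: le_trans (phiK z zS) _.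
      apply: (@le_trans _ _ (cnorm (q z))).
        apply: le_trans qz2; rewrite /N mulrDr mulr1 mulrC divfK ?gt_eqF//.
        by rewrite lerDr ltW.
      by rewrite ler_peMl ?cnorm_ge0.
    have vert : cnorm (phi z) <= 1 + t -> cnorm (phi z) <= (1 + t) * cnorm (q z).
      by move=> /le_trans; apply; rewrite ler_peMr.
    case: bz => E.
    + apply: vert; move: E zI; case: (z) => a b /= -> zI.
      by apply: (H1 dl) => //; rewrite ltW//=; lra.
    + apply: vert; move: E zI; case: (z) => a b /= -> zI.
      by apply: (H2 dl) => //; rewrite ltW//=; lra.
    + by apply: horiz; rewrite E normrN gtr0_norm.
    + by apply: horiz; rewrite E gtr0_norm.
have [qz1 _] := qge (Complex th 0) (ltW th0).
have qz0 := lt_le_trans ltr01 qz1.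
move: psi_le; rewrite normcM normcV ler_pdivrMr// => /le_trans; apply.
rewrite ler_wpM2l//.
apply: le_trans (cnorm_le_ReIm _) _; rewrite qE /= mulr0 normr0 addr0.
have tth : 0 <= t * th by rewrite mulr_ge0// ltW.
by rewrite ger0_norm ?addr_ge0// lerD2l ler_piMr// ltW.
Qed.

End StripMaximum.

(** * The complex exponential and its derivative *)

Section ComplexExponential.
Variable R : realType.
Implicit Types (z w : R[i]) (x y e : R).

Definition cexp (z : R[i]^o) : R[i]^o :=
  Complex (expR (complex.Re z) * cos (complex.Im z))
          (expR (complex.Re z) * sin (complex.Im z)).

Lemma cexpD z w : cexp (z + w) = cexp z * cexp w.
Proof.
apply/eqP; rewrite eq_complex ReM ImM /= ReD ImD expRD cosD sinD.
by apply/andP; split; apply/eqP; ring.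
Qed.

Lemma cexp_real x : cexp x%:C%C = (expR x)%:C%C.
Proof. by rewrite /cexp /= cos0 sin0 mulr1 mulr0. Qed.

Lemma cnorm_cexp z : cnorm (cexp z) = expR (complex.Re z).
Proof.
rewrite /cexp /normc !exprMn -mulrDr cos2Dsin2 mulr1 sqrtr_sqr.
by rewrite ger0_norm// expR_ge0.
Qed.

Lemma is_derive_normP (f : R -> R) (l : R) : is_derive (0:R) 1 f l ->
  forall e, 0 < e -> exists2 d : R, 0 < d &
    forall x, `|x| < d -> `|f x - f 0 - l * x| <= e * `|x|.
Proof.
move=> [df fl] e e0.
move: df => /cvg_ex[l' Hl'].
have {fl} ll' : l' = l by rewrite -fl /derive; apply/esym/cvg_lim.
move: Hl' => /cvgrPdist_le/(_ e e0); rewrite ll' near_withinE => -[d /= d0 Hd].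
exists d => // x xd; have [->|x0] := eqVneq x 0.
  by rewrite subrr mulr0 subr0 normr0 mulr0.
have := Hd x; rewrite /= sub0r normrN => /(_ xd x0).
rewrite addr0 [_ *: 1]mulr1 => H.
have -> : f x - f 0 - l * x = - (l - x^-1 * (f x - f 0)) * x.
  by rewrite opprB mulrBl mulrAC mulVf// mul1r.
by rewrite normrM normrN ler_wpM2r.
Qed.

Lemma derivable_cexp0 : forall e, 0 < e -> exists2 d : R, 0 < d &
  forall z, cnorm z < d -> cnorm (cexp z - 1 - z) <= e * cnorm z.
Proof.
(* Real and imaginary parts of the remainder are each at most [3 * e' * cnorm z]; the cap at 1 keeps
   [expR] of the real part below 2. *)
move=> e e0; pose e' := Num.min (e / 6) 1.
have e'0 : 0 < e' by rewrite lt_min divr_gt0//=.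
have /andP[e'e e'1] : (e' <= e / 6) && (e' <= 1) by rewrite -le_min.
have dexp : is_derive (0:R) 1 (@expR R) 1.
  by have := is_derive_expR (0:R); rewrite expR0.
have dcos : is_derive (0:R) 1 (@cos R) 0.
  by have := is_derive_cos (0:R); rewrite sin0 oppr0.
have dsin : is_derive (0:R) 1 (@sin R) 1.
  by have := is_derive_sin (0:R); rewrite cos0.
have [d1 d10 H1] := is_derive_normP dexp e'0.
have [d2 d20 H2] := is_derive_normP dcos e'0.
have [d3 d30 H3] := is_derive_normP dsin e'0.
pose d := Num.min (Num.min d1 d2) (Num.min d3 (e' / 2)).
exists d => [|z]; first by rewrite !lt_min d10 d20 d30 divr_gt0.
rewrite !lt_min => /andP[/andP[zd1 zd2] /andP[zd3 ze]].
have xz := normr_Re_le z; have yz := normr_Im_le z.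
have {H1} := H1 _ (le_lt_trans xz zd1).
have {H2} := H2 _ (le_lt_trans yz zd2).
have {H3} := H3 _ (le_lt_trans yz zd3).
rewrite sin0 cos0 expR0 subr0 mul0r subr0 !mul1r.
set r := cnorm z in xz yz zd1 zd2 zd3 ze *; have r0 : 0 <= r by exact: cnorm_ge0.
move=> Hs Hc He; apply: le_trans (cnorm_le_ReIm _) _; move: Hs Hc He.
rewrite !(ReD, ReN, ImD, ImN) /cexp /= oppr0 addr0.
set x := complex.Re z in xz *; set y := complex.Im z in yz *.
set E := expR x; set c := cos y; set s := sin y => Hs Hc He.
have er : e' * r <= e / 6 * r by rewrite ler_wpM2r.
have ex : e' * `|x| <= e' * r by rewrite ler_wpM2l// ltW.
have ey : e' * `|y| <= e' * r by rewrite ler_wpM2l// ltW.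
have x1 : e' * `|x| <= `|x| by rewrite ler_piMl.
have E1 : `|E - 1| <= e'.
  rewrite -(subrK x (E - 1)); apply: le_trans (ler_normD _ _) _; lra.
have E2 : `|E| <= 2.
  rewrite -(subrK 1 E); apply: le_trans (ler_normD _ _) _; rewrite normr1; lra.
have A1 : `|E * c - 1 - x| <= e' * r *+ 3.
  have -> : E * c - 1 - x = E * (c - 1) + (E - 1 - x) by ring.
  apply: le_trans (ler_normD _ _) _; rewrite normrM.
  have : `|E| * `|c - 1| <= 2 * (e' * r) by rewrite ler_pM// (le_trans Hc).
  lra.
have A2 : `|E * s - y| <= e' * r *+ 3.
  have -> : E * s - y = E * (s - y) + (E - 1) * y by ring.
  apply: le_trans (ler_normD _ _) _; rewrite !normrM.
  have : `|E| * `|s - y| <= 2 * (e' * r) by rewrite ler_pM// (le_trans Hs).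
  have : `|E - 1| * `|y| <= e' * r by rewrite ler_pM.
  lra.
have -> : E * s - y = E * s - y by [].
move: A1 A2 er; clear; lra.
Qed.

Lemma derivable_cexp z : derivable cexp z 1.
Proof.
apply/derivable_cnormP; exists (cexp z) => e e0.
have c0 : 0 < cnorm (cexp z) by rewrite cnorm_cexp expR_gt0.
have [d d0 Hd] := derivable_cexp0 (divr_gt0 e0 c0).
exists d => // w /Hd.
have -> : cexp w - cexp z - cexp z * (w - z) = cexp z * (cexp (w - z) - 1 - (w - z)).
  by rewrite -{1}(subrKC z w) cexpD; ring.
move=> H; rewrite normcM mulrC -ler_pdivlMr//.
by apply: le_trans H _; rewrite mulrAC.
Qed.

Lemma derivable_cexp_affine (k l : R[i]) (z : R[i]^o) :
  derivable (fun w : R[i]^o => cexp (k + l * w)) z 1.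
Proof.
have [->|l0] := eqVneq l 0.
  by under eq_fun do rewrite mul0r; exact: cderivable_cst.
have /derivable_cnormP[m Hm] := @derivable_cexp (k + l * z).
apply/derivable_cnormP; exists (m * l) => e e0.
have c0 : 0 < cnorm l by rewrite cnorm_gt0.
have [d d0 Hd] := Hm _ (divr_gt0 e0 c0).
exists (d / cnorm l) => [|w wz]; first exact: divr_gt0.
have E : k + l * w - (k + l * z) = l * (w - z) by ring.
rewrite -mulrA -E; apply: le_trans (Hd (k + l * w) _) _.
  by rewrite E normcM mulrC -ltr_pdivlMr.
by rewrite E normcM mulrA divfK ?gt_eqF.
Qed.

End ComplexExponential.

(** * Level sets of maximal and sharp functions *)

Section MetricBalls.
Context (R : realType) (M : pointedMetricType R).
Implicit Types (x y c : M) (r s : R) (B : M * R).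

Lemma ballP c r x : ball c r x = (mdist c x < r) :> Prop.
Proof. by rewrite ballEmdist. Qed.

Lemma mem_ball_center c r : 0 < r -> ball c r c.
Proof. by rewrite ballP mdistxx. Qed.

Lemma sub_ball c r c' r' : mdist c c' + r <= r' -> ball c r `<=` ball c' r'.
Proof.
move=> H x; rewrite !ballP => cx.
apply: le_lt_trans (metric_triangle _ c _) _.
by rewrite metric_sym; apply: lt_le_trans H; rewrite ltrD2l.
Qed.

Lemma open_metricP (A : set M) :
  open A <-> forall x, A x -> exists2 r, 0 < r & ball x r `<=` A.
Proof.
split=> [oA x Ax|H].
  have : nbhs x A by exact: open_nbhs_nbhs.
  by rewrite -nbhs_ballE => -[r /= r0 Hr]; exists r.
rewrite openE => x /H[r r0 Hr]; rewrite /interior -nbhs_ballE.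
by exists r.
Qed.

Lemma open_ball_metric c r : open (ball c r).
Proof.
apply/open_metricP => x; rewrite ballP => cx.
exists (r - mdist c x); first by rewrite subr_gt0.
by apply: sub_ball; rewrite metric_sym subrKC.
Qed.

Lemma measurable_open (A : set M) : open A -> measurable (A : set (borel M)).
Proof. by move=> oA; apply: sub_sigma_algebra. Qed.

Lemma measurable_ball_metric c r : measurable (ball c r : set (borel M)).
Proof. by apply: measurable_open; exact: open_ball_metric. Qed.

Definition balls_union (P : set (M * R)) : set M := \bigcup_(B in P) ball B.1 B.2.

Lemma open_balls_union (P : set (M * R)) : open (balls_union P).
Proof. by apply: bigcup_open => B _; exact: open_ball_metric. Qed.

Lemma measurable_balls_union (P : set (M * R)) :
  measurable (balls_union P : set (borel M)).
Proof. by apply: measurable_open; exact: open_balls_union. Qed.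

(** Greedy selection: a ball of largest radius is kept and all balls meeting it are discarded. A
    discarded ball is no larger than the kept one, so it lies in the threefold dilate. The induction
    is on the length of the list that remains. *)
Lemma finite_vitali (s : seq (M * R)) :
  (forall B, B \in s -> 0 < B.2) ->
  exists t : seq (M * R), [/\ uniq t, {subset t <= s},
    trivIset [set` t] (fun B : M * R => ball B.1 B.2) &
    forall B, B \in s -> exists2 B', B' \in t & ball B.1 B.2 `<=` ball B'.1 (3 * B'.2)].
Proof.
have [n] := ubnP (size s); elim: n s => // n IH s sn s0.
case: s sn s0 => [_ _|B0 s0 sn spos]; first by exists [::]; split.
pose s := B0 :: s0.
have [Bm Bms Bmax] : exists2 B, B \in s & forall B', B' \in s -> B'.2 <= B.2.
  rewrite /s; clear; elim: s0 B0 => [B|B' s IH B].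
    by exists B; rewrite ?mem_head// => B'; rewrite inE => /eqP ->.
  have [Bm Bms Hm] := IH B'.
  have [BB|BB] := leP Bm.2 B.2.
    exists B; rewrite ?mem_head// => B1; rewrite inE => /orP[/eqP ->//|/Hm].
    by move=> /le_trans; apply.
  exists Bm; first by rewrite inE Bms orbT.
  by move=> B1; rewrite inE => /orP[/eqP ->|/Hm//]; exact: ltW.
pose meets (B : M * R) := `[< ball B.1 B.2 `&` ball Bm.1 Bm.2 !=set0 >].
have Bm0 : 0 < Bm.2 by exact: spos.
have mBm : meets Bm.
  by apply/asboolP; exists Bm.1; split; exact: mem_ball_center.
have szf : (size [seq B <- s | ~~ meets B] < n)%N.
  rewrite size_filter; apply: (@leq_trans (size s)); last exact: sn.
  rewrite -(count_predC meets s) -[X in (X < _)%N]add0n ltn_add2r -has_count.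
  by apply/hasP; exists Bm.
have [|t [ut ts tt Ht]] := IH _ szf.
  by move=> B; rewrite mem_filter => /andP[_ /spos].
exists (Bm :: t); split.
- rewrite /= ut andbT; apply/negP => /ts; rewrite mem_filter mBm//.
- move=> B; rewrite inE => /orP[/eqP ->//|/ts].
  by rewrite mem_filter => /andP[].
- have dis B : B \in t -> ball B.1 B.2 `&` ball Bm.1 Bm.2 !=set0 -> False.
    by move=> /ts; rewrite mem_filter => /andP[/asboolP].
  move=> B B' /=; rewrite !inE => /orP[/eqP ->|Bt] /orP[/eqP ->|B't] //.
  + by rewrite setIC => /(dis _ B't).
  + by move/(dis _ Bt).
  + exact: tt.
- move=> B Bs; have [/asboolP[x [/= Bx Bmx]]|nB] := boolP (meets B).
    exists Bm; first exact: mem_head.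
    apply: sub_ball; have := Bmax _ Bs; move: Bx Bmx; rewrite !ballP => Bx Bmx Ble.
    have := metric_triangle B.1 x Bm.1; rewrite (metric_sym x Bm.1).
    lra.
  have [|B' B't BB'] := Ht B; first by rewrite mem_filter nB.
  by exists B' => //; rewrite inE B't orbT.
Qed.

End MetricBalls.

Lemma measure_bigcup_seq d (T : measurableType d) (R : realType)
    (mu : {measure set T -> \bar R}) (I : choiceType) (s : seq I)
    (F : I -> set T) : uniq s -> trivIset [set` s] F ->
  (forall i, measurable (F i)) ->
  mu (\bigcup_(i in [set` s]) F i) = (\sum_(i <- s) mu (F i))%E.
Proof.
by move=> us tF mF; rewrite measure_fin_bigcup// -fsbig_seq.
Qed.

(** * Consequences of local doubling: positive volumes, separability, Lindelof *)

Section LocallyDoublingMeasure.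
Context (R : realType) (M : pointedMetricType R).
Variable mu : {measure set (borel M) -> \bar R}.
Hypothesis mu_pos : (0 < mu setT)%E.
Hypothesis mu_balls : balls_finite mu.
Hypothesis LDP : locally_doubling mu.
Implicit Types (x y c : M) (r s b : R) (B : M * R).

(** Doubling at the radii [2 ^+ n * r], with a constant that may change with [n], would spread the
    measure 0 of one ball to all its dilates, and these exhaust the space. *)
Lemma mu_ball_gt0 c r : 0 < r -> (0 < mu (ball c r))%E.
Proof.
move=> r0; rewrite lt0e measure_ge0 andbT; apply/eqP => mu0.
have H n : mu (ball c (2 ^+ n * r)) = 0%E.
  elim: n => [|n IH]; first by rewrite expr0 mul1r.
  have rn : 0 < 2 ^+ n * r by rewrite mulr_gt0 ?exprn_gt0.
  have [D /(_ c _ rn (lexx _))] := LDP rn.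
  by rewrite mulrA -exprS IH mule0 => ?; apply/eqP; rewrite eq_le measure_ge0 andbT.
have : mu (\bigcup_n (ball c (2 ^+ n * r) : set (borel M))) = 0%E.
  have mb n : measurable (ball c (2 ^+ n * r) : set (borel M)).
    exact: measurable_ball_metric.
  apply/negligibleP; first exact: bigcupT_measurable.
  by apply: negligible_bigcup => n; apply/negligibleP; [exact: mb|exact: H].
rewrite (_ : \bigcup_n _ = setT); first by move=> E; move: mu_pos; rewrite E ltxx.
apply/seteqP; split=> // x _; exists (Num.truncn (mdist c x / r)).+1 => //.
rewrite ballP -ltr_pdivrMr//.
apply: lt_trans (truncnS_gt _) _.
by rewrite -natrX ltr_nat ltn_expl.
Qed.

Lemma mu_ball_fin c r : mu (ball c r) \is a fin_num.
Proof.
rewrite ge0_fin_numE ?measure_ge0//; have [r0|r0] := ltP 0 r; first exact: mu_balls.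
rewrite (_ : ball c r = set0) ?measure0//.
by apply/seteqP; split => // x; rewrite ballP ltNge (le_trans r0) ?mdist_ge0.
Qed.

Definition vol c r := fine (mu (ball c r)).

Lemma mu_ballE c r : mu (ball c r) = (vol c r)%:E.
Proof. by rewrite /vol fineK ?mu_ball_fin. Qed.

Lemma vol_gt0 c r : 0 < r -> 0 < vol c r.
Proof. by move=> r0; rewrite -lte_fin -mu_ballE; exact: mu_ball_gt0. Qed.

Lemma vol_le c r c' r' : mdist c c' + r <= r' -> vol c r <= vol c' r'.
Proof.
move=> H; rewrite -lee_fin -!mu_ballE le_measure ?inE//;
  try exact: measurable_ball_metric.
exact: sub_ball.
Qed.

(** One constant for all later comparisons of volumes. The most demanding is in [whitney_ball],
    where a ball of radius [8 * p] whose centre is at distance below [7 * p] has to be covered. Four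
    doublings start from radii up to [8 * b]. *)
Lemma doubling16 b : 0 < b -> exists2 K : R, 1 <= K &
  forall c r, 0 < r <= b -> vol c (16 * r) <= K * vol c r.
Proof.
move=> b0; have b80 : 0 < 8 * b by rewrite mulr_gt0.
have [D HD] := LDP b80; pose D' := Num.max D 1.
have D'1 : 1 <= D' by rewrite le_max lexx orbT.
have step c r : 0 < r -> r <= 8 * b -> vol c (2 * r) <= D' * vol c r.
  move=> r0 rb; have := HD c r r0 rb; rewrite !mu_ballE -EFinM lee_fin => /le_trans.
  by apply; apply: ler_wpM2r; [apply: ltW; exact: vol_gt0|rewrite le_max lexx].
exists (D' ^+ 4) => [|c r /andP[r0 rb]]; first by rewrite exprn_ege1.
have D'0 : 0 <= D' by exact: le_trans D'1.
have -> : 16 * r = 2 * (2 * (2 * (2 * r))) by ring.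
rewrite !exprS expr0 mulr1 -!mulrA.
apply: le_trans (step _ _ _ _) _; try lra.
rewrite ler_wpM2l//; apply: le_trans (step _ _ _ _) _; try lra.
rewrite ler_wpM2l//; apply: le_trans (step _ _ _ _) _; try lra.
by rewrite ler_wpM2l//; apply: step; lra.
Qed.

(** Centres are sorted by their distance from a base point and by a lower bound on the volume of
    their ball. Each class is finite, since its disjoint balls all lie in one ball of finite
    measure. *)
Lemma countable_disjoint_balls (D : set M) r : 0 < r ->
  trivIset D (fun x => ball x r) -> countable D.
Proof.
move=> r0 tD; pose x0 : M := point.
have -> : D = \bigcup_n [set x | D x /\ mdist x0 x < n%:R /\ n%:R^-1 < vol x r].
  apply/seteqP; split=> [x Dx|x [n _ []]//].
  pose n := (maxn (Num.truncn (mdist x0 x)) (Num.truncn (vol x r)^-1)).+1.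
  exists n => //; split => //; split.
    by apply: lt_le_trans (truncnS_gt _) _; rewrite ler_nat ltnS leq_maxl.
  rewrite invf_plt ?posrE ?vol_gt0//.
  by apply: lt_le_trans (truncnS_gt _) _; rewrite ler_nat ltnS leq_maxr.
apply: bigcup_countable => // n _; apply: finite_set_countable.
set E := [set _ | _]; apply: contrapT => infE.
pose V := vol x0 (n%:R + r).
have [F0 FE0 Fn] := infinite_set_fset (Num.truncn (n%:R * V)).+1 infE.
pose F : seq M := finmap.enum_fset F0.
have FE x : x \in F -> E x by exact: FE0.
have uF : uniq F by exact: finmap.fset_uniq.
have Emeas x : measurable (ball x r : set (borel M)) by exact: measurable_ball_metric.
have n0 : (0:R) < n%:R.
  have /infinite_setN0[x [_ [+ _]]] := infE.
  by apply: le_lt_trans; exact: mdist_ge0.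
have : (\sum_(x <- F) mu (ball x r) <= V%:E)%E.
  rewrite -(@measure_bigcup_seq _ _ _ mu _ _ (fun x => ball x r : set (borel M)))//.
    rewrite -mu_ballE le_measure ?inE//.
    - by rewrite bigcup_seq; exact: bigsetU_measurable.
    - exact: measurable_ball_metric.
    - apply: bigcup_sub => x /= /FE[_ [xn _]].
      by apply: sub_ball; rewrite lerD2r metric_sym ltW.
  by move=> x y /= /FE[Dx _] /FE[Dy _]; exact: tD.
have : (\sum_(x <- F) (n%:R^-1)%:E <= \sum_(x <- F) mu (ball x r))%E.
  rewrite big_seq [leRHS]big_seq; apply: lee_sum => x xF.
  by have [_ [_ /ltW]] := FE _ xF; rewrite -lee_fin mu_ballE.
move=> /le_trans/[apply]; rewrite sumEFin lee_fin big_const_seq count_predT.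
rewrite iter_addr_0 -[_ *+ size _]mulr_natl ler_pdivrMr// leNgt => /negP; apply.
rewrite mulrC; apply: lt_le_trans (truncnS_gt _) _.
by rewrite ler_nat.
Qed.

(** The measure provides separability: for each [k] a maximal disjoint family of balls of radius
    1/(k+1) is countable, and by maximality its centres come within 2/(k+1) of every point. *)
Lemma separable_metric : exists q : nat -> M,
  forall y e, 0 < e -> exists n, ball y e (q n).
Proof.
pose P k := @ex_maximal_disjoint_subcollection M M (fun x => ball x (k.+1%:R^-1 : R)) setT.
pose D k := projT1 (P k).
have cD : countable (\bigcup_k D k).
  apply: bigcup_countable => // k _.
  apply: (@countable_disjoint_balls _ (k.+1%:R^-1)); first by rewrite invr_gt0.
  by rewrite /D; case: (P k) => E [].
have /countable_injP[f injf] := cD.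
exists (fun n => xget point [set x | (\bigcup_k D k) x /\ f x = n]) => y e e0.
pose k := Num.truncn (2 / e).
have ke : 2 * k.+1%:R^-1 < e.
  by rewrite ltr_pdivrMr// mulrC -ltr_pdivrMr// truncnS_gt.
have [x Dx yx] : exists2 x, D k x & mdist y x < e.
  rewrite /D; case: (P k) => E [_ tE maxE] /=.
  have [yE|yE] := pselect (E y); first by exists y; rewrite ?mdistxx.
  apply: contrapT => /forall2NP H.
  apply: (maxE (E `|` [set y])) => //.
    split=> [x Ex|]; first by left.
    by move=> /(_ y); apply/not_implyP; split => //; right.
  have dis x : E x -> ball x k.+1%:R^-1 `&` ball y k.+1%:R^-1 !=set0 -> False.
    move=> Ex [z]; rewrite /setI/= !ballP => -[xz yz].
    have [//|] := H x; apply.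
    apply: le_lt_trans (metric_triangle _ z _) _; rewrite (metric_sym z).
    by apply: lt_trans ke; rewrite mulr_natl mulr2n ltrD.
  move=> x x' [Ex|->] [Ex'|->] //.
  - exact: tE.
  - by move/dis => /(_ Ex).
  - by rewrite setIC => /dis => /(_ Ex').
exists (f x); rewrite ballP.
have Dx' : (\bigcup_k D k) x by exists k.
case: xgetP => [z _ [Dz fz]|/(_ x)]; last by case.
by rewrite (injf z x)// inE.
Qed.

(** For every small ball about a point of the dense sequence one member of [P] containing it is
    picked, if there is one, and the member [B0] otherwise. Finite stages are delivered as lists
    because both Vitali selection and interpolation work on finite families. *)
Lemma lindelof_balls (P : set (M * R)) : exists u : nat -> seq (M * R),
  [/\ forall n B, B \in u n -> P B,
    nondecreasing_seq (fun n => balls_union [set` u n]) &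
    balls_union P = \bigcup_n balls_union [set` u n]].
Proof.
have [q Hq] := separable_metric.
pose good (i : nat * nat) (B : M * R) := P B /\
  ball (q i.1) i.2.+1%:R^-1 `<=` ball B.1 B.2.
have [[B0 PB0]|noP] := pselect (exists B, P B); last first.
  exists (fun=> [::]); split => //.
  rewrite (_ : P = set0); last by apply/seteqP; split => // B PB; apply: noP; exists B.
  rewrite /balls_union bigcup_set0; apply/seteqP; split => // x [n _ [B]].
  by rewrite /= in_nil.
pose g i := xget B0 (good i).
have gP i : P (g i) by rewrite /g; case: xgetP => [B _ []|].
pose u n := [seq g (i, j) | i <- iota 0 n, j <- iota 0 n].
exists u; split.
- by move=> n B /allpairsP[[i j] /= [_ _ ->]].
- move=> m n mn; apply/subsetPset => x [B /allpairsP[[i j] /= [im jm ->]] Bx].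
  exists (g (i, j)) => //=; apply/allpairsP; exists (i, j).
  rewrite !mem_iota !add0n /= in im jm *.
  by split => //; [exact: leq_trans im mn|exact: leq_trans jm mn].
- apply/seteqP; split=> [x [B PB Bx]|x [n _ [B /allpairsP[[i j] /= [_ _ ->]] Bx]]];
    last by exists (g (i, j)).
  have /open_metricP/(_ x Bx)[e e0 He] := @open_ball_metric R M B.1 B.2.
  pose j := Num.truncn (2 / e).
  have je : 2 * j.+1%:R^-1 < e.
    by rewrite ltr_pdivrMr// mulrC -ltr_pdivrMr// truncnS_gt.
  have [|m] := Hq x j.+1%:R^-1; first by rewrite invr_gt0.
  rewrite ballP => qx.
  have gg : good (m, j) B.
    split => //= z; rewrite ballP => qz; apply: He; rewrite ballP.
    by apply: le_lt_trans (metric_triangle _ (q m) _) _; apply: lt_trans je; rewrite mulr_natl mulr2n ltrD.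
  exists (maxn m j).+1 => //; exists (g (m, j)) => /=.
    apply/allpairsP; exists (m, j); rewrite !mem_iota !add0n/= !ltnS leq_maxl leq_maxr.
    by split.
  have [_ /=] : good (m, j) (g (m, j)) by rewrite /g; case: xgetP => [//|/(_ B)].
  by apply; rewrite ballP metric_sym.
Qed.

(* Lindelof makes the measure of a union of balls the supremum over finite
   subfamilies. *)
Lemma mu_balls_union_le (E : set M) (P : set (M * R)) (c : \bar R) :
  measurable (E : set (borel M)) ->
  (forall s : seq (M * R), (forall B, B \in s -> P B) ->
    (mu (E `&` balls_union [set` s]) <= c)%E) ->
  (mu (E `&` balls_union P) <= c)%E.
Proof.
move=> mE H; have [u [uP undecr ->]] := lindelof_balls P.
have mu_u n : measurable (E `&` balls_union [set` u n] : set (borel M)).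
  by apply: measurableI => //; exact: measurable_balls_union.
rewrite setI_bigcupr.
have cv : mu (E `&` balls_union [set` u n]) @[n --> \oo] -->
    mu (\bigcup_n (E `&` balls_union [set` u n])).
  apply: (@nondecreasing_cvg_mu _ _ _ mu (fun n => E `&` balls_union [set` u n])) => //.
    exact: bigcupT_measurable.
  by move=> m n mn; apply/subsetPset; apply: setIS; apply/subsetPset; exact: undecr.
rewrite -(cvg_lim _ cv)//; apply: lime_le; first by apply/cvg_ex; eexists; exact: cv.
by apply: nearW => n; apply: H => B; exact: uP.
Qed.

End LocallyDoublingMeasure.

Lemma measure_bigcup_seq_le d (T : measurableType d) (R : realType)
    (mu : {measure set T -> \bar R}) (I : choiceType) (s : seq I)
    (F : I -> set T) : (forall i, measurable (F i)) ->
  (mu (\bigcup_(i in [set` s]) F i) <= \sum_(i <- s) mu (F i))%E.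
Proof.
move=> mF; rewrite bigcup_seq; elim: s => [|i s IH].
  by rewrite !big_nil measure0.
rewrite !big_cons; apply: le_trans (measureU2 _ _ _) _ => //.
  exact: bigsetU_measurable.
by rewrite leeD2l.
Qed.

(** * Level sets and the weak type inequality *)

Section LevelSets.
Context (R : realType) (M : pointedMetricType R).
Variable mu : {measure set (borel M) -> \bar R}.
Hypothesis mu_pos : (0 < mu setT)%E.
Hypothesis mu_balls : balls_finite mu.
Hypothesis LDP : locally_doubling mu.
Implicit Types (x y c : M) (r s b : R) (B : M * R) (w : borel M -> R).

(* The level set {M w > l} of the maximal function over balls of radius at
   most s, and the level set of the sharp function; both are used only through
   these unions of balls. *)
Definition maximal_balls w s (l : R) : set (M * R) :=
  [set B | 0 < B.2 <= s /\
    ((l * vol mu B.1 B.2)%:E < \int[mu]_(x in ball B.1 B.2) (w x)%:E)%E].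

Definition maximal_set w s l : set M := balls_union (maximal_balls w s l).

(** The oscillation must exceed the level about every constant [m], not just about the average.
    Outside the set some good constant is then available, and inside it [m] is free to be chosen, as
    in [sharp_balls_oscillation]. *)
Definition sharp_balls w s (l : R) : set (M * R) :=
  [set B | 0 < B.2 <= s /\ forall m : R,
    ((l * vol mu B.1 B.2)%:E < \int[mu]_(x in ball B.1 B.2) `|w x - m|%:E)%E].

Definition sharp_set w s l : set M := balls_union (sharp_balls w s l).

Lemma vitali_measure_le (E : set M) (s : seq (M * R)) :
  measurable (E : set (borel M)) -> (forall B, B \in s -> 0 < B.2) ->
  exists t : seq (M * R), [/\ uniq t, {subset t <= s},
    trivIset [set` t] (fun B : M * R => ball B.1 B.2) &
    (mu (E `&` balls_union [set` s]) <=
      \sum_(B <- t) mu (E `&` ball B.1 (3 * B.2)))%E].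
Proof.
move=> mE s0; have [t [ut ts tt Ht]] := finite_vitali s0.
exists t; split => //.
have mEB B : measurable (E `&` ball B.1 (3 * B.2) : set (borel M)).
  by apply: measurableI => //; exact: measurable_ball_metric.
apply: le_trans (measure_bigcup_seq_le mu t mEB).
rewrite le_measure ?inE//.
- by apply: measurableI => //; exact: measurable_balls_union.
- by rewrite bigcup_seq; exact: bigsetU_measurable.
- move=> x [Ex [B /= /Ht[B' B't BB'] Bx]]; exists B' => //.
  by split => //; exact: BB'.
Qed.

Lemma sum_ball_integral_le w (t : seq (M * R)) : (forall x, 0 <= w x) ->
  measurable_fun setT w -> uniq t ->
  trivIset [set` t] (fun B : M * R => ball B.1 B.2) ->
  (\sum_(B <- t) \int[mu]_(x in ball B.1 B.2) (w x)%:E <= \int[mu]_x (w x)%:E)%E.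
Proof.
move=> w0 mw ut tt.
have mB B : measurable (ball B.1 B.2 : set (borel M)) by exact: measurable_ball_metric.
rewrite -(@ge0_integral_bigsetU _ _ _ mu _ (fun B : M * R => ball B.1 B.2 : set (borel M)))//.
- apply: ge0_subset_integral => //; first exact: bigsetU_measurable.
    exact/measurable_EFinP.
  by move=> x _; rewrite lee_fin.
- by apply: measurable_funTS; exact/measurable_EFinP.
- by move=> x _; rewrite lee_fin.
Qed.

(** Threefold dilates of disjoint balls cover. Each has measure at most [K] times that of its ball,
    which is less than the integral of [w] over the ball divided by [l]; disjointness adds these
    integrals up. *)
Lemma weak_type w s (K l : R) : (forall x, 0 <= w x) -> measurable_fun setT w ->
  (forall c r, 0 < r <= s -> vol mu c (16 * r) <= K * vol mu c r) -> 0 <= K ->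
  0 < l ->
  (mu (maximal_set w s l) <= (K / l)%:E * \int[mu]_x (w x)%:E)%E.
Proof.
move=> w0 mw HK K0 l0; rewrite -[X in mu X]setTI.
apply: mu_balls_union_le => // t Ht.
have [|t' [ut' t't tt' /le_trans]] := vitali_measure_le (s := t) measurableT.
  by move=> B /Ht[/andP[]].
apply; apply: (@le_trans _ _ (\sum_(B <- t') (K / l)%:E *
    \int[mu]_(x in ball B.1 B.2) (w x)%:E)%E).
  rewrite big_seq [leRHS]big_seq; apply: lee_sum => B Bt'.
  have [/andP[r0 rs] HB] := Ht _ (t't _ Bt').
  rewrite setTI mu_ballE// (le_trans _ (lee_wpmul2l _ (ltW HB))) ?lee_fin ?divr_ge0// ?(ltW l0)//.
  rewrite mulrA divfK ?gt_eqF//.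
  apply: le_trans (HK _ _ _); last by rewrite r0.
  by apply: vol_le => //; rewrite mdistxx add0r; lra.
rewrite -ge0_sume_distrr; last first.
  by move=> B _; apply: integral_ge0 => x _; rewrite lee_fin.
rewrite lee_wpmul2l ?lee_fin ?divr_ge0// ?(ltW l0)//.
exact: sum_ball_integral_le.
Qed.

End LevelSets.

(** * Lebesgue density in weak form *)

Section LebesgueDensity.
Context (R : realType) (M : pointedMetricType R).
Variable mu : {measure set (borel M) -> \bar R}.
Hypothesis mu_pos : (0 < mu setT)%E.
Hypothesis mu_balls : balls_finite mu.
Hypothesis LDP : locally_doubling mu.
Implicit Types (x y c : M) (r s b e : R) (E V W : set M).

(** Symmetric differences, rather than open supersets, treat a set and its complement alike; the
    window [W] is there to supply the finite measure that continuity from above requires. *)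
Definition open_approximable W E := forall e, 0 < e -> exists2 V, open V &
  (mu (W `&` ((E `\` V) `|` (V `\` E))) <= e%:E)%E.

(** For a complement, the closed set [C] is replaced by its open neighbourhoods of radius 1/(n+1).
    They decrease to [C], so what they add inside [W] has measure tending to 0. For a countable
    union the n-th set receives the error [e / (2 ^ n.+1)]. *)
Lemma open_approximable_sigma W : measurable (W : set (borel M)) ->
  (mu W < +oo)%E ->
  sigma_algebra setT [set E | measurable (E : set (borel M)) /\ open_approximable W E].
Proof.
move=> mW Wfin; split.
- split; first exact: measurable0.
  move=> e e0; exists set0; first exact: open0.
  by rewrite set0D setU0 setI0 measure0 lee_fin ltW.
- move=> E [mE aE]; split; first exact: measurableD.
  move=> e e0; have e20 : 0 < e / 2 by rewrite divr_gt0.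
  have [V oV HV] := aE _ e20.
  pose C := ~` V.
  pose N n : set M := \bigcup_(x in C) ball x (n.+1%:R^-1 : R).
  have oN n : open (N n) by apply: bigcup_open => x _; exact: open_ball_metric.
  have mV : measurable (V : set (borel M)) by exact: measurable_open.
  have mN n : measurable (N n : set (borel M)) by exact: measurable_open.
  have CN n : C `<=` N n by move=> x Cx; exists x => //; exact: mem_ball_center.
  pose F n : set (borel M) := W `&` (N n `\` C).
  have mF n : measurable (F n).
    by apply: measurableI => //; apply: measurableD => //; exact: measurableC.
  have F0 : \bigcap_n F n = set0.
    apply/seteqP; split => // x H.
    have [_ [_ /contrapT Ox]] := H 0%N I.
    have /open_metricP/(_ x Ox)[r r0 Hr] := oV.
    pose n := Num.truncn r^-1.
    have nr : n.+1%:R^-1 < r.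
      by rewrite invf_plt ?posrE// truncnS_gt.
    have [_ [[y Cy]]] := H n I; rewrite ballP metric_sym => yx _.
    by apply: Cy; apply: Hr; rewrite ballP; exact: lt_trans nr.
  have cvF : mu (F n) @[n --> \oo] --> 0%E.
    rewrite -(measure0 mu) -F0; apply: nonincreasing_cvg_mu => //.
    - by apply: le_lt_trans Wfin; rewrite le_measure ?inE//; exact: subIsetl.
    - exact: bigcap_measurableType.
    - move=> m n mn; apply/subsetPset; apply: setIS; apply: setSD => x [y Cy yx].
      exists y => //; apply: sub_ball yx; rewrite mdistxx add0r.
      by rewrite lef_pV2 ?posrE// ler_nat.
  have [n Hn] : exists n, (mu (F n) <= (e / 2)%:E)%E.
    apply: contrapT => /forallNP H.
    have : ((e / 2)%:E <= 0)%E.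
      rewrite -(cvg_lim _ cvF)//; apply: lime_ge.
        by apply/cvg_ex; eexists; exact: cvF.
      by apply: nearW => n; rewrite ltW// ltNge; exact/negP/H.
    by rewrite lee_fin leNgt e20.
  exists (N n) => //.
  apply: (@le_trans _ _ (mu ((W `&` ((E `\` V) `|` (V `\` E))) `|` F n))).
    rewrite le_measure ?inE//.
    - apply: measurableI => //; apply: measurableU; apply: measurableD => //;
        exact: measurableD.
    - by apply: measurableU => //; apply: measurableI => //; apply: measurableU;
        apply: measurableD.
    - move=> x [Wx [[[_ nEx] nNx]|[Nx nEx]]].
        left; split => //; right; split => //.
        by apply: contrapT => Ox; apply: nNx; apply: CN.
      have Ex : E x by apply: contrapT => ?; apply: nEx.
      have [Ox|Ox] := pselect (V x); last by left; split => //; left.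
      by right; split => //; split => // /(_ Ox).
  apply: le_trans (measureU2 _ _ _) _ => //.
    by apply: measurableI => //; apply: measurableU; apply: measurableD.
  by rewrite [e in leRHS]splitr EFinD leeD.
- move=> F HF; split; first by apply: bigcupT_measurable => n; case: (HF n).
  move=> e e0.
  have /choice[V HV] n : exists V, open V /\
      (mu (W `&` ((F n `\` V) `|` (V `\` F n))) <= (e / (2 ^ n.+1)%:R)%:E)%E.
    have [_ /(_ (e / (2 ^ n.+1)%:R))] := HF n.
    by rewrite divr_gt0// ?ltr0n ?expn_gt0// => /(_ isT)[V oV HV]; exists V.
  have mF n : measurable (F n : set (borel M)) by case: (HF n).
  have mV n : measurable (V n : set (borel M)).
    by apply: measurable_open; case: (HV n).
  have mD n : measurable (W `&` ((F n `\` V n) `|` (V n `\` F n)) : set (borel M)).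
    by apply: measurableI => //; apply: measurableU; apply: measurableD.
  exists (\bigcup_n V n); first by apply: bigcup_open => n _; case: (HV n).
  pose D n : set (borel M) := W `&` ((F n `\` V n) `|` (V n `\` F n)).
  apply: (@le_trans _ _ (\sum_(n <oo) mu (D n))%E).
    apply: measure_sigma_subadditive => //.
      apply: measurableI => //; apply: measurableU; apply: measurableD;
        exact: bigcupT_measurable.
    move=> x [Wx [[[n _ Fx] nO]|[[n _ Ox] nF]]]; exists n => //; split => //.
      by left; split => // Ox; apply: nO; exists n.
    by right; split => // Fx; apply: nF; exists n.
  have := @epsilon_trick _ (fun=> 0%E) e xpredT (fun=> lexx _) (ltW e0).
  rewrite [X in (_ <= X + _)%E -> _]eseries0// add0e; apply: le_trans.
  by apply: lee_nneseries => // n _; rewrite add0e; case: (HV n).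
Qed.

Lemma measurable_open_approximable W E : measurable (W : set (borel M)) ->
  (mu W < +oo)%E -> measurable (E : set (borel M)) -> open_approximable W E.
Proof.
move=> mW Wfin mE.
have := @smallest_sub _ (sigma_algebra setT) (@open M)
  [set E | measurable (E : set (borel M)) /\ open_approximable W E]
  (open_approximable_sigma mW Wfin).
move=> /(_ _ E mE)[]// V oV; split; first exact: measurable_open.
move=> e e0; exists V => //.
by rewrite setDv setU0 setI0 measure0 lee_fin ltW.
Qed.

End LebesgueDensity.

Section DensityAndLayers.
Context (R : realType) (M : pointedMetricType R).
Variable mu : {measure set (borel M) -> \bar R}.
Hypothesis mu_pos : (0 < mu setT)%E.
Hypothesis mu_balls : balls_finite mu.
Hypothesis LDP : locally_doubling mu.
Implicit Types (x y c : M) (r s b e : R) (E W : set M) (w : borel M -> R).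

Lemma maximal_setW w w' s l : (forall x, 0 <= w x <= w' x) ->
  measurable_fun setT w -> measurable_fun setT w' ->
  maximal_set mu w s l `<=` maximal_set mu w' s l.
Proof.
move=> ww' mw mw' x [B [Bs HB] Bx]; exists B => //; split => //.
apply: lt_le_trans HB _; apply: ge0_le_integral => //.
- exact: measurable_ball_metric.
- by move=> y _; rewrite lee_fin; case/andP: (ww' y).
- by apply/measurable_EFinP; exact: measurable_funTS.
- by apply/measurable_EFinP; exact: measurable_funTS.
- by move=> y _; rewrite lee_fin; case/andP: (ww' y).
Qed.

Lemma indic_maximal_ball E c r s l : measurable (E : set (borel M)) ->
  0 < r <= s -> ((l * vol mu c r)%:E < mu (E `&` ball c r))%E ->
  ball c r `<=` maximal_set mu \1_E s l.
Proof.
move=> mE rs H x xb; exists (c, r) => //; split => //=.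
by rewrite integral_indic//; exact: measurable_ball_metric.
Qed.

(** Almost every point of [E] lies in a small ball that [E] fills beyond the proportion [l]. An open
    [V'] close to [E] shows it: at an exceptional point of [V'] a small ball inside [V'] is
    substantially filled by [V' \ E], so the weak type inequality bounds these points by the small
    measure of [V' \ E]. *)
Lemma maximal_indic_density_bounded c0 r0 E s (K l : R) : 0 < s ->
  (forall c r, 0 < r <= s -> vol mu c (16 * r) <= K * vol mu c r) -> 0 <= K ->
  measurable (E : set (borel M)) -> E `<=` ball c0 r0 -> 0 < l < 1 ->
  mu (E `\` maximal_set mu \1_E s l) = 0%E.
Proof.
move=> s0 HK K0 mE EW /andP[l0 l1].
pose W := ball c0 r0.
have mW : measurable (W : set (borel M)) by exact: measurable_ball_metric.
have Wfin : (mu W < +oo)%E by rewrite ltey_eq mu_ball_fin.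
have aE := measurable_open_approximable mW Wfin mE.
have mMS : measurable (maximal_set mu \1_E s l : set (borel M)).
  exact: measurable_balls_union.
apply/eqP; rewrite eq_le measure_ge0 andbT; apply/lee_addgt0Pr => e e0; rewrite add0e.
(* If [E] fills at most the proportion [l], the remainder fills at least [1 - l]; halving produces
   the strict inequality that a maximal ball demands. *)
pose l' := (1 - l) / 2; have l'0 : 0 < l' by rewrite divr_gt0// subr_gt0.
pose C := 1 + K / l'.
have C0 : 0 < C by rewrite ltr_wpDr// divr_ge0// ltW.
have [V oV HV] := aE _ (divr_gt0 e0 C0).
pose V' := V `&` W.
have oV' : open V' by apply: openI => //; exact: open_ball_metric.
have mV' : measurable (V' : set (borel M)) by exact: measurable_open.
have mV : measurable (V : set (borel M)) by exact: measurable_open.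
pose D : set (borel M) := V' `\` E.
have mD : measurable D by exact: measurableD.
have mDiff : measurable (W `&` (E `\` V `|` V `\` E) : set (borel M)).
  by apply: measurableI => //; apply: measurableU; apply: measurableD.
have sub : E `\` maximal_set mu \1_E s l `<=`
    (E `\` V') `|` maximal_set mu \1_D s l'.
  move=> x [Ex nMx]; have [Vx|nVx] := pselect (V' x); last by left.
  right; have /open_metricP/(_ x Vx)[r1 r10 Hr1] := oV'.
  pose r := Num.min r1 s; have r00 : 0 < r by rewrite lt_min r10.
  have Br : ball x r `<=` V'.
    by apply: subset_trans Hr1; apply: sub_ball; rewrite mdistxx add0r ge_min lexx.
  have rs : 0 < r <= s by rewrite r00 ge_min lexx orbT.
  have mB : measurable (ball x r : set (borel M)) by exact: measurable_ball_metric.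
  have HEr : (mu (E `&` ball x r) <= (l * vol mu x r)%:E)%E.
    rewrite leNgt; apply/negP => H; apply: nMx.
    by apply: (indic_maximal_ball mE rs H); exact: mem_ball_center.
  apply: (indic_maximal_ball mD rs); last exact: mem_ball_center.
  have EB : mu (ball x r) = (mu (E `&` ball x r) + mu (D `&` ball x r))%E.
    rewrite -measureU//; [|exact: measurableI|exact: measurableI|].
      congr (mu _); apply/seteqP; split=> [y yb|y []]; last by move=> [].
        have [Ey|nEy] := pselect (E y); [by left|right; split => //].
        by split => //; exact: Br.
      by move=> [].
    by apply/seteqP; split => // y [[Ey _] [[_ /(_ Ey)]]].
  have fE : mu (E `&` ball x r) \is a fin_num.
    rewrite ge0_fin_numE//; apply: le_lt_trans HEr _; exact: ltry.
  have fD : mu (D `&` ball x r) \is a fin_num.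
    rewrite ge0_fin_numE//; apply: le_lt_trans (_ : mu (ball x r) < +oo)%E.
      by rewrite le_measure ?inE//; exact: measurableI.
    by rewrite ltey_eq mu_ball_fin.
  move: EB HEr; rewrite mu_ballE// -(fineK fE) -(fineK fD) -EFinD => -[EB].
  rewrite !lee_fin !lte_fin => HE; rewrite /l'.
  have := vol_gt0 mu_pos mu_balls LDP x r00.
  move: EB HE; set a := fine _; set b := fine _; set v := vol _ _ _ => -> HE v0.
  nra.
apply: le_trans (_ : (mu (E `\` V' `|` maximal_set mu \1_D s l') <= _)%E).
  rewrite le_measure ?inE//; first exact: measurableD.
  apply: measurableU; first exact: measurableD.
  exact: measurable_balls_union.
apply: le_trans (measureU2 _ _ _) _.
- exact: measurableD.
- exact: measurable_balls_union.
have b1 : (mu (E `\` V') <= (e / C)%:E)%E.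
  apply: le_trans HV; rewrite le_measure ?inE//; first exact: measurableD.
  move=> x [Ex nV]; split; first exact: EW.
  by left; split => // Vx; apply: nV; split => //; exact: EW.
have b2 : (mu D <= (e / C)%:E)%E.
  by apply: le_trans HV; rewrite le_measure ?inE// => x [[Vx Wx] nEx]; split => //; right.
have b3 : (mu (maximal_set mu \1_D s l') <= (K / l' * (e / C))%:E)%E.
  apply: le_trans (weak_type mu_pos mu_balls LDP _ _ HK K0 l'0) _ => //.
  rewrite [in leRHS]EFinM; apply: lee_wpmul2l.
    by rewrite lee_fin divr_ge0// ltW.
  by rewrite integral_indic// setIT.
apply: le_trans (leeD b1 b3) _; rewrite -EFinD lee_fin.
by rewrite -[X in X + _]mul1r -mulrDl mulrC divfK// gt_eqF.
Qed.

Lemma maximal_indic_density E s (K l : R) : 0 < s ->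
  (forall c r, 0 < r <= s -> vol mu c (16 * r) <= K * vol mu c r) -> 0 <= K ->
  measurable (E : set (borel M)) -> 0 < l < 1 ->
  mu (E `\` maximal_set mu \1_E s l) = 0%E.
Proof.
move=> s0 HK K0 mE l01.
have mMS : measurable (maximal_set mu \1_E s l : set (borel M)).
  exact: measurable_balls_union.
pose En n : set (borel M) := E `&` ball (point : M) (n%:R : R).
have mEn n : measurable (En n) by apply: measurableI => //; exact: measurable_ball_metric.
apply/negligibleP; first exact: measurableD.
apply: (@negligibleS _ _ _ mu (\bigcup_n (En n `\` maximal_set mu \1_(En n) s l))).
  move=> x [Ex nMx]; exists (Num.truncn (mdist point x)).+1 => //; split.
    by split => //; rewrite ballP truncnS_gt.
  move=> H; apply: nMx; apply: maximal_setW H => // y.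
  rewrite !indicE; case: (boolP (y \in En _)) => [|_]; last by rewrite lexx/= ler0n.
  by rewrite inE => -[Ey _]; rewrite mem_set// ler01 lexx.
apply: negligible_bigcup => n; apply/negligibleP.
  by apply: measurableD => //; exact: measurable_balls_union.
apply: (@maximal_indic_density_bounded point n%:R _ _ K) => //.
by move=> x [].
Qed.

(** Stands in for Lebesgue differentiation. Almost every point of the set where [w > eta * t] lies
    in a ball filled by it beyond [eta^-1], and the average of [w] over that ball exceeds [t]. The
    price is the factor [eta] between the levels. *)
Lemma le_maximal_set w s (K t eta : R) : 0 < s ->
  (forall c r, 0 < r <= s -> vol mu c (16 * r) <= K * vol mu c r) -> 0 <= K ->
  (forall x, 0 <= w x) -> measurable_fun setT w -> 0 < t -> 1 < eta ->
  (mu [set x | (eta * t < w x)%R] <= mu (maximal_set mu w s t))%E.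
Proof.
move=> s0 HK K0 w0 mw t0 eta1; set E := [set x | _].
have mE : measurable (E : set (borel M)).
  rewrite -[E]setTI; apply: measurable_fun_ltr => //; exact: measurable_cst.
have eta0 : 0 < eta by exact: lt_trans eta1.
have mM : measurable (maximal_set mu w s t : set (borel M)).
  exact: measurable_balls_union.
have mM1 : measurable (maximal_set mu \1_E s eta^-1 : set (borel M)).
  exact: measurable_balls_union.
have H := @maximal_indic_density E s K eta^-1 s0 HK K0 mE.
have {}H : mu (E `\` maximal_set mu \1_E s eta^-1) = 0%E.
  by apply: H; rewrite invr_gt0 eta0 invf_lt1.
apply: le_trans (_ : (mu (maximal_set mu w s t `|`
    (E `\` maximal_set mu \1_E s eta^-1)) <= _)%E).
  rewrite le_measure ?inE//.
    by apply: measurableU => //; exact: measurableD.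
  move=> x Ex; have [[B [Bs HB] Bx]|nM] := pselect (maximal_set mu \1_E s eta^-1 x);
    [left|by right].
  exists B => //; split => //.
  have mB : measurable (ball B.1 B.2 : set (borel M)) by exact: measurable_ball_metric.
  have et0 : 0 < eta * t by rewrite mulr_gt0.
  have := HB; rewrite -(@lte_pmul2l _ (eta * t)%:E)//.
  rewrite -EFinM !mulrA (mulrAC eta) divff ?gt_eqF// mul1r => /lt_le_trans; apply.
  rewrite -ge0_integralZl_EFin//; [|by apply/measurable_EFinP; exact: measurable_funTS
    |exact: ltW].
  apply: ge0_le_integral => //.
  - by move=> y _; rewrite lee_fin mulr_ge0// ltW.
  - apply/measurable_EFinP; apply: measurable_funM => //; exact: measurable_funTS.
  - by apply/measurable_EFinP; exact: measurable_funTS.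
  - move=> y _; rewrite lee_fin indicE; case: (boolP (y \in E)) => [|_].
      by rewrite inE mulr1 => /ltW.
    by rewrite mulr0.
  by rewrite measureU0//; exact: measurableD.
Qed.

End DensityAndLayers.

(** * Isoperimetry for level sets and the good-lambda inequality *)

Section GoodLambda.
Context (R : realType) (M : pointedMetricType R).
Variable mu : {measure set (borel M) -> \bar R}.
Hypothesis mu_pos : (0 < mu setT)%E.
Hypothesis mu_balls : balls_finite mu.
Hypothesis LDP : locally_doubling mu.
Implicit Types (x y c : M) (r s b e : R) (E A : set M) (w : borel M -> R).

(** The infimum is replaced by points of the complement. With an empty complement both sides fail,
    since the infimum is then +oo. *)
Lemma layerP A kappa x : layer A kappa x <->
  A x /\ forall e, 0 < e -> exists2 y, ~ A y & mdist x y < kappa + e.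
Proof.
rewrite /layer/= /dist_to; split=> [[Ax H]|[Ax H]]; split => //.
  move=> e e0; apply: contrapT => /forall2NP K.
  move: H; apply/negP; rewrite -ltNge.
  apply: (@lt_le_trans _ _ (kappa + e)%:E); first by rewrite lte_fin ltrDl.
  apply: le_ereal_inf_tmp => _ [y /= nAy <-]; rewrite lee_fin leNgt.
  by have [//|/negP] := K y.
apply/lee_addgt0Pr => e e0; have [y nAy yx] := H e e0.
apply: le_trans (_ : ((mdist x y)%:E <= _)%E); first by apply: ereal_inf_lbound; exists y.
by rewrite -EFinD lee_fin ltW.
Qed.

Lemma measurable_layer A kappa : open A -> measurable (layer A kappa : set (borel M)).
Proof.
move=> oA; rewrite (_ : layer A kappa = A `\` [set x | A x /\ ~ layer A kappa x]).
  apply: measurableD; first exact: measurable_open.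
  apply: measurable_open; apply/open_metricP => x [Ax nL].
  have /open_metricP/(_ x Ax)[r r0 Hr] := oA.
  have [e [e0 He]] : exists e, 0 < e /\ forall y, ~ A y -> kappa + e <= mdist x y.
    apply: contrapT => /forallNP H; apply: nL; apply/layerP; split=> // e e0.
    apply: contrapT => /forall2NP K; apply: (H e); split => // y nAy.
    by rewrite leNgt; apply/negP; have [|] := K y.
  exists (Num.min r (e / 2)) => [|y]; first by rewrite lt_min r0 divr_gt0.
  rewrite ballP lt_min => /andP[yr ye]; split; first by apply: Hr; rewrite ballP.
  move=> /layerP[Ay] /(_ _ (divr_gt0 e0 (ltr0n _ 2)))[z nAz yz].
  have := He z nAz; have := metric_triangle x y z; lra.
apply/seteqP; split=> x.
  by move=> Lx; split; [case: Lx|case].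
by move=> [Ax H]; apply: contrapT => nL; apply: H.
Qed.

(** Level sets need not be bounded, so the property is carried over to finite measure by cutting
    with balls [W n]. Cutting creates new boundary only near the edge: a point in the layer of
    [An n] but not in that of [A] has distance at least [n - (k + 1)] from the base point, and the
    measure of this part of [A] tends to 0. *)
Lemma isoperimetric_finite : isoperimetric mu -> exists kappa0 C : R,
  [/\ 0 < kappa0, 0 < C & forall A, open A -> (mu A < +oo)%E ->
    forall kappa, 0 < kappa -> kappa <= kappa0 ->
      ((C * kappa)%:E * mu A <= mu (layer A kappa))%E].
Proof.
move=> [k0 [C [k00 C0 H]]]; exists k0, C; split => // A oA Afin k kp kk0.
have mA : measurable (A : set (borel M)) by exact: measurable_open.
pose W n : set M := ball (point : M) (n%:R : R).
have mW n : measurable (W n : set (borel M)) by exact: measurable_ball_metric.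
pose An n : set (borel M) := A `&` W n.
have mAn n : measurable (An n) by exact: measurableI.
pose Bn n : set (borel M) := A `\` ball (point : M) (n%:R - (k + 1)).
have mBn n : measurable (Bn n).
  by apply: measurableD => //; exact: measurable_ball_metric.
have mL : measurable (layer A k : set (borel M)) by exact: measurable_layer.
have step n : ((C * k)%:E * mu (An n) <= mu (layer A k) + mu (Bn n))%E.
  have oAn : open (An n : set M) by apply: openI => //; exact: open_ball_metric.
  have bAn : mbounded (An n : set M) by exists (point : M), n%:R => x [].
  apply: le_trans (H _ oAn bAn _ kp kk0) _.
  apply: le_trans (measureU2 mu mL (mBn n)); rewrite le_measure ?inE//.
  - exact: measurable_layer.
  - exact: measurableU.
  move=> x /layerP[[Ax Wx] Hx].
  have [|nL] := pselect (layer A k x); [by left|right; split => //].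
  move/layerP : nL => /not_andP[//|/existsNP[e /not_implyP[e0 He]]].
  have [y nAn yx] := Hx (Num.min e 1) (ltac:(by rewrite lt_min e0 ltr01)).
  have ye : mdist x y < k + e.
    by apply: lt_le_trans yx _; rewrite lerD2l ge_min lexx.
  have y1 : mdist x y < k + 1.
    by apply: lt_le_trans yx _; rewrite lerD2l ge_min lexx orbT.
  have Ay : A y by apply: contrapT => nAy; apply: He; exists y.
  rewrite ballP => xb; apply: nAn; split => //; rewrite /W ballP.
  by apply: le_lt_trans (metric_triangle _ x _) _; lra.
have cvA : mu (An n) @[n --> \oo] --> mu A.
  have -> : A = \bigcup_n An n.
    apply/seteqP; split => [x Ax|x [n _ []//]].
    by exists (Num.truncn (mdist point x)).+1 => //; split => //; rewrite /W ballP truncnS_gt.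
  apply: nondecreasing_cvg_mu => //; first exact: bigcupT_measurable.
  move=> m n mn; apply/subsetPset; apply: setIS; apply: sub_ball.
  by rewrite mdistxx add0r ler_nat.
have cvB : mu (Bn n) @[n --> \oo] --> 0%E.
  have B0 : \bigcap_n Bn n = set0.
    apply/seteqP; split => // x /(_ (Num.truncn (mdist point x + (k + 1))).+1 I)[_].
    by apply; rewrite ballP ltrBrDr truncnS_gt.
  rewrite -(measure0 mu) -B0; apply: nonincreasing_cvg_mu => //.
  - by apply: le_lt_trans Afin; rewrite le_measure ?inE//; exact: subDsetl.
  - exact: bigcap_measurableType.
  - move=> m n mn; apply/subsetPset; apply: setDS; apply: sub_ball.
    by rewrite mdistxx add0r lerD2r ler_nat.
have cv1 : ((C * k)%:E * mu (An n))%E @[n --> \oo] --> ((C * k)%:E * mu A)%E.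
  exact: cvgeZl.
have cv2 : (mu (layer A k) + mu (Bn n))%E @[n --> \oo] --> (mu (layer A k) + 0)%E.
  by apply: cvgeD => //; [rewrite fin_num_adde_defl|exact: cvg_cst].
rewrite -[leRHS]adde0 -(cvg_lim _ cv1)// -(cvg_lim _ cv2)//; apply: lee_lim.
- by apply/cvg_ex; eexists; exact: cv1.
- by apply/cvg_ex; eexists; exact: cv2.
- exact: nearW.
Qed.

Lemma not_sharp_set w s l x c r : (forall x, 0 <= w x) -> measurable_fun setT w ->
  ~ sharp_set mu w s l x -> 0 < r <= s -> ball c r x ->
  exists2 m, 0 <= m &
    (\int[mu]_(y in ball c r) `|w y - m|%:E <= (l * vol mu c r)%:E)%E.
Proof.
move=> w0 mw nS rs xb.
have [m Hm] : exists m, (\int[mu]_(y in ball c r) `|w y - m|%:E <= (l * vol mu c r)%:E)%E.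
  apply: contrapT => /forallNP H; apply: nS; exists (c, r) => //; split => // m /=.
  by rewrite ltNge; apply/negP; exact: H.
have mB : measurable (ball c r : set (borel M)) by exact: measurable_ball_metric.
have mf m' : measurable_fun (ball c r : set (borel M)) (fun y => `|w y - m'|%:E).
  apply/measurable_EFinP; apply: measurableT_comp => //.
  by apply: measurable_funB => //; exact: measurable_funTS.
(* Since [w] is nonnegative, raising a negative [m] to 0 does not increase any [|w x - m|]. *)
exists (Num.max m 0); first by rewrite le_max lexx orbT.
apply: le_trans Hm; apply: ge0_le_integral => // y _.
rewrite lee_fin; case: (leP m 0) => // m0.
rewrite subr0 !ger0_norm//; last by rewrite subr_ge0 (le_trans m0).
by rewrite lerDl oppr_ge0.
Qed.

Lemma integral_center_comparison w c r m : (forall x, 0 <= w x) ->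
  measurable_fun setT w -> 0 <= m ->
  (\int[mu]_(y in ball c r) (w y)%:E <=
    (m * vol mu c r)%:E + \int[mu]_(y in ball c r) `|w y - m|%:E)%E /\
  ((m * vol mu c r)%:E <=
    \int[mu]_(y in ball c r) (w y)%:E + \int[mu]_(y in ball c r) `|w y - m|%:E)%E.
Proof.
move=> w0 mw m0.
have mB : measurable (ball c r : set (borel M)) by exact: measurable_ball_metric.
have mf : measurable_fun (ball c r : set (borel M)) (fun y => `|w y - m|%:E).
  apply/measurable_EFinP; apply: measurableT_comp => //.
  by apply: measurable_funB => //; exact: measurable_funTS.
have mwB : measurable_fun (ball c r : set (borel M)) (fun y => (w y)%:E).
  by apply/measurable_EFinP; exact: measurable_funTS.
have mE : (\int[mu]_(y in ball c r) m%:E = (m * vol mu c r)%:E)%E.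
  by rewrite integral_cst// mu_ballE.
rewrite -mE; split; rewrite -ge0_integralD//; try by move=> y _; rewrite lee_fin.
  apply: ge0_le_integral => //; first by move=> y _; rewrite lee_fin.
    by apply: emeasurable_funD => //; exact: measurable_cst.
  move=> y _; rewrite -EFinD lee_fin.
  by have := ler_norm (w y - m); lra.
apply: ge0_le_integral => //; first exact: emeasurable_funD.
move=> y _; rewrite -EFinD lee_fin.
by have := ler_norm (m - w y); rewrite distrC; lra.
Qed.

Lemma average_comparison w c r z r' m (D : R) : (forall x, 0 <= w x) ->
  measurable_fun setT w -> 0 <= m -> ball c r `<=` ball z r' ->
  (\int[mu]_(y in ball z r') `|w y - m|%:E <= D%:E)%E ->
  (\int[mu]_(y in ball c r) (w y)%:E <= (m * vol mu c r + D)%:E)%E /\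
  ((m * vol mu c r)%:E <= \int[mu]_(y in ball c r) (w y)%:E + D%:E)%E.
Proof.
move=> w0 mw m0 sub HD.
have HD' : (\int[mu]_(y in ball c r) `|w y - m|%:E <= D%:E)%E.
  apply: le_trans HD; apply: ge0_subset_integral => //;
    try exact: measurable_ball_metric.
  apply/measurable_EFinP; apply: measurableT_comp => //.
  by apply: measurable_funB => //; exact: measurable_funTS.
have [H1 H2] := integral_center_comparison c r w0 mw m0; split.
  by rewrite EFinD; apply: le_trans H1 _; exact: leeD2l.
by apply: le_trans H2 _; exact: leeD2l.
Qed.

(* Outside the level set of the maximal function the averages are at most [l],
   and a small sharp function transfers this bound to nearby balls. *)
Lemma oscillation_center_le w s l z r' y r m g (K : R) : (forall x, 0 <= w x) ->
  measurable_fun setT w -> 0 <= m -> 0 < l -> 0 <= g -> 0 < r <= s ->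
  ~ maximal_set mu w s l y -> ball y r `<=` ball z r' ->
  vol mu z r' <= K * vol mu y r ->
  (\int[mu]_(x in ball z r') `|w x - m|%:E <= (g * l * vol mu z r')%:E)%E ->
  m <= l * (1 + g * K).
Proof.
move=> w0 mw m0 l0 g0 rs nM sub HK Hm.
have [_ H] := average_comparison w0 mw m0 sub Hm.
have Hw : (\int[mu]_(x in ball y r) (w x)%:E <= (l * vol mu y r)%:E)%E.
  rewrite leNgt; apply/negP => K'; apply: nM; exists (y, r) => //.
  by apply: mem_ball_center; case/andP: rs.
have := le_trans H (leeD2r _ Hw); rewrite -EFinD lee_fin.
have v0 : 0 < vol mu y r by apply: vol_gt0 => //; case/andP: rs.
have gl : 0 <= g * l by rewrite mulr_ge0// ltW.
have := ler_wpM2l gl HK.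
move=> H1 H2; rewrite -(ler_pM2r v0); apply: le_trans H2 _.
rewrite mulrDr mulr1 mulrDl lerD2l; apply: le_trans H1 _.
by rewrite le_eqVlt; apply/orP; left; apply/eqP; ring.
Qed.

Definition good_set w s (l eta : R) b g kappa : set M :=
  layer (maximal_set mu w s l) kappa `&` maximal_set mu w s (eta * l)
    `\` sharp_set mu w b (g * l).

Lemma measurable_good_set w s l eta b g kappa :
  measurable (good_set w s l eta b g kappa : set (borel M)).
Proof.
apply: measurableD; last exact: measurable_balls_union.
apply: measurableI; last exact: measurable_balls_union.
by apply: measurable_layer; exact: open_balls_union.
Qed.

(** The nearby point [y] outside the level set and the small sharp function at [x] show that [w] is
    close, on the ball of radius [8 * r], to a constant [m] hardly above [l]. A ball with average
    above [eta * l] must then be small, and so lies in that ball, where [|w - m|] has a large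
    average. The weak type inequality for [|w - m|] bounds the measure of such points by a multiple
    of [g]. *)
Lemma whitney_ball w s l eta b g kappa x r y (K : R) : (forall x, 0 <= w x) ->
  measurable_fun setT w -> 0 < l -> 0 <= g -> 8 * s <= b ->
  (forall c r, 0 < r <= b -> vol mu c (16 * r) <= K * vol mu c r) -> 1 <= K ->
  1 < eta -> 2 * (g * K) <= eta - 1 ->
  good_set w s l eta b g kappa x -> 0 < r <= s ->
  ~ maximal_set mu w s l y -> mdist x y < 4 * r ->
  (mu (good_set w s l eta b g kappa `&` ball x (3 * r)) <=
    (2 * K ^+ 2 * g / (eta - 1) * vol mu x r)%:E)%E.
Proof.
move=> w0 mw l0 g0 sb HK K1 eta1 gK [_ nSx] /andP[r0 rs] nMy xy.
have rb : 0 < r <= b by apply/andP; split => //; clear -mu_pos mu_balls LDP r0 rs sb; lra.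
have r8 : 0 < 8 * r <= b by clear -mu_pos mu_balls LDP r0 rs sb; apply/andP; split; lra.
have [m m0 Hm] := not_sharp_set w0 mw nSx r8 (mem_ball_center x (proj1 (andP r8))).
have vK : vol mu x (8 * r) <= K * vol mu x r.
  by apply: le_trans (HK _ _ rb); apply: vol_le => //; rewrite mdistxx add0r; clear -mu_pos mu_balls LDP r0; lra.
have mle : m <= l * (1 + g * K).
  apply: (@oscillation_center_le w s l x (8 * r) y r) => //.
  - by rewrite r0.
  - by apply: sub_ball; rewrite metric_sym; clear -mu_pos mu_balls LDP xy r0; lra.
  - by apply: le_trans (HK _ _ rb); apply: vol_le => //; clear -mu_pos mu_balls LDP xy r0; lra.
pose f : borel M -> R := fun y => `|w y - m|.
pose w' : borel M -> R := f \_ (ball x (8 * r)).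
have mB c1 r1 : measurable (ball c1 r1 : set (borel M)) by exact: measurable_ball_metric.
have mf : measurable_fun setT f.
  by apply: measurableT_comp => //; exact: measurable_funB.
have mw' : measurable_fun setT w'.
  apply: (iffLR (measurable_restrictT _ _)); [exact: mB|exact: measurable_funTS].
have w'0 z : 0 <= w' z by rewrite /w' patchE; case: ifP => // _; exact: normr_ge0.
(* The gap between [eta * l] and [m]: the assumption on [g * K] gives [m <= l * (eta + 1) / 2]. *)
pose l' := (eta - 1) * l / 2.
have l'0 : 0 < l' by rewrite divr_gt0// mulr_gt0// subr_gt0.
have Hs c1 r1 : 0 < r1 <= s -> vol mu c1 (16 * r1) <= K * vol mu c1 r1.
  by move=> /andP[p1 p2]; apply: HK; apply/andP; split => //; clear -mu_pos mu_balls LDP p1 p2 sb; lra.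
have sub : good_set w s l eta b g kappa `&` ball x (3 * r) `<=` maximal_set mu w' s l'.
  move=> z [[[_ [[c p] [/= /andP[p0 ps] HB] zB]] nSz] xz].
  move: zB HB => /= zB HB; exists (c, p) => //; split => /=; first by rewrite p0.
  have [pr|rp] := leP p r.
    have sB : ball c p `<=` ball x (8 * r).
      move: xz zB; rewrite !ballP => xz zB; apply: sub_ball.
      have := metric_triangle c z x; rewrite (metric_sym z x).
      by clear -mu_pos mu_balls LDP xz zB pr r0; lra.
    have [H1 _] := integral_center_comparison c p w0 mw m0.
    rewrite (_ : \int[mu]_(y in ball c p) _ = \int[mu]_(y in ball c p) (f y)%:E)%E; last first.
      apply: eq_integral => u; rewrite inE => cu.
      by rewrite /w' patchE mem_set//; exact: sB.
    rewrite ltNge; apply/negP => Hf.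
    have := lt_le_trans HB (le_trans H1 (leeD2l _ Hf)).
    rewrite -EFinD lte_fin -mulrDl ltr_pM2r; last exact: vol_gt0.
    rewrite ltNge => /negP; apply; apply: le_trans (lerD mle (lexx _)) _.
    by rewrite /l'; have := ler_wpM2l (ltW l0) gK; clear -mu_pos mu_balls LDP; lra.
  (* For [p > r] the point [y] is within [7 * p] of [z]. Small oscillation on the ball of radius
     [8 * p] about [z] then carries the bound at [y] over to [ball c p], whose average cannot exceed
     [eta * l]. *)
  exfalso; have p8 : 0 < 8 * p <= b by clear -mu_pos mu_balls LDP p0 ps sb; apply/andP; split; lra.
  have [m' m'0 Hm'] := not_sharp_set w0 mw nSz p8 (mem_ball_center z (proj1 (andP p8))).
  have pb : 0 < p <= b by clear -mu_pos mu_balls LDP p0 ps sb; apply/andP; split; lra.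
  move: xz zB; rewrite !ballP => xz zB.
  have yz : mdist y z < 7 * p.
    by have := metric_triangle y x z; rewrite (metric_sym y x); clear -mu_pos mu_balls LDP xy xz rp; lra.
  have m'le : m' <= l * (1 + g * K).
    apply: (@oscillation_center_le w s l z (8 * p) y p) => //.
    - by rewrite p0.
    - by apply: sub_ball; clear -mu_pos mu_balls LDP yz; lra.
    - by apply: le_trans (HK _ _ pb); apply: vol_le => //; rewrite metric_sym; clear -mu_pos mu_balls LDP yz p0; lra.
  have [|H1 _] := average_comparison w0 mw m'0 _ Hm' (c := c) (r := p).
    by apply: sub_ball; clear -mu_pos mu_balls LDP zB p0; lra.
  have := lt_le_trans HB H1; rewrite lte_fin ltNge => /negP; apply.
  have v8 : vol mu z (8 * p) <= K * vol mu c p.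
    by apply: le_trans (HK _ _ pb); apply: vol_le => //; rewrite metric_sym; clear -mu_pos mu_balls LDP zB p0; lra.
  have v0 : 0 <= vol mu c p by apply: ltW; exact: vol_gt0.
  have gl : 0 <= g * l by rewrite mulr_ge0// ltW.
  apply: (@le_trans _ _ (l * (1 + g * K) * vol mu c p + g * l * (K * vol mu c p))).
    by apply: lerD; [exact: ler_wpM2r|exact: ler_wpM2l].
  have := ler_wpM2r v0 (ler_wpM2l (ltW l0) gK).
  by move: (vol mu c p) => v; clear -mu_pos mu_balls LDP; lra.
apply: (@le_trans _ _ (mu (maximal_set mu w' s l'))).
  rewrite le_measure ?inE//; last exact: measurable_balls_union.
  by apply: measurableI => //; exact: measurable_good_set.
have K0 : 0 <= K by exact: le_trans K1.
apply: le_trans (weak_type mu_pos mu_balls LDP w'0 mw' Hs K0 l'0) _.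
have -> : (\int[mu]_u (w' u)%:E = \int[mu]_(u in ball x (8 * r)) (f u)%:E)%E.
  rewrite [RHS]integral_mkcond; apply: eq_integral => u _.
  by rewrite /w' !patchE; case: ifP.
apply: (@le_trans _ _ ((K / l')%:E * (g * l * vol mu x (8 * r))%:E)%E).
  by apply: lee_wpmul2l => //; rewrite lee_fin divr_ge0// ltW.
rewrite -EFinM lee_fin.
have v0 : 0 <= vol mu x r by apply: ltW; exact: vol_gt0.
have gl : 0 <= K / l' * (g * l).
  apply: mulr_ge0; first by apply: divr_ge0 => //; exact: ltW.
  by apply: mulr_ge0 => //; exact: ltW.
rewrite mulrA; apply: le_trans (ler_wpM2l gl vK) _.
rewrite le_eqVlt; apply/orP; left; apply/eqP; rewrite /l'.
have e1 : eta - 1 != 0 by rewrite subr_eq0 gt_eqF.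
by field; rewrite e1 gt_eqF.
Qed.

End GoodLambda.

Section GoodLambdaInequality.
Context (R : realType) (M : pointedMetricType R).
Variable mu : {measure set (borel M) -> \bar R}.
Hypothesis mu_pos : (0 < mu setT)%E.
Hypothesis mu_balls : balls_finite mu.
Hypothesis LDP : locally_doubling mu.
Implicit Types (x y c : M) (r s b e : R) (E A : set M) (w : borel M -> R).

(** The largest [kappa / 2 ^+ n] whose ball stays in [A]. If [n] is positive, the doubled ball
    leaves [A]; if [n = 0], the layer provides a point of the complement within [2 * kappa]. All
    radii stay below [kappa], where local doubling is uniform. *)
Lemma whitney_radius A kappa x : open A -> 0 < kappa -> layer A kappa x ->
  exists r y, [/\ 0 < r <= kappa, ball x r `<=` A, ~ A y & mdist x y < 4 * r].
Proof.
move=> oA k0 /layerP[Ax Hx].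
have /open_metricP/(_ x Ax)[r0 r00 Hr0] := oA.
have exn : exists n, `[< ball x (kappa / 2 ^+ n) `<=` A >].
  exists (Num.truncn (kappa / r0)).+1; apply/asboolP.
  apply: subset_trans Hr0; apply: sub_ball; rewrite mdistxx add0r.
  rewrite ler_pdivrMr ?exprn_gt0// mulrC -ler_pdivrMr//.
  apply: le_trans (ltW (truncnS_gt _)) _.
  by rewrite -natrX ler_nat ltnW// ltn_expl.
case: (ex_minnP exn) => n /asboolP Hn nmin.
have kn0 : 0 < kappa / 2 ^+ n by rewrite divr_gt0// exprn_gt0.
case: n Hn nmin kn0 => [|n] Hn nmin kn0.
  have [y nAy xy] := Hx _ k0; exists kappa, y; split => //.
  - by rewrite k0 lexx.
  - by move: Hn; rewrite expr0 divr1.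
  - by move: xy; lra.
have : ~ ball x (kappa / 2 ^+ n) `<=` A.
  by move=> /asboolP /nmin; rewrite ltnn.
move/existsNP => [y /not_implyP[xy nAy]].
exists (kappa / 2 ^+ n.+1), y; split => //.
  rewrite kn0 ler_pdivrMr ?exprn_gt0// ler_peMr ?(ltW k0)//.
  by rewrite exprn_ege1// ler1n.
move: xy; rewrite ballP => /lt_le_trans; apply.
rewrite exprS invfM mulrA mulrCA mulrA.
by rewrite ler_pM2r ?invr_gt0 ?exprn_gt0//; move: k0; lra.
Qed.

(** The level set at [eta * l] is covered by the part of [A] away from its boundary layer, the good
    set and the sharp set. The layer takes at least the proportion [delta] away from the first. The
    inequality is kept additive so that no measures, possibly infinite, are subtracted. *)
Lemma good_lambda w s l eta b g kappa (K delta : R) : (forall x, 0 <= w x) ->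
  measurable_fun setT w -> 0 < l -> 0 <= g -> 8 * s <= b ->
  (forall c r, 0 < r <= b -> vol mu c (16 * r) <= K * vol mu c r) -> 1 <= K ->
  1 < eta -> 2 * (g * K) <= eta - 1 -> 0 < kappa <= s ->
  (delta%:E * mu (maximal_set mu w s l) <=
    mu (layer (maximal_set mu w s l) kappa))%E ->
  (mu (maximal_set mu w s (eta * l)) + delta%:E * mu (maximal_set mu w s l) <=
   mu (maximal_set mu w s l) +
   (2 * K ^+ 2 * g / (eta - 1))%:E * mu (maximal_set mu w s l) +
   mu (sharp_set mu w b (g * l)))%E.
Proof.
move=> w0 mw l0 g0 sb HK K1 eta1 gK /andP[k0 ks] HL.
set A := maximal_set mu w s l; set G := good_set mu w s l eta b g kappa.
have oA : open A by exact: open_balls_union.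
have mA : measurable (A : set (borel M)) by exact: measurable_open.
have mL : measurable (layer A kappa : set (borel M)) by exact: measurable_layer.
have mG : measurable (G : set (borel M)) by exact: measurable_good_set.
have mS : measurable (sharp_set mu w b (g * l) : set (borel M)).
  exact: measurable_balls_union.
set C := 2 * K ^+ 2 * g / (eta - 1).
have C0 : 0 <= C.
  rewrite /C; apply: divr_ge0; last by rewrite subr_ge0 ltW.
  by apply: mulr_ge0 => //; rewrite mulr_ge0// sqr_ge0.
have GA : (mu G <= C%:E * mu A)%E.
  (* These Whitney balls are centred in [G] and contained in [A]; after Vitali selection the
     measures of the disjoint ones add up to at most that of [A]. *)
  pose P : set (M * R) := [set B | G B.1 /\ exists y, [/\ 0 < B.2 <= kappa,
    ball B.1 B.2 `<=` A, ~ A y & mdist B.1 y < 4 * B.2]].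
  have -> : G = G `&` balls_union P.
    apply/seteqP; split=> [x Gx|x []//]; split => //.
    have [[Lx _] _] := Gx.
    have [r [y [r0 rA nAy xy]]] := whitney_radius oA k0 Lx.
    exists (x, r); last by apply: mem_ball_center; case/andP: r0.
    by split => //; exists y.
  apply: mu_balls_union_le => // t tP.
  have [|t' [ut' t't tt' /le_trans]] := vitali_measure_le mu (s := t) mG.
    by move=> B /tP[_ [y [/andP[]]]].
  apply; apply: (@le_trans _ _ (\sum_(B <- t') C%:E * mu (ball B.1 B.2))%E).
    rewrite big_seq [leRHS]big_seq; apply: lee_sum => B /t't/tP[GB [y [/andP[r0 rk] _ nAy By]]].
    rewrite mu_ballE// -EFinM.
    apply: (whitney_ball mu_pos mu_balls LDP (y := y)) => //.
    by rewrite r0 (le_trans rk).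
  rewrite -ge0_sume_distrr//; apply: lee_wpmul2l; first by rewrite lee_fin.
  have mB B : measurable (ball B.1 B.2 : set (borel M)).
    exact: (@measurable_ball_metric R M).
  rewrite -(@measure_bigcup_seq _ _ _ mu _ t' (fun B : M * R => ball B.1 B.2 : set (borel M)))//.
  rewrite le_measure ?inE//; first by rewrite bigcup_seq; exact: bigsetU_measurable.
  by apply: bigcup_sub => B /t't/tP[_ [y []]].
have mAL : measurable (A `\` layer A kappa : set (borel M)) by exact: measurableD.
have sub : maximal_set mu w s (eta * l) `<=`
    (A `\` layer A kappa) `|` (G `|` sharp_set mu w b (g * l)).
  move=> x Hx; have Ax : A x.
    have [B [Bs HB] Bx] := Hx; exists B => //; split => //.
    apply: le_lt_trans HB; rewrite lee_fin ler_wpM2r//; last by rewrite ler_peMl// ltW.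
    by rewrite /vol fine_ge0.
  have [Lx|nLx] := pselect (layer A kappa x); last by left.
  by right; have [Sx|nSx] := pselect (sharp_set mu w b (g * l) x); [right|left].
have H1 : (mu (maximal_set mu w s (eta * l)) <=
    mu (A `\` layer A kappa) + (mu G + mu (sharp_set mu w b (g * l))))%E.
  apply: le_trans (_ : (mu ((A `\` layer A kappa) `|` (G `|` sharp_set mu w b (g * l))) <= _)%E).
    rewrite le_measure ?inE//; first exact: measurable_balls_union.
    by apply: measurableU => //; exact: measurableU.
  apply: le_trans (measureU2 mu mAL (measurableU _ _ mG mS)) _.
  by apply: leeD2l; exact: measureU2.
have EA : (mu A = mu (A `\` layer A kappa) + mu (layer A kappa))%E.
  rewrite -measureU//; last by apply/seteqP; split => // x [[]].
  congr (mu _); apply/seteqP; split=> [x Ax|x [[]//|[]//]].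
  by have [Lx|nLx] := pselect (layer A kappa x); [right|left].
apply: le_trans (leeD H1 HL) _.
rewrite addeAC -/A -EA -addeA; apply: leeD2l; exact: leeD2r.
Qed.

End GoodLambdaInequality.

(** * Discrete layer-cake sums *)

Section LevelSums.
Context (R : realType).
Implicit Types (eta q t x : R) (n k : nat).

(** The levels below [x] form a geometric progression, so their sum is governed by its last term,
    which is less than [x] to the power [q]; multiplication by the ratio minus 1 telescopes. *)
Lemma level_sum_le eta q t x n : 1 < eta -> 0 < q -> 0 < t -> 0 <= x ->
  \sum_(k < n) (if t * eta ^+ k < x then (t * eta ^+ k) `^ q else 0) <=
  eta `^ q / (eta `^ q - 1) * x `^ q.
Proof.
move=> eta1 q0 t0 x0; have eta0 : 0 < eta by exact: lt_trans eta1.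
have E1 : 1 < eta `^ q.
  have -> : 1 = 1 `^ q :> R by rewrite powR1.
  by apply: gt0_ltr_powR => //; rewrite nnegrE// ltW.
have E0 : 0 < eta `^ q - 1 by rewrite subr_gt0.
have EV : 0 <= eta `^ q / (eta `^ q - 1) by rewrite divr_ge0 ?powR_ge0// ltW.
elim: n => [|n IH]; first by rewrite big_ord0 mulr_ge0// powR_ge0.
have [tx|tx] := ltP (t * eta ^+ n) x; last first.
  by rewrite big_ord_recr/= ltNge tx addr0.
have tn m : (m <= n)%N -> t * eta ^+ m < x.
  move=> mn; apply: le_lt_trans tx; rewrite ler_pM2l//.
  by rewrite ler_weXn2l// ltW.
apply: (@le_trans _ _ (\sum_(k < n.+1) (t * eta ^+ k) `^ q)).
  by apply: ler_sum => k _; rewrite tn// -ltnS ltn_ord.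
have sumE m : (eta `^ q - 1) * \sum_(k < m) (t * eta ^+ k) `^ q =
    (t * eta ^+ m) `^ q - t `^ q.
  elim: m => [|m IHm]; first by rewrite big_ord0 mulr0 expr0 mulr1 subrr.
  rewrite big_ord_recr/= mulrDr IHm exprS mulrCA (powRM _ (ltW eta0)).
    by ring.
  by rewrite mulr_ge0 ?exprn_ge0// ltW.
rewrite mulrAC ler_pdivlMr// mulrC sumE.
rewrite exprS mulrCA (powRM _ (ltW eta0)); last by rewrite mulr_ge0 ?exprn_ge0// ltW.
apply: (@le_trans _ _ (eta `^ q * (t * eta ^+ n) `^ q)).
  by rewrite gerBl powR_ge0.
rewrite ler_wpM2l ?powR_ge0//; apply: ge0_ler_powR => //; rewrite ?nnegrE//; try exact: ltW.
by rewrite mulr_ge0 ?exprn_ge0// ltW.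
Qed.

(** The single largest level below [x] suffices, since [x] is at most [eta] times it. *)
Lemma le_level_sum eta q t x n : 1 < eta -> 0 < q -> 0 < t ->
  t < x <= t * eta ^+ n ->
  x `^ q <= eta `^ q * \sum_(k < n) (if t * eta ^+ k < x then (t * eta ^+ k) `^ q else 0).
Proof.
move=> eta1 q0 t0 /andP[tx]; have eta0 : 0 < eta by exact: lt_trans eta1.
have x0 : 0 < x by exact: lt_trans tx.
elim: n => [|n IH]; first by rewrite expr0 mulr1 leNgt tx.
move=> xn; rewrite big_ord_recr/=; case: ltP => [tnx|/IH]; last by rewrite addr0.
rewrite mulrDr; apply: ler_wpDl.
  rewrite mulr_ge0 ?powR_ge0//; apply: sumr_ge0 => k _.
  by case: ifP => // _; exact: powR_ge0.
have tn0 : 0 <= t * eta ^+ n by rewrite mulr_ge0 ?exprn_ge0// ltW.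
rewrite -powRM ?(ltW eta0)//; apply: ge0_ler_powR; rewrite ?nnegrE ?(ltW q0) ?(ltW x0)//.
  by rewrite mulr_ge0// ltW.
by rewrite mulrCA -exprS.
Qed.

End LevelSums.

(** * From the good-lambda inequality to an inequality for the sharp function *)

Section SharpInequality.
Context (R : realType) (M : pointedMetricType R).
Variable mu : {measure set (borel M) -> \bar R}.
Hypothesis mu_pos : (0 < mu setT)%E.
Hypothesis mu_balls : balls_finite mu.
Hypothesis LDP : locally_doubling mu.
Implicit Types (x y c : M) (r s b e : R) (E A : set M) (w : borel M -> R).

(** Values of [w] up to [l / 2] contribute at most [l / 2] to an average, so a ball with average
    above [l] keeps an average above [l / 2] after truncation. *)
Lemma weak_type_truncated w s (K l : R) : (forall x, 0 <= w x) ->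
  measurable_fun setT w ->
  (forall c r, 0 < r <= s -> vol mu c (16 * r) <= K * vol mu c r) -> 0 <= K ->
  0 < l ->
  (mu (maximal_set mu w s l) <=
   (2 * K / l)%:E * \int[mu]_x (if l / 2 < w x then w x else 0)%:E)%E.
Proof.
move=> w0 mw HK K0 l0; pose w1 (x : borel M) := if l / 2 < w x then w x else 0.
have mw1 : measurable_fun setT w1.
  apply: measurable_fun_ifT => //.
  by apply: measurable_fun_ltr => //; exact: measurable_cst.
have w10 x : 0 <= w1 x by rewrite /w1; case: ifP.
have l20 : 0 < l / 2 by rewrite divr_gt0.
apply: le_trans (_ : (mu (maximal_set mu w1 s (l / 2)) <= _)%E).
  rewrite le_measure ?inE//; try exact: measurable_balls_union.
  move=> x [B [Bs HB] Bx]; exists B => //; split => //.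
  have mB : measurable (ball B.1 B.2 : set (borel M)) by exact: measurable_ball_metric.
  rewrite ltNge; apply/negP => H.
  have : (\int[mu]_(x in ball B.1 B.2) (w x)%:E <=
      \int[mu]_(x in ball B.1 B.2) ((l / 2)%:E + (w1 x)%:E))%E.
    apply: ge0_le_integral => //.
    - by move=> y _; rewrite lee_fin.
    - by apply/measurable_EFinP; exact: measurable_funTS.
    - apply: emeasurable_funD; first exact: measurable_cst.
      by apply/measurable_EFinP; exact: measurable_funTS.
    - move=> y _; rewrite -EFinD lee_fin /w1; case: ltP => [_|]; last by lra.
      by rewrite lerDr ltW.
  rewrite ge0_integralD//; first last.
  - by apply/measurable_EFinP; exact: measurable_funTS.
  - by move=> y _; rewrite lee_fin.
  - by move=> y _; rewrite lee_fin ltW.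
  rewrite integral_cst// mu_ballE// => /(lt_le_trans HB); apply/negP.
  rewrite -leNgt; apply: le_trans (leeD2l _ H) _.
  by rewrite -EFinM -EFinD lee_fin -mulrDl -splitr.
apply: le_trans (weak_type mu_pos mu_balls LDP w10 mw1 HK K0 l20) _.
by rewrite invf_div mulrA (mulrC K).
Qed.

(** Where [w > l / 2] one has [w <= (2 / l) * w ^+ 2]. It provides the a priori finiteness of level
    sets and the initial term of the recursion. *)
Lemma maximal_set_L2 w s (K l : R) : (forall x, 0 <= w x) ->
  measurable_fun setT w ->
  (forall c r, 0 < r <= s -> vol mu c (16 * r) <= K * vol mu c r) -> 0 <= K ->
  0 < l ->
  (mu (maximal_set mu w s l) <= (4 * K / l ^+ 2)%:E * \int[mu]_x (w x ^+ 2)%:E)%E.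
Proof.
move=> w0 mw HK K0 l0; apply: le_trans (weak_type_truncated w0 mw HK K0 l0) _.
have l20 : 0 < l / 2 by rewrite divr_gt0.
have -> : 4 * K / l ^+ 2 = 2 * K / l * (2 / l) by field; rewrite gt_eqF.
rewrite (EFinM (2 * K / l)) -muleA; apply: lee_wpmul2l.
  by rewrite lee_fin divr_ge0 ?mulr_ge0// ltW.
have mw2 : measurable_fun setT (fun x : borel M => w x ^+ 2) by exact: measurable_funX.
rewrite -ge0_integralZl_EFin//; last 3 first.
- by move=> x _; rewrite lee_fin sqr_ge0.
- exact/measurable_EFinP.
- by rewrite divr_ge0// ltW.
apply: ge0_le_integral => //.
- by move=> x _; rewrite lee_fin; case: ifP.
- apply/measurable_EFinP; apply: measurable_fun_ifT => //.
  by apply: measurable_fun_ltr => //; exact: measurable_cst.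
- by apply/measurable_EFinP; apply: measurable_funM => //; exact: measurable_cst.
- move=> x _; rewrite lee_fin; case: ltP => [H|_]; last by rewrite mulr_ge0 ?sqr_ge0// divr_ge0// ltW.
  rewrite expr2 mulrA ler_peMl// mulrAC ler_pdivlMr// mul1r; lra.
Qed.

(** A weighted sum over several level sets may be tested on finite lists of balls: Lindelof
    sequences for all levels are run with a common index and the limit is taken in the sum. *)
Lemma sum_balls_union_le (c : nat -> R) (P : nat -> set (M * R)) n (Q : \bar R) :
  (forall k, 0 <= c k) ->
  (forall u : nat -> seq (M * R), (forall k B, (k < n)%N -> B \in u k -> P k B) ->
    (\sum_(k < n) (c k)%:E * mu (balls_union [set` u k]) <= Q)%E) ->
  (\sum_(k < n) (c k)%:E * mu (balls_union (P k)) <= Q)%E.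
Proof.
move=> c0 H.
have /choice[u Hu] k : exists u : nat -> seq (M * R),
  [/\ forall n B, B \in u n -> P k B,
    nondecreasing_seq (fun n => balls_union [set` u n]) &
    balls_union (P k) = \bigcup_n balls_union [set` u n]].
  exact: (lindelof_balls mu_pos mu_balls LDP).
have cv k : mu (balls_union [set` u k m]) @[m --> \oo] --> mu (balls_union (P k)).
  have [_ nd ->] := Hu k; apply: nondecreasing_cvg_mu => //.
    by move=> m; exact: measurable_balls_union.
  by apply: bigcupT_measurable => m; exact: measurable_balls_union.
have cvs : (\sum_(k < n) (c k)%:E * mu (balls_union [set` u k m]))%E @[m --> \oo] -->
    (\sum_(k < n) (c k)%:E * mu (balls_union (P k)))%E.
  elim: n {H} => [|n IH].
    by under eq_fun do rewrite big_ord0; rewrite big_ord0; exact: cvg_cst.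
  under eq_fun do rewrite big_ord_recr/=; rewrite big_ord_recr/=.
  apply: cvgeD => //; last exact: cvgeZl.
  apply: ge0_adde_def; rewrite inE; last by rewrite mule_ge0// lee_fin.
  by apply: sume_ge0 => k _; rewrite mule_ge0// lee_fin.
rewrite -(cvg_lim _ cvs)//; apply: lime_le.
  by apply/cvg_ex; eexists; exact: cvs.
apply: nearW => m; apply: (H (fun k => u k m)) => k B _.
by have [+ _ _] := Hu k; exact.
Qed.

End SharpInequality.

(** Weighting the recurrence by [c k.+1 = e * c k] turns the term in [a k] into at most [rho] times
    the same weighted sum, which moves to the left side. The induction carries the extra term
    [c n * a n], dropped at the end by positivity. *)
Lemma recurrence_sum_le (R : realType) (a b c : nat -> R) (q e rho : R) n :
  (forall k, 0 <= a k) -> (forall k, 0 <= c k) -> 0 <= e ->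
  (forall k, c k.+1 = e * c k) -> e * q <= rho ->
  (forall k, (k < n)%N -> a k.+1 <= q * a k + b k) ->
  (1 - rho) * \sum_(k < n) c k * a k <= c 0%N * a 0%N + e * \sum_(k < n) c k * b k.
Proof.
move=> a0 c0 e0 cS eq ab.
suff: \sum_(k < n) c k * a k + c n * a n <=
    c 0%N * a 0%N + rho * (\sum_(k < n) c k * a k) + e * \sum_(k < n) c k * b k.
  have : 0 <= c n * a n by rewrite mulr_ge0.
  by lra.
elim: n ab => [|n IH] ab; first by rewrite !big_ord0 !mulr0 add0r !addr0.
rewrite !big_ord_recr/= !mulrDr.
have /IH{IH} IH : forall k, (k < n)%N -> a k.+1 <= q * a k + b k.
  by move=> k kn; apply: ab; exact: ltnW.
have : c n.+1 * a n.+1 <= rho * (c n * a n) + e * (c n * b n).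
  rewrite cS -mulrA; apply: (@le_trans _ _ (e * (c n * (q * a n + b n)))).
    by rewrite !ler_wpM2l// ab.
  have -> : e * (c n * (q * a n + b n)) = e * q * (c n * a n) + e * (c n * b n) by ring.
  by rewrite lerD2r ler_wpM2r// mulr_ge0.
by lra.
Qed.

Section SharpMaximal.
Context (R : realType) (M : pointedMetricType R).
Variable mu : {measure set (borel M) -> \bar R}.
Hypothesis mu_pos : (0 < mu setT)%E.
Hypothesis mu_balls : balls_finite mu.
Hypothesis LDP : locally_doubling mu.
Implicit Types (x y c : M) (r s b e : R) (E A : set M) (w : borel M -> R).

(** Along the ladder [t * eta ^+ k] the good-lambda inequality is a linear recurrence with factor
    [1 - delta / 2], while the weights grow by the p-th power of [eta]; their product is at most
    [rho < 1]. The initial level set is measured by [W]. *)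
Lemma sum_maximal_set_le w s b (p eta g kappa K delta rho t Q W : R) n :
  (forall x, 0 <= w x) -> measurable_fun setT w ->
  (\int[mu]_x (w x ^+ 2)%:E <= W%:E)%E -> 0 < t -> 0 <= g -> 8 * s <= b ->
  (forall c r, 0 < r <= b -> vol mu c (16 * r) <= K * vol mu c r) -> 1 <= K ->
  1 < eta -> 2 * (g * K) <= eta - 1 -> 0 < kappa <= s ->
  (forall A, open A -> (mu A < +oo)%E -> (delta%:E * mu A <= mu (layer A kappa))%E) ->
  2 * K ^+ 2 * g / (eta - 1) <= delta / 2 -> eta `^ p * (1 - delta / 2) <= rho ->
  rho < 1 ->
  (forall u : nat -> seq (M * R), (forall k B, (k < n)%N -> B \in u k ->
      sharp_balls mu w b (g * (t * eta ^+ k)) B) ->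
    (\sum_(k < n) ((t * eta ^+ k) `^ p)%:E * mu (balls_union [set` u k]) <= Q%:E)%E) ->
  (\sum_(k < n) ((t * eta ^+ k) `^ p)%:E * mu (maximal_set mu w s (t * eta ^+ k)) <=
    ((4 * K * t `^ (p - 2) * W + eta `^ p * Q) / (1 - rho))%:E)%E.
Proof.
move=> w0 mw HW t0 g0 sb HK K1 eta1 gK /andP[k0 ks] HL Hd Hr rho1 HQ.
have eta0 : 0 < eta by exact: lt_trans eta1.
have K0 : 0 <= K by exact: le_trans K1.
have tk k : 0 < t * eta ^+ k by rewrite mulr_gt0// exprn_gt0.
have HK' c r : 0 < r <= s -> vol mu c (16 * r) <= K * vol mu c r.
  by move=> /andP[r0 rs]; apply: HK; rewrite r0/=; lra.
have W0 : 0 <= W.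
  rewrite -lee_fin; apply: le_trans HW; apply: integral_ge0 => x _.
  by rewrite lee_fin sqr_ge0.
have HM k : (mu (maximal_set mu w s (t * eta ^+ k)) <=
    (4 * K / (t * eta ^+ k) ^+ 2 * W)%:E)%E.
  apply: le_trans (maximal_set_L2 mu_pos mu_balls LDP w0 mw HK' K0 (tk k)) _.
  rewrite (EFinM _ W); apply: lee_wpmul2l => //.
  by rewrite lee_fin divr_ge0 ?sqr_ge0 ?mulr_ge0.
pose c k := (t * eta ^+ k) `^ p.
have c_gt0 k : 0 < c k by rewrite powR_gt0.
have cS k : c k.+1 = eta `^ p * c k.
  have tS : t * eta ^+ k.+1 = eta * (t * eta ^+ k) by rewrite exprS mulrCA.
  by rewrite /c tS powRM//; apply: ltW.
pose a k := fine (mu (maximal_set mu w s (t * eta ^+ k))).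
have aE k : mu (maximal_set mu w s (t * eta ^+ k)) = (a k)%:E.
  rewrite /a fineK// ge0_fin_numE ?measure_ge0//.
  exact: le_lt_trans (HM k) (ltry _).
have a0 k : 0 <= a k by rewrite fine_ge0.
pose b' k := fine (mu (sharp_set mu w b (g * (t * eta ^+ k)))).
have HS : (\sum_(k < n) (c k)%:E * mu (sharp_set mu w b (g * (t * eta ^+ k))) <= Q%:E)%E.
  apply: (sum_balls_union_le mu_pos mu_balls LDP (P := fun k => sharp_balls mu w b (g * (t * eta ^+ k)))) => [k|//].
  exact: ltW.
(* Finiteness of the sharp level sets is read off from [Q]: an infinite one, weighted by the
   positive [c k], would make the sum infinite. *)
have bE k : (k < n)%N -> mu (sharp_set mu w b (g * (t * eta ^+ k))) = (b' k)%:E.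
  move=> kn; rewrite /b' fineK// ge0_fin_numE ?measure_ge0//.
  rewrite ltNge leye_eq; apply/negP => /eqP E.
  have := HS; rewrite (bigD1 (Ordinal kn))//= E gt0_muley ?lte_fin// addye; last first.
    rewrite gt_eqF// (lt_le_trans ltNy0)// sume_ge0// => i _.
    by rewrite mule_ge0// lee_fin ltW.
  by [].
have ab k : (k < n)%N -> a k.+1 <= (1 - delta / 2) * a k + b' k.
  move=> kn; have ok : open (maximal_set mu w s (t * eta ^+ k)).
    exact: open_balls_union.
  have fk : (mu (maximal_set mu w s (t * eta ^+ k)) < +oo)%E by rewrite aE ltry.
  have := good_lambda mu_pos mu_balls LDP w0 mw (tk k) g0 sb HK K1 eta1 gK
    _ (HL _ ok fk).
  rewrite k0 ks => /(_ isT).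
  rewrite mulrCA -exprS !aE (bE _ kn) -!EFinM -!EFinD lee_fin => H.
  have : 2 * K ^+ 2 * g / (eta - 1) * a k <= delta / 2 * a k by rewrite ler_wpM2r.
  by lra.
rewrite (eq_bigr (fun k : 'I_n => (c k * a k)%:E)); last by move=> k _; rewrite aE -EFinM.
rewrite sumEFin lee_fin.
have := recurrence_sum_le (b := b') a0 (fun k => ltW (c_gt0 k)) (powR_ge0 _ _) cS Hr ab.
move=> H; rewrite ler_pdivlMr ?subr_gt0// mulrC; apply: le_trans H _; apply: lerD.
  have := HM 0%N; rewrite aE lee_fin => /(ler_wpM2l (ltW (c_gt0 0%N))) /le_trans.
  apply; rewrite /c expr0 mulr1 powRB; last by rewrite (gt_eqF t0) implybT.
  rewrite (@powR_mulrn _ t 2) ?(ltW t0)//.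
  rewrite le_eqVlt; apply/orP; left; apply/eqP; ring.
rewrite ler_wpM2l ?powR_ge0// -lee_fin; apply: le_trans HS.
rewrite -sumEFin; apply: lee_sum => k _.
by rewrite bE.
Qed.

(** One p-th power of [eta] is lost by discretising the levels, the other by passing through
    [le_maximal_set] from [w] to its maximal function. *)
Lemma integral_level_le w s (p eta K t : R) n : 0 < s ->
  (forall c r, 0 < r <= s -> vol mu c (16 * r) <= K * vol mu c r) -> 0 <= K ->
  (forall x, 0 <= w x) -> measurable_fun setT w -> 0 < t -> 1 < eta -> 0 < p ->
  (\int[mu]_x (if (eta * t < w x <= eta * (t * eta ^+ n)) then w x `^ p else 0)%:E <=
   (eta `^ p * eta `^ p)%:E *
   \sum_(k < n) ((t * eta ^+ k) `^ p)%:E * mu (maximal_set mu w s (t * eta ^+ k)))%E.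
Proof.
move=> s0 HK K0 w0 mw t0 eta1 p0.
have eta0 : 0 < eta by exact: lt_trans eta1.
have tk k : 0 < t * eta ^+ k by rewrite mulr_gt0// exprn_gt0.
pose L k := [set x : borel M | eta * (t * eta ^+ k) < w x].
have mL k : measurable (L k).
  by rewrite -[L k]setTI; apply: measurable_fun_ltr => //; exact: measurable_cst.
pose F k (x : borel M) := (((t * eta ^+ k) `^ p)%:E * (\1_(L k) x)%:E)%E.
have mF k : measurable_fun setT (F k).
  apply/measurable_EFinP; apply: measurable_funM; first exact: measurable_cst.
  exact: measurable_indic.
have F0 k x : (0 <= F k x)%E by rewrite mule_ge0// lee_fin powR_ge0.
pose F' (x : borel M) := (\sum_(k < n) F k x)%E.
have mF' : measurable_fun setT F' by apply: emeasurable_sum => k; exact: mF.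
apply: (@le_trans _ _ (\int[mu]_x ((eta `^ p * eta `^ p)%:E * F' x))%E).
  apply: ge0_le_integral => //.
  - by move=> x _; rewrite lee_fin; case: ifP => // _; exact: powR_ge0.
  - apply/measurable_EFinP; apply: measurable_fun_ifT.
    + apply: measurable_and.
        by apply: measurable_fun_ltr => //; exact: measurable_cst.
      by apply: measurable_fun_ler => //; exact: measurable_cst.
    + exact: (measurableT_comp (measurable_powR p) mw).
    + exact: measurable_cst.
  - apply: (emeasurable_funM (f := cst _)); first exact: measurable_cst.
    exact: mF'.
  - move=> x _; rewrite /F' /F.
    under eq_bigr do rewrite -EFinM.
    rewrite sumEFin -EFinM lee_fin.
    case: ifP => [/andP[H1 H2]|_]; last first.
      rewrite mulr_ge0 ?mulr_ge0 ?powR_ge0// sumr_ge0// => k _.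
      by rewrite mulr_ge0 ?powR_ge0.
    have H : t < w x / eta <= t * eta ^+ n.
      by rewrite ltr_pdivlMr// ler_pdivrMr// mulrC H1 mulrC H2.
    have -> : w x `^ p = eta `^ p * (w x / eta) `^ p.
      by rewrite -powRM ?divr_ge0 ?(ltW eta0)// mulrC divfK// gt_eqF.
    rewrite -mulrA ler_wpM2l ?powR_ge0//.
    apply: le_trans (le_level_sum eta1 p0 t0 H) _.
    rewrite ler_wpM2l ?powR_ge0//; apply: ler_sum => k _.
    rewrite ltr_pdivlMr// [X in X < _]mulrC indicE /L.
    case: ifPn => H'; first by rewrite mem_set// mulr1.
    by rewrite mulr_ge0 ?powR_ge0.
rewrite ge0_integralZl_EFin//; first last.
- by rewrite mulr_ge0 ?powR_ge0.
- by move=> x _; exact: sume_ge0.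
rewrite lee_wpmul2l ?lee_fin ?mulr_ge0 ?powR_ge0// /F' ge0_integral_sum//.
apply: lee_sum => k _; rewrite ge0_integralZl_EFin ?powR_ge0//; last first.
  by apply/measurable_EFinP; exact: measurable_indic.
rewrite integral_indic// setIT lee_wpmul2l ?lee_fin ?powR_ge0//.
exact: (le_maximal_set mu_pos mu_balls LDP s0 HK).
Qed.

End SharpMaximal.

Lemma powR_lt_1 (R : realType) (x a : R) : 0 <= x < 1 -> 0 < a -> x `^ a < 1.
Proof.
move=> /andP[x0 x1] a0; have -> : 1 = 1 `^ a :> R by rewrite powR1.
by apply: gt0_ltr_powR => //; rewrite nnegrE.
Qed.

Section SharpInequality.
Context (R : realType) (M : pointedMetricType R).
Variable mu : {measure set (borel M) -> \bar R}.
Hypothesis mu_pos : (0 < mu setT)%E.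
Hypothesis mu_balls : balls_finite mu.
Hypothesis LDP : locally_doubling mu.
Implicit Types (x y c : M) (r s b e : R) (E A : set M) (w : borel M -> R).

(** Monotone convergence: the windows of values increase to all positive numbers, and where [w]
    vanishes so does its p-th power. *)
Lemma integral_level_cvg w (p eta B : R) (C : R^nat) : (forall x, 0 <= w x) ->
  measurable_fun setT w -> 0 < p -> 1 < eta -> C @ \oo --> B ->
  (forall m, (\int[mu]_x (if eta * eta ^- m < w x <= eta * eta ^+ m then w x `^ p else 0)%:E
     <= (C m)%:E)%E) ->
  (\int[mu]_x (w x `^ p)%:E <= B%:E)%E.
Proof.
move=> w0 mw p0 eta1 CB H; have eta0 : 0 < eta by exact: lt_trans eta1.
have inv1 : 0 <= eta^-1 < 1 by rewrite invr_ge0 (ltW eta0)/= invf_lt1.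
pose f m (x : borel M) :=
  (if eta * eta ^- m < w x <= eta * eta ^+ m then w x `^ p else 0)%:E.
have f0 m x : (0 <= f m x)%E by rewrite lee_fin; case: ifP => // _; exact: powR_ge0.
have mf m : measurable_fun setT (f m).
  apply/measurable_EFinP; apply: measurable_fun_ifT.
  + apply: measurable_and.
      by apply: measurable_fun_ltr => //; exact: measurable_cst.
    by apply: measurable_fun_ler => //; exact: measurable_cst.
  + exact: (measurableT_comp (measurable_powR p) mw).
  + exact: measurable_cst.
have nd x : nondecreasing_seq (f ^~ x).
  apply/nondecreasing_seqP => m; rewrite lee_fin; case: ifP => [/andP[H1 H2]|_]; last first.
    by case: ifP => // _; exact: powR_ge0.
  rewrite ifT//; apply/andP; split.
    apply: le_lt_trans H1; rewrite ler_pM2l// lef_pV2 ?posrE ?exprn_gt0//.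
    by rewrite ler_weXn2l// ltW.
  by apply: le_trans H2 _; rewrite ler_pM2l// ler_weXn2l// ltW.
have lf x : f n x @[n --> \oo] --> (w x `^ p)%:E.
  have [wx0|wx0] := eqVneq (w x) 0.
    rewrite /f wx0 powR0 ?gt_eqF//; apply: cvg_near_cst.
    by apply: nearW => m; case: ifP.
  have wx : 0 < w x by rewrite lt_neqAle eq_sym wx0 w0.
  apply: cvg_near_cst; near=> m; rewrite /f ifT//; apply/andP; split; last first.
    near: m.
    have : w x * eta^-1 ^+ m @[m --> \oo] --> w x * 0.
      by apply: cvgMr; apply: cvg_expr; rewrite ger0_norm; case/andP: inv1.
    rewrite mulr0 => /cvgrPdist_lt/(_ _ eta0) [N _ HN]; exists N => // m /HN/=.
    rewrite sub0r normrN ger0_norm ?exprVn; last by rewrite mulr_ge0// invr_ge0 exprn_ge0// ltW.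
    by rewrite ltr_pdivrMr ?exprn_gt0// => /ltW.
  near: m.
  have : eta * eta^-1 ^+ m @[m --> \oo] --> eta * 0.
    by apply: cvgMr; apply: cvg_expr; rewrite ger0_norm; case/andP: inv1.
  rewrite mulr0 => /cvgrPdist_lt/(_ _ wx) [N _ HN]; exists N => // m /HN/=.
  rewrite sub0r normrN ger0_norm ?exprVn//.
  by rewrite mulr_ge0 ?(ltW eta0)// invr_ge0 exprn_ge0// ltW.
have := @cvg_monotone_convergence _ _ _ mu _ measurableT f mf (fun m x _ => f0 m x) (fun x _ => nd x).
rewrite (eq_integral (fun x : borel M => (w x `^ p)%:E)); last first.
  by move=> x _; apply/cvg_lim => //; exact: lf.
move=> cv; rewrite -(cvg_lim _ cv)//.
have cC : (C m)%:E @[m --> \oo] --> B%:E by apply: cvg_EFin => //; exact: nearW.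
rewrite -(cvg_lim _ cC)//; apply: lee_lim.
- by apply/cvg_ex; eexists; exact: cv.
- by apply/cvg_ex; eexists; exact: cC.
- by apply: nearW => m; exact: H.
Unshelve. all: by end_near. Qed.

(** A local Fefferman-Stein inequality, in which the sharp function enters only through finite lists
    of balls along a ladder, with [Q] uniform in the ladder. Finiteness in L^2 is qualitative: the
    value of that integral is multiplied by a positive power of the lowest level and disappears in
    the limit. *)
Lemma sharp_inequality b (p : R) : 0 < b -> 2 < p -> isoperimetric mu ->
  exists eta g C : R, [/\ 1 < eta, 0 < g, 0 <= C &
  forall w (Q : R), (forall x, 0 <= w x) -> measurable_fun setT w ->
    (\int[mu]_x (w x ^+ 2)%:E < +oo)%E ->
    (forall (t : R) n (u : nat -> seq (M * R)), 0 < t ->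
      (forall k B, (k < n)%N -> B \in u k ->
        sharp_balls mu w b (g * (t * eta ^+ k)) B) ->
      (\sum_(k < n) ((t * eta ^+ k) `^ p)%:E * mu (balls_union [set` u k]) <=
        Q%:E)%E) ->
    (\int[mu]_x (w x `^ p)%:E <= (C * Q)%:E)%E].
Proof.
move=> b0 p2 /(isoperimetric_finite)[k0 [C1 [k00 C10 HI]]].
have p0 : 0 < p by lra.
have [K K1 HK] := doubling16 mu_pos mu_balls LDP b0.
have K0 : 0 < K by exact: lt_le_trans K1.
(* Eightfold dilates of balls of radius at most [s] are still tested by the sharp function at scale
   [b]. *)
pose s := b / 8; have s0 : 0 < s by rewrite divr_gt0.
pose kappa := Num.min k0 s.
have kappa0 : 0 < kappa by rewrite lt_min k00.
(* The cap at 1 keeps [q] positive, so that it can be raised to real powers. *)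
pose delta := Num.min (C1 * kappa) 1.
have delta0 : 0 < delta by rewrite lt_min mulr_gt0//=.
have delta1 : delta <= 1 by rewrite ge_min lexx orbT.
pose q := 1 - delta / 2.
have q0 : 0 < q by rewrite /q; lra.
have q1 : q < 1 by rewrite /q; lra.
(* With this exponent the p-th power of [eta] times [q] is the square root of [q], hence less than
   1. *)
pose eta := q `^ (- (2 * p)^-1).
have p20 : 0 < (2 * p)^-1 by rewrite invr_gt0 mulr_gt0.
have eta1 : 1 < eta.
  rewrite /eta powRN invf_gt1 ?powR_gt0//.
  by apply: powR_lt_1; rewrite ?(ltW q0).
have eta0 : 0 < eta by exact: lt_trans eta1.
pose rho := q `^ 2^-1.
have rho1 : rho < 1 by apply: powR_lt_1; rewrite ?(ltW q0).
have Hr : eta `^ p * (1 - delta / 2) <= rho.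
  rewrite -/q -[X in _ * X](powRr1 (ltW q0)) /eta -powRrM -powRD; last by rewrite (gt_eqF q0) implybT.
  rewrite /rho le_eqVlt; apply/orP; left; apply/eqP; congr (_ `^ _).
  by field; rewrite gt_eqF.
(* The solution of [2 * K ^+ 2 * g / (eta - 1) = delta / 2]: half of the isoperimetric gain pays for
   the good set. *)
pose g := (eta - 1) * delta / (4 * K ^+ 2).
have e1 : 0 < eta - 1 by rewrite subr_gt0.
have g0 : 0 < g by rewrite divr_gt0 ?mulr_gt0 ?exprn_gt0.
have gK : 2 * (g * K) <= eta - 1.
  have -> : 2 * (g * K) = (eta - 1) * (delta / (2 * K)).
    by rewrite /g; field; rewrite gt_eqF.
  by rewrite ger_pMr// ler_pdivrMr ?mulr_gt0// mul1r; lra.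
have Hd : 2 * K ^+ 2 * g / (eta - 1) <= delta / 2.
  rewrite le_eqVlt; apply/orP; left; apply/eqP; rewrite /g; field.
  by rewrite !gt_eqF.
have HL A : open A -> (mu A < +oo)%E -> (delta%:E * mu A <= mu (layer A kappa))%E.
  move=> oA fA; apply: le_trans (HI _ oA fA _ kappa0 _); last by rewrite ge_min lexx.
  by rewrite lee_wpmul2r// lee_fin ge_min lexx.
have sb : 8 * s <= b by rewrite /s mulrC divfK.
have ks : 0 < kappa <= s by rewrite kappa0 ge_min lexx orbT.
have HK' c r : 0 < r <= s -> vol mu c (16 * r) <= K * vol mu c r.
  by move=> /andP[r0 rs]; apply: HK; rewrite r0/=; lra.
have rho0 : 0 < 1 - rho by rewrite subr_gt0.
exists eta, g, (eta `^ p * eta `^ p * eta `^ p / (1 - rho)); split => //.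
  by rewrite divr_ge0 ?(ltW rho0)// !mulr_ge0 ?powR_ge0.
move=> w Q w0 mw W2 HQ.
pose W := fine (\int[mu]_x (w x ^+ 2)%:E).
have W0 : (0 <= \int[mu]_x (w x ^+ 2)%:E)%E.
  by apply: integral_ge0 => x _; rewrite lee_fin sqr_ge0.
have WE : (\int[mu]_x (w x ^+ 2)%:E <= W%:E)%E by rewrite /W fineK// ge0_fin_numE.
pose B m := eta `^ p * eta `^ p *
  ((4 * K * (eta ^- m) `^ (p - 2) * W + eta `^ p * Q) / (1 - rho)).
apply: (@integral_level_cvg _ p eta _ B) => //.
  have -> : eta `^ p * eta `^ p * eta `^ p / (1 - rho) * Q =
     eta `^ p * eta `^ p * ((4 * K * 0 * W + eta `^ p * Q) / (1 - rho)).
    by field; rewrite gt_eqF.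
  apply: cvgMr; apply: cvgMl; apply: cvgD; last exact: cvg_cst.
  apply: cvgMl; apply: cvgMr.
  have -> : (fun m => (eta ^- m) `^ (p - 2)) = GRing.exp ((eta^-1) `^ (p - 2)).
    apply/funext => m; rewrite -exprVn.
    elim: m => [|m IH]; first by rewrite !expr0 powR1.
    by rewrite !exprS powRM ?IH// ?exprn_ge0// invr_ge0 ltW.
  apply: cvg_expr; rewrite ger0_norm ?powR_ge0//.
  by apply: powR_lt_1; rewrite ?subr_gt0// invr_ge0 (ltW eta0) invf_lt1.
(* The ladder starts at [eta ^- m] and takes [m + m] steps, so that it ends at [eta ^+ m]. *)
move=> m; have t0 : 0 < eta ^- m by rewrite invr_gt0 exprn_gt0.
have := integral_level_le mu_pos mu_balls LDP (m + m) s0 HK' (ltW K0) w0 mw t0 eta1 p0.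
rewrite exprD mulKf ?gt_eqF ?exprn_gt0// => /le_trans; apply.
rewrite /B (EFinM (_ * _)); apply: lee_wpmul2l; first by rewrite lee_fin mulr_ge0 ?powR_ge0.
apply: (sum_maximal_set_le mu_pos mu_balls LDP w0 mw WE t0 (ltW g0) sb HK K1 eta1 gK ks HL Hd Hr rho1).
by move=> u; exact: HQ.
Qed.

End SharpInequality.

(** * Complex-valued integration and interpolation on step functions *)

Section Phase.
Context (R : realType).
Implicit Types z : R[i].

Lemma cnorm_conj z : cnorm (z^*)%C = cnorm z.
Proof. by case: z => u v; rewrite /= /normc sqrrN. Qed.

Lemma mul_conj z : (z^*)%C * z = (cnorm z ^+ 2)%:C%C.
Proof.
case: z => u v; apply/eqP; rewrite eq_complex ReM ImM /= /normc sqr_sqrtr ?addr_ge0 ?sqr_ge0//.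
by apply/andP; split; apply/eqP; ring.
Qed.

(* At [z = 0] this is [0]. *)
Definition conj_phase z : R[i] := (z^*)%C * ((cnorm z)^-1)%:C%C.

Lemma conj_phaseM z : conj_phase z * z = (cnorm z)%:C%C.
Proof.
rewrite /conj_phase mulrAC mul_conj -rmorphM/= expr2.
by have [->|z0] := eqVneq (cnorm z) 0; rewrite ?mul0r// mulfK.
Qed.

Lemma cnorm_conj_phase z : z != 0 -> cnorm (conj_phase z) = 1.
Proof.
rewrite -cnorm_gt0 => z0; rewrite /conj_phase normcM cnorm_conj cnorm_real.
by rewrite ger0_norm ?invr_ge0 ?cnorm_ge0// divff// gt_eqF.
Qed.

Lemma cnorm_conj_phase_le1 z : cnorm (conj_phase z) <= 1.
Proof.
have [->|/cnorm_conj_phase->//] := eqVneq z 0.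
by rewrite /conj_phase normcM cnorm_conj normc0 mul0r.
Qed.

End Phase.

Section ComplexIntegration.
Context d (X : measurableType d) (R : realType).
Variable mu : {measure set X -> \bar R}.
Implicit Types (f g : X -> R[i]) (D : set X) (a c : R[i]).

Lemma cmeasurable_cst c : cmeasurable (fun _ : X => c).
Proof. by split; exact: measurable_cst. Qed.

Lemma cmeasurable_real (h : X -> R) : measurable_fun setT h ->
  cmeasurable (fun x => (h x)%:C%C).
Proof. by move=> mh; split => //=; exact: measurable_cst. Qed.

Lemma cmeasurableD f g : cmeasurable f -> cmeasurable g ->
  cmeasurable (fun x => f x + g x).
Proof.
move=> [f1 f2] [g1 g2]; split.
- by under eq_fun do rewrite ReD; exact: measurable_funD.
- by under eq_fun do rewrite ImD; exact: measurable_funD.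
Qed.

Lemma cmeasurableM f g : cmeasurable f -> cmeasurable g ->
  cmeasurable (fun x => f x * g x).
Proof.
move=> [f1 f2] [g1 g2]; split.
- under eq_fun do rewrite ReM.
  by apply: measurable_funB; exact: measurable_funM.
- under eq_fun do rewrite ImM.
  by apply: measurable_funD; exact: measurable_funM.
Qed.

Lemma cmeasurableB f g : cmeasurable f -> cmeasurable g ->
  cmeasurable (fun x => f x - g x).
Proof.
move=> mf mg; under eq_fun do rewrite -mulN1r.
by apply: cmeasurableD => //; apply: cmeasurableM => //; exact: cmeasurable_cst.
Qed.

Lemma cmeasurable_conj f : cmeasurable f -> cmeasurable (fun x => ((f x)^*)%C).
Proof.
move=> [f1 f2]; split.
- by rewrite (_ : (fun x => _) = (fun x => complex.Re (f x)))//; apply/funext => x; case: (f x).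
- rewrite (_ : (fun x => _) = (fun x => - complex.Im (f x))); last first.
    by apply/funext => x; case: (f x).
  exact: measurable_funN.
Qed.

Lemma measurable_cnorm f : cmeasurable f -> measurable_fun setT (fun x => cnorm (f x)).
Proof.
move=> [f1 f2].
rewrite (_ : (fun x => _) =
  (fun x => (complex.Re (f x) ^+ 2 + complex.Im (f x) ^+ 2) `^ 2^-1)).
  apply: (measurableT_comp (measurable_powR _)).
  by apply: measurable_funD; exact: measurable_funX.
by apply/funext => x; case: (f x) => u v /=; rewrite powR12_sqrt// addr_ge0// sqr_ge0.
Qed.

Lemma measurable_cnorm_powR f p : cmeasurable f ->
  measurable_fun setT (fun x => cnorm (f x) `^ p).
Proof.
by move=> /measurable_cnorm mf; exact: (measurableT_comp (measurable_powR p) mf).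
Qed.

Lemma cmeasurable_conj_phase f : cmeasurable f -> cmeasurable (fun x => conj_phase (f x)).
Proof.
move=> mf; apply: cmeasurableM; first exact: cmeasurable_conj.
apply: cmeasurable_real.
rewrite (_ : (fun x => _) = (fun x => cnorm (f x) `^ (-1))).
  exact: measurable_cnorm_powR.
by apply/funext => x; rewrite powR_inv1// cnorm_ge0.
Qed.

Lemma cintegrable_cnorm D f : measurable D -> cmeasurable f ->
  (\int[mu]_(x in D) (cnorm (f x))%:E < +oo)%E -> cintegrable mu D f.
Proof.
move=> mD mf foo; have mcf := measurable_cnorm mf; have [f1 f2] := mf.
have I : mu.-integrable D (EFin \o (fun x => cnorm (f x))).
  apply/integrableP; split; first by apply/measurable_EFinP; exact: measurable_funTS.
  by under eq_integral do rewrite /= ger0_norm ?cnorm_ge0//.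
split; apply: le_integrable I => //.
- by apply/measurable_EFinP; exact: measurable_funTS.
- by move=> x _ /=; rewrite lee_fin (ger0_norm (cnorm_ge0 _)) normr_Re_le.
- by apply/measurable_EFinP; exact: measurable_funTS.
- by move=> x _ /=; rewrite lee_fin (ger0_norm (cnorm_ge0 _)) normr_Im_le.
Qed.

Lemma cintegrableD D f g : measurable D -> cintegrable mu D f -> cintegrable mu D g ->
  cintegrable mu D (fun x => f x + g x).
Proof.
move=> mD [f1 f2] [g1 g2]; split.
- by under eq_fun do rewrite ReD EFinD; exact: integrableD.
- by under eq_fun do rewrite ImD EFinD; exact: integrableD.
Qed.

Lemma cintegrableZ D f a : measurable D -> cintegrable mu D f ->
  cintegrable mu D (fun x => a * f x).
Proof.
move=> mD [f1 f2]; split.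
- under eq_fun do rewrite ReM EFinB.
  apply: integrableB => //.
  + by under eq_fun do rewrite EFinM; exact: integrableZl.
  + by under eq_fun do rewrite EFinM; exact: integrableZl.
- under eq_fun do rewrite ImM EFinD.
  apply: integrableD => //.
  + by under eq_fun do rewrite EFinM; exact: integrableZl.
  + by under eq_fun do rewrite EFinM; exact: integrableZl.
Qed.

Lemma cintegralD D f g : measurable D -> cintegrable mu D f -> cintegrable mu D g ->
  cintegral mu D (fun x => f x + g x) = cintegral mu D f + cintegral mu D g.
Proof.
move=> mD [f1 f2] [g1 g2]; rewrite /cintegral; apply/eqP; rewrite eq_complex /=.
apply/andP; split; apply/eqP.
- by under eq_Rintegral do rewrite ReD; exact: RintegralD.
- by under eq_Rintegral do rewrite ImD; exact: RintegralD.
Qed.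

Lemma cintegralZ D f a : measurable D -> cintegrable mu D f ->
  cintegral mu D (fun x => a * f x) = a * cintegral mu D f.
Proof.
move=> mD [f1 f2]; rewrite /cintegral; apply/eqP; rewrite eq_complex ReM ImM /=.
have Z (h : X -> R) r : mu.-integrable D (fun x => (h x)%:E) ->
    mu.-integrable D (EFin \o (fun x => r * h x)).
  by move=> hi; rewrite /comp; under eq_fun do rewrite EFinM; exact: integrableZl.
apply/andP; split; apply/eqP.
- under eq_Rintegral do rewrite ReM.
  by rewrite RintegralB ?RintegralZl//; exact: Z.
- under eq_Rintegral do rewrite ImM.
  by rewrite RintegralD ?RintegralZl//; exact: Z.
Qed.

(** Rotation by the conjugate phase of the integral makes it real, so that only a real part has to
    be compared and the constant is 1. *)
Lemma cnorm_cintegral_le D f : measurable D -> cmeasurable f ->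
  cintegrable mu D f ->
  ((cnorm (cintegral mu D f))%:E <= \int[mu]_(x in D) (cnorm (f x))%:E)%E.
Proof.
move=> mD mf fi; set z := cintegral mu D f.
have [->|z0] := eqVneq z 0.
  by rewrite normc0; apply: integral_ge0 => x _; rewrite lee_fin cnorm_ge0.
pose u := conj_phase z; have u1 : cnorm u = 1 by exact: cnorm_conj_phase.
have := cintegralZ u mD fi; rewrite -/z => uE.
have [uf _] := cintegrableZ u mD fi.
have /(congr1 (@complex.Re R)) := uE; rewrite conj_phaseM /= => <-.
rewrite /Rintegral fineK; last exact: integrable_fin_num.
have [foo|] := ltP (\int[mu]_(x in D) (cnorm (f x))%:E)%E +oo%E; last first.
  by rewrite leye_eq => /eqP ->; rewrite leey.
apply: le_integral => //.
- apply/integrableP; split.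
    by apply/measurable_EFinP; apply: measurable_funTS; exact: measurable_cnorm.
  by under eq_integral do rewrite /= ger0_norm ?cnorm_ge0//.
- move=> x _; rewrite lee_fin; apply: le_trans (ler_norm _) _.
  by apply: le_trans (normr_Re_le _) _; rewrite normcM u1 mul1r.
Qed.

End ComplexIntegration.

(** * Integrals of p-th powers in place of norms *)

Section Moments.
Context d (X : measurableType d) (R : realType).
Variable mu : {measure set X -> \bar R}.
Implicit Types (f g h : X -> R[i]) (D : set X) (a c : R[i]) (p : R).

(* Locked, because unification would otherwise unfold the integral. *)
Definition moment p f : \bar R := locked (\int[mu]_x (cnorm (f x) `^ p)%:E)%E.

Lemma momentE p f : moment p f = (\int[mu]_x (cnorm (f x) `^ p)%:E)%E.
Proof. by rewrite /moment -lock. Qed.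

Lemma moment_ge0 p f : (0 <= moment p f)%E.
Proof. by rewrite momentE; apply: integral_ge0 => x _; rewrite lee_fin powR_ge0. Qed.

Lemma cLnorm_poweR p f : 0 < p -> poweR (cLnorm mu p%:E f) p = moment p f.
Proof.
move=> p0; rewrite /cLnorm (poweR_Lnorm _ _ (lt0r_neq0 p0)) momentE.
apply: eq_integral => x _.
by rewrite /= ger0_norm ?cnorm_ge0.
Qed.

Lemma in_LpP p f : 0 < p -> in_Lp mu p%:E f <-> cmeasurable f /\ (moment p f < +oo)%E.
Proof.
move=> p0; rewrite -cLnorm_poweR//; split=> -[mf H]; split => //.
- exact: poweR_lty.
- by apply: lty_poweRy H; rewrite gt_eqF.
Qed.

Lemma cLnorm_le_moment p f g (A : R) : 0 < p -> 0 <= A ->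
  (cLnorm mu p%:E f <= A%:E * cLnorm mu p%:E g)%E =
  (moment p f <= (A `^ p)%:E * moment p g)%E.
Proof.
move=> p0 A0; rewrite -!cLnorm_poweR// -poweR_EFin -poweRM ?Lnorm_ge0//.
have N0 h : (0 <= cLnorm mu p%:E h)%E by exact: Lnorm_ge0.
have AN : (0 <= A%:E * cLnorm mu p%:E g)%E by rewrite mule_ge0.
apply/idP/idP => [H|H].
- by apply: gt0_ler_poweR => //; rewrite ?(ltW p0)// in_itv/= ?N0 ?AN leey.
- rewrite -(poweRe1 (N0 f)) -(poweRe1 AN) -(mulfV (lt0r_neq0 p0)) 2!poweRrM.
  apply: gt0_ler_poweR => //; rewrite ?invr_ge0 ?(ltW p0)// in_itv/= leey andbT;
    exact: poweR_ge0.
Qed.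

Lemma opnorm_moment_le p (U : (X -> R[i]) -> X -> R[i]) (A : R) f :
  0 < p -> 0 <= A -> Lp_opnorm_le mu p%:E U A -> in_Lp mu p%:E f ->
  (moment p (U f) <= (A `^ p)%:E * moment p f)%E.
Proof. by move=> p0 A0 H /H; rewrite cLnorm_le_moment. Qed.

Lemma eq_moment p f g : cmeasurable f -> cmeasurable g ->
  (\forall x \ae mu, f x = g x) -> moment p f = moment p g.
Proof.
move=> mf mg fg; rewrite !momentE; apply: ae_eq_integral => //.
- by apply/measurable_EFinP; exact: measurable_cnorm_powR.
- by apply/measurable_EFinP; exact: measurable_cnorm_powR.
- by apply: filterS fg => x /= -> _.
Qed.

Lemma le_moment p f g : 0 < p -> cmeasurable f -> cmeasurable g ->
  (forall x, cnorm (f x) <= cnorm (g x)) -> (moment p f <= moment p g)%E.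
Proof.
move=> p0 mf mg fg; rewrite !momentE; apply: ge0_le_integral => //.
- by move=> x _; rewrite lee_fin powR_ge0.
- by apply/measurable_EFinP; exact: measurable_cnorm_powR.
- by apply/measurable_EFinP; exact: measurable_cnorm_powR.
- move=> x _; rewrite lee_fin; apply: ge0_ler_powR => //; rewrite ?nnegrE ?cnorm_ge0//.
  exact: ltW.
Qed.

Lemma cintegrable_L2 D f : measurable D -> (mu D < +oo)%E -> in_Lp mu 2%:E f ->
  (\int[mu]_(x in D) (cnorm (f x))%:E < +oo)%E.
Proof.
move=> mD Doo /(in_LpP _ (ltr0Sn _ 1))[mf foo].
have mf2 := measurable_cnorm_powR 2 mf.
apply: (@le_lt_trans _ _ (\int[mu]_(x in D) (1%:E + (cnorm (f x) `^ 2)%:E))%E).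
  apply: ge0_le_integral => //.
  - by move=> x _; rewrite lee_fin cnorm_ge0.
  - by apply/measurable_EFinP; apply: measurable_funTS; exact: measurable_cnorm.
  - apply: emeasurable_funD; first exact: measurable_cst.
    by apply/measurable_EFinP; exact: measurable_funTS.
  - move=> x _; rewrite -EFinD lee_fin; have := cnorm_ge0 (f x).
    by move: (cnorm (f x)) => t t0; rewrite (@powR_mulrn _ t 2)//; nra.
rewrite ge0_integralD//; first last.
- by apply/measurable_EFinP; exact: measurable_funTS.
- by move=> x _; rewrite lee_fin powR_ge0.
rewrite integral_cst// mul1e lte_add_pinfty//; apply: le_lt_trans foo; rewrite momentE.
apply: ge0_subset_integral => //; first exact/measurable_EFinP.
by move=> x _; rewrite lee_fin powR_ge0.
Qed.

(** The elementary bound st <= s^2 + t^2 takes the place of Cauchy-Schwarz: the estimate serves only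
    for integrability and for the qualitative boundedness of pairings on the strip. *)
Lemma integral_mul_L2 f g : in_Lp mu 2%:E f -> in_Lp mu 2%:E g ->
  (\int[mu]_x (cnorm (f x * g x))%:E <= moment 2 f + moment 2 g)%E.
Proof.
move=> /(in_LpP _ (ltr0Sn _ 1))[mf foo] /(in_LpP _ (ltr0Sn _ 1))[mg goo].
have mf2 := measurable_cnorm_powR 2 mf; have mg2 := measurable_cnorm_powR 2 mg.
rewrite !momentE -ge0_integralD//; first last.
- exact/measurable_EFinP.
- by move=> x _; rewrite lee_fin powR_ge0.
- exact/measurable_EFinP.
- by move=> x _; rewrite lee_fin powR_ge0.
apply: ge0_le_integral => //.
- by move=> x _; rewrite lee_fin cnorm_ge0.
- by apply/measurable_EFinP/measurable_cnorm; exact: cmeasurableM.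
- by apply: emeasurable_funD; exact/measurable_EFinP.
- move=> x _; rewrite -EFinD lee_fin normcM.
  have := cnorm_ge0 (f x); have := cnorm_ge0 (g x).
  move: (cnorm (f x)) (cnorm (g x)) => s t t0 s0.
  by rewrite (@powR_mulrn _ t 2)// (@powR_mulrn _ s 2)//; nra.
Qed.

Lemma cintegrable_mul_L2 f g : in_Lp mu 2%:E f -> in_Lp mu 2%:E g ->
  cintegrable mu setT (fun x => f x * g x).
Proof.
move=> f2 g2; have := integral_mul_L2 f2 g2.
move: (f2) (g2) => /(in_LpP _ (ltr0Sn _ 1))[mf foo] /(in_LpP _ (ltr0Sn _ 1))[mg goo] H.
apply: cintegrable_cnorm => //; first exact: cmeasurableM.
exact: le_lt_trans H (lte_add_pinfty foo goo).
Qed.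

Lemma eq_cintegral_ae D f g : measurable D -> cmeasurable f -> cmeasurable g ->
  (\forall x \ae mu, f x = g x) -> cintegral mu D f = cintegral mu D g.
Proof.
move=> mD [f1 f2] [g1 g2] fg; rewrite /cintegral /Rintegral.
congr (Complex (fine _) (fine _)); apply: ae_eq_integral => //;
  try by apply/measurable_EFinP; exact: measurable_funTS.
- by apply: filterS fg => x -> _.
- by apply: filterS fg => x -> _.
Qed.

End Moments.

(** * Mean oscillation as a pairing *)

Section OscillationKernel.
Context (R : realType) (M : pointedMetricType R).
Variable mu : {measure set (borel M) -> \bar R}.
Variables (B : set (borel M)) (v : R).
Hypotheses (mB : measurable B) (v0 : 0 < v) (muB : mu B = v%:E).
Implicit Types (u g h : borel M -> R[i]).

Lemma cintegral_indicM h : cintegral mu setT (fun x => (\1_B x)%:C%C * h x) = cintegral mu B h.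
Proof.
rewrite /cintegral; congr Complex; rewrite [RHS]Rintegral_mkcond;
  apply: eq_Rintegral => x _; rewrite patchE indicE.
- by rewrite ReM /=; case: ifP => _; rewrite ?mul1r !mul0r subr0.
- by rewrite ImM /=; case: ifP => _; rewrite ?mul1r !mul0r ?addr0 ?add0r.
Qed.

Lemma cmeasurable_indic : cmeasurable (fun x => (\1_B x : R)%:C%C).
Proof. by apply: cmeasurable_real; exact: measurable_indic. Qed.

Lemma cintegrable_bounded h (c : R) : cmeasurable h -> (forall x, cnorm (h x) <= c) ->
  (\int[mu]_(x in B) (cnorm (h x))%:E < +oo)%E.
Proof.
move=> mh hc; apply: (@le_lt_trans _ _ (\int[mu]_(x in B) (cst c%:E x))%E).
  apply: ge0_le_integral => //.
  - by move=> x _; rewrite lee_fin cnorm_ge0.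
  - by apply/measurable_EFinP; apply: measurable_funTS; exact: measurable_cnorm.
  - by move=> x _; rewrite lee_fin hc.
by rewrite integral_cst// muB -EFinM ltry.
Qed.

Lemma cnorm_average_le u : cmeasurable u ->
  (\int[mu]_(x in B) (cnorm (u x))%:E < +oo)%E ->
  ((v * cnorm (average mu u B))%:E <= \int[mu]_(x in B) (cnorm (u x))%:E)%E.
Proof.
move=> mu_ iu; have cu := cintegrable_cnorm mB mu_ iu.
rewrite /average muB /= normcM cnorm_real ger0_norm ?invr_ge0 ?(ltW v0)//.
by rewrite mulVKf ?gt_eqF//; exact: cnorm_cintegral_le.
Qed.

Lemma integral_cnormB_le u (m : R[i]) : cmeasurable u ->
  (\int[mu]_(x in B) (cnorm (u x - m))%:E <=
   \int[mu]_(x in B) (cnorm (u x))%:E + (v * cnorm m)%:E)%E.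
Proof.
move=> mu_; have mcu : measurable_fun B (fun x => (cnorm (u x))%:E).
  by apply/measurable_EFinP; apply: measurable_funTS; exact: measurable_cnorm.
have -> : ((v * cnorm m)%:E = \int[mu]_(x in B) (cst (cnorm m)%:E x))%E.
  by rewrite integral_cst// muB -EFinM mulrC.
rewrite -ge0_integralD//.
- apply: ge0_le_integral => //.
  + by move=> x _; rewrite lee_fin cnorm_ge0.
  + apply/measurable_EFinP; apply: measurable_funTS; apply: measurable_cnorm.
    by apply: cmeasurableB => //; exact: cmeasurable_cst.
  + by apply: emeasurable_funD => //; exact: measurable_cst.
  + move=> x _; rewrite /cst -EFinD lee_fin.
    by apply: le_trans (le_normcD _ _) _; rewrite normcN.
- by move=> x _; rewrite lee_fin cnorm_ge0.
- by move=> x _; rewrite lee_fin cnorm_ge0.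
Qed.

Lemma mean_oscillation_le u : cmeasurable u ->
  (\int[mu]_(x in B) (cnorm (u x))%:E < +oo)%E ->
  (mean_oscillation mu u B <= (2 / v)%:E * \int[mu]_(x in B) (cnorm (u x))%:E)%E.
Proof.
move=> mu_ iu; rewrite /mean_oscillation muB /= mulrC (EFinM v^-1) -muleA.
apply: lee_wpmul2l; first by rewrite lee_fin invr_ge0 ltW.
apply: le_trans (integral_cnormB_le _ mu_) _.
rewrite mule_natl mule2n leeD2l//; exact: cnorm_average_le.
Qed.

Lemma mean_oscillation_ge0 u : (0 <= mean_oscillation mu u B)%E.
Proof.
rewrite mule_ge0 ?lee_fin ?invr_ge0 ?fine_ge0//.
by apply: integral_ge0 => x _; rewrite lee_fin cnorm_ge0.
Qed.

Lemma mean_oscillation_fin_num u : cmeasurable u ->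
  (\int[mu]_(x in B) (cnorm (u x))%:E < +oo)%E -> mean_oscillation mu u B \is a fin_num.
Proof.
move=> mu_ iu; rewrite ge0_fin_numE ?mean_oscillation_ge0//.
apply: le_lt_trans (mean_oscillation_le mu_ iu) _.
by rewrite lte_mul_pinfty// lee_fin divr_ge0// ltW.
Qed.

Definition oscillation_phase g x := conj_phase (g x - average mu g B).

(* Pairing with this kernel recovers the mean oscillation of [g] on [B], and is
   dominated by the mean oscillation for every other function. *)
Definition oscillation_kernel g x : R[i] :=
  (\1_B x)%:C%C * (v^-1%:C%C * (oscillation_phase g x - average mu (oscillation_phase g) B)).

Lemma cmeasurable_oscillation_phase g : cmeasurable g -> cmeasurable (oscillation_phase g).
Proof.
move=> mg; apply: cmeasurable_conj_phase.
by apply: cmeasurableB => //; exact: cmeasurable_cst.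
Qed.

Lemma oscillation_kernel_in_L2 g : cmeasurable g -> in_Lp mu 2%:E (oscillation_kernel g).
Proof.
move=> mg; have mp := cmeasurable_oscillation_phase mg.
have mk : cmeasurable (oscillation_kernel g).
  apply: cmeasurableM; first exact: cmeasurable_indic.
  apply: cmeasurableM; first exact: cmeasurable_cst.
  by apply: cmeasurableB => //; exact: cmeasurable_cst.
apply/in_LpP => //; split => //.
pose c := v^-1 * (1 + cnorm (average mu (oscillation_phase g) B)).
have c0 : 0 <= c by rewrite mulr_ge0 ?invr_ge0 ?(ltW v0)// addr_ge0 ?cnorm_ge0.
rewrite momentE; apply: (@le_lt_trans _ _ (\int[mu]_x ((c `^ 2)%:E * (\1_B x)%:E))%E).
  apply: ge0_le_integral => //.
  - by move=> x _; rewrite lee_fin powR_ge0.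
  - by apply/measurable_EFinP; exact: measurable_cnorm_powR.
  - apply/measurable_EFinP; apply: measurable_funM; first exact: measurable_cst.
    exact: measurable_indic.
  - move=> x _; rewrite -EFinM lee_fin /oscillation_kernel indicE.
    case: (x \in B); last by rewrite mul0r normc0 powR0 ?mulr0// pnatr_eq0.
    rewrite mul1r mulr1; apply: ge0_ler_powR; rewrite ?nnegrE ?cnorm_ge0//.
    rewrite normcM cnorm_real ger0_norm ?invr_ge0 ?(ltW v0)//.
    apply: ler_wpM2l; first by rewrite invr_ge0 ltW.
    apply: le_trans (le_normcD _ _) _; rewrite normcN lerD2r.
    exact: cnorm_conj_phase_le1.
rewrite ge0_integralZl_EFin ?powR_ge0//; last first.
  by apply/measurable_EFinP; exact: measurable_indic.
by rewrite integral_indic// setIT muB -EFinM ltry.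
Qed.

(** Subtraction of the average over [B] is symmetric for the bilinear pairing, so it can be moved
    from the phase to [u]. *)
Lemma cintegral_oscillation_kernel g u : cmeasurable g -> cmeasurable u ->
  (\int[mu]_(x in B) (cnorm (u x))%:E < +oo)%E ->
  cintegral mu setT (fun x => u x * oscillation_kernel g x) =
  v^-1%:C%C * cintegral mu B (fun x => oscillation_phase g x * (u x - average mu u B)).
Proof.
move=> mg mu_ iu; have mp := cmeasurable_oscillation_phase mg.
set p := oscillation_phase g; have p1 x : cnorm (p x) <= 1 by exact: cnorm_conj_phase_le1.
have ip : cintegrable mu B p.
  by apply: cintegrable_cnorm => //; exact: (cintegrable_bounded mp p1).
have iu' : cintegrable mu B u by exact: cintegrable_cnorm.
have ipu : cintegrable mu B (fun x => p x * u x).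
  apply: cintegrable_cnorm => //; first exact: cmeasurableM.
  apply: le_lt_trans iu; apply: ge0_le_integral => //.
  - by move=> x _; rewrite lee_fin cnorm_ge0.
  - apply/measurable_EFinP; apply: measurable_funTS; apply: measurable_cnorm.
    exact: cmeasurableM.
  - by apply/measurable_EFinP; apply: measurable_funTS; exact: measurable_cnorm.
  - by move=> x _; rewrite lee_fin normcM ler_piMl ?cnorm_ge0.
rewrite (_ : (fun x => u x * _) = (fun x => (\1_B x)%:C%C *
    (v^-1%:C%C * (p x * u x + - average mu p B * u x)))); last first.
  by apply/funext => x; rewrite /oscillation_kernel -/p; ring.
rewrite cintegral_indicM cintegralZ//; last by apply: cintegrableD => //; exact: cintegrableZ.
rewrite cintegralD//; last exact: cintegrableZ.
rewrite cintegralZ//.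
rewrite (_ : (fun x => p x * (u x - _)) = (fun x => p x * u x + - average mu u B * p x)); last first.
  by apply/funext => x; ring.
rewrite (cintegralD (g := fun x => _ * p x))//; last exact: cintegrableZ.
by rewrite [in RHS]cintegralZ// /average; ring.
Qed.

Lemma cnorm_cintegral_oscillation_kernel g u : cmeasurable g -> cmeasurable u ->
  (\int[mu]_(x in B) (cnorm (u x))%:E < +oo)%E ->
  ((cnorm (cintegral mu setT (fun x => (u x * oscillation_kernel g x)%R)))%:E <=
   mean_oscillation mu u B)%E.
Proof.
move=> mg mu_ iu; rewrite cintegral_oscillation_kernel// normcM cnorm_real.
rewrite ger0_norm ?invr_ge0 ?(ltW v0)// EFinM /mean_oscillation muB /=.
apply: lee_wpmul2l; first by rewrite lee_fin invr_ge0 ltW.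
have mp := cmeasurable_oscillation_phase mg.
have mum : cmeasurable (fun x => u x - average mu u B).
  by apply: cmeasurableB => //; exact: cmeasurable_cst.
have mpu : cmeasurable (fun x => oscillation_phase g x * (u x - average mu u B)).
  exact: cmeasurableM.
have H : (\int[mu]_(x in B) (cnorm (oscillation_phase g x * (u x - average mu u B)))%:E <=
    \int[mu]_(x in B) (cnorm (u x - average mu u B))%:E)%E.
  apply: ge0_le_integral => //.
  - by move=> x _; rewrite lee_fin cnorm_ge0.
  - by apply/measurable_EFinP; apply: measurable_funTS; exact: measurable_cnorm.
  - by apply/measurable_EFinP; apply: measurable_funTS; exact: measurable_cnorm.
  - move=> x _; rewrite lee_fin normcM ler_piMl ?cnorm_ge0//.
    exact: cnorm_conj_phase_le1.
apply: (le_trans _ H); apply: cnorm_cintegral_le => //.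
apply: cintegrable_cnorm => //; apply: le_lt_trans H _.
apply: le_lt_trans (integral_cnormB_le _ mu_) _.
by rewrite lte_add_pinfty// ltry.
Qed.

Lemma cintegral_oscillation_kernel_self g : cmeasurable g ->
  (\int[mu]_(x in B) (cnorm (g x))%:E < +oo)%E ->
  cintegral mu setT (fun x => g x * oscillation_kernel g x) =
  (fine (mean_oscillation mu g B))%:C%C.
Proof.
move=> mg ig; rewrite cintegral_oscillation_kernel//.
rewrite /mean_oscillation muB /= fineM//; last first.
  rewrite ge0_fin_numE; last by apply: integral_ge0 => x _; rewrite lee_fin cnorm_ge0.
  by apply: le_lt_trans (integral_cnormB_le _ mg) _; rewrite lte_add_pinfty// ltry.
rewrite rmorphM/=; congr (_ * _); rewrite /cintegral /oscillation_phase.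
congr Complex; rewrite /Rintegral.
  by congr fine; apply: eq_integral => x _; rewrite conj_phaseM.
by rewrite integral0_eq// => x _; rewrite conj_phaseM.
Qed.

End OscillationKernel.

(** * The three lines theorem *)

Section ThreeLines.
Context (R : realType).
Implicit Types (phi psi : R[i]^o -> R[i]^o) (z : R[i]^o).

Lemma Re_closed_strip z : @closed_strip R z -> 0 <= complex.Re z <= 1.
Proof.
have near (e : R) : @closed_strip R z -> 0 < e ->
    exists2 w, @strip R w & `|complex.Re w - complex.Re z| < e.
  move=> cz e0; have /cz[w [sw]] : nbhs z [set w | cnorm (w - z) < e].
    by apply/nbhs_cnormP; exists e.
  move=> /= wz; exists w => //; apply: le_lt_trans wz.
  by have := normr_Re_le (w - z); rewrite ReD ReN.
move=> cz; rewrite !leNgt -negb_or; apply/negP => /orP[z0|z1].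
- have [|w /andP[w0 _]] := near (- complex.Re z) cz; first by rewrite oppr_gt0.
  by rewrite ltr_norml => /andP[_]; lra.
- have [|w /andP[_ w1]] := near (complex.Re z - 1) cz; first by rewrite subr_gt0.
  by rewrite ltr_norml => /andP[+ _]; lra.
Qed.

Definition strip_bounded phi :=
  [/\ holomorphic_on (@strip R) phi, {within @closed_strip R, continuous phi} &
      exists K : R, forall z, @closed_strip R z -> cnorm (phi z) <= K].

Lemma strip_boundedD phi psi : strip_bounded phi -> strip_bounded psi ->
  strip_bounded (fun z => phi z + psi z).
Proof.
move=> [h1 c1 [K1 b1]] [h2 c2 [K2 b2]]; split.
- by move=> z sz; exact: cderivableD (h1 _ sz) (h2 _ sz).
- by move=> z; apply: cvgD; [exact: c1|exact: c2].
- exists (K1 + K2) => z cz; apply: le_trans (le_normcD _ _) _.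
  by apply: lerD; [exact: b1|exact: b2].
Qed.

Lemma strip_boundedM phi psi : strip_bounded phi -> strip_bounded psi ->
  strip_bounded (fun z => phi z * psi z).
Proof.
move=> [h1 c1 [K1 b1]] [h2 c2 [K2 b2]]; split.
- by move=> z sz; exact: cderivableM (h1 _ sz) (h2 _ sz).
- by move=> z; apply: cvgM; [exact: c1|exact: c2].
- exists (K1 * K2) => z cz; rewrite normcM.
  by apply: ler_pM; rewrite ?cnorm_ge0//; [exact: b1|exact: b2].
Qed.

Lemma strip_bounded_cst c : strip_bounded (fun=> c).
Proof.
split.
- by move=> z sz; exact: cderivable_cst.
- by move=> z; exact: cvg_cst.
- by exists (cnorm c).
Qed.

Lemma strip_bounded_sum (I : Type) (s : seq I) (P : pred I) (F : I -> R[i]^o -> R[i]^o) :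
  (forall i, P i -> strip_bounded (F i)) ->
  strip_bounded (fun z => \sum_(i <- s | P i) F i z).
Proof.
move=> H; elim: s => [|i s IH].
  by under eq_fun do rewrite big_nil; exact: strip_bounded_cst.
under eq_fun do rewrite big_cons.
case Pi: (P i); last exact: IH.
by apply: strip_boundedD; [exact: H|exact: IH].
Qed.

Lemma strip_bounded_cexp (k l : R) :
  strip_bounded (fun z => cexp (k%:C%C + l%:C%C * z)).
Proof.
split.
- by move=> z _; exact: derivable_cexp_affine.
- apply: cnorm_within_continuous => z _ e e0.
  have [d d0 Hd] := derivable_cnorm_continuous (@derivable_cexp_affine _ k%:C%C l%:C%C z) e0.
  by exists d => // w _; exact: Hd.
- exists (expR (`|k| + `|l|)) => z /Re_closed_strip/andP[z0 z1].
  rewrite cnorm_cexp ler_expR ReD ReM /= mul0r subr0.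
  apply: lerD; first exact: ler_norm.
  apply: le_trans (ler_norm _) _; rewrite normrM ler_piMr//.
  by rewrite ger0_norm.
Qed.

(** Multiplication by the exponential of -((1 - z) ln A0 + z ln A1) normalises both boundary bounds
    to 1. *)
Lemma three_lines phi (A0 A1 theta : R) : strip_bounded phi -> 0 < A0 -> 0 < A1 ->
  (forall s : R, cnorm (phi (Complex 0 s)) <= A0) ->
  (forall s : R, cnorm (phi (Complex 1 s)) <= A1) -> 0 < theta < 1 ->
  cnorm (phi (Complex theta 0)) <= A0 `^ (1 - theta) * A1 `^ theta.
Proof.
move=> hphi A00 A10 H0 H1 th.
have [h c [K b]] := strip_boundedM (strip_bounded_cexp (- ln A0) (ln A0 - ln A1)) hphi.
have e (x y : R) : cnorm (cexp ((- ln A0)%:C%C + (ln A0 - ln A1)%:C%C * Complex x y)) =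
    expR (- ((1 - x) * ln A0 + x * ln A1)).
  by rewrite cnorm_cexp ReD ReM /= mul0r subr0; congr expR; ring.
have := strip_maximum h c b _ _ th.
rewrite !normcM e expRN mulrC => H.
have -> : A0 `^ (1 - theta) * A1 `^ theta = expR ((1 - theta) * ln A0 + theta * ln A1).
  by rewrite expRD /powR !gt_eqF.
rewrite -[leRHS]mul1r -ler_pdivrMr ?expR_gt0//; apply: H => s; rewrite normcM e.
- by rewrite subr0 mul1r mul0r addr0 expRN lnK ?posrE// mulrC ler_pdivrMr// mul1r.
- by rewrite subrr mul1r mul0r add0r expRN lnK ?posrE// mulrC ler_pdivrMr// mul1r.
Qed.

End ThreeLines.

(** One dyadic ladder for finitely many values. It starts at half of the least positive value or
    lower, which gives the strict inequality; zero values are replaced by 1 in the minimum. *)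
Lemma geometric_range (R : realType) n (v : 'I_n -> R) : (forall j, 0 <= v j) ->
  exists2 t : R, 0 < t & exists N, forall j, 0 < v j -> t < v j <= t * 2 ^+ N.
Proof.
move=> v0; pose s j := if 0 < v j then v j / 2 else 1.
pose t := \big[Num.min/1]_j s j.
have t0 : 0 < t.
  rewrite /t; elim/big_ind: _ => // [x y x0 y0|j _]; first by rewrite lt_min x0.
  by rewrite /s; case: ifP => // vj; rewrite divr_gt0.
exists t => //; pose V := \sum_j v j; exists (Num.truncn (V / t)).+1 => j vj.
apply/andP; split.
  have : t <= s j by rewrite /t (bigD1 j)//= ge_min lexx.
  by rewrite /s vj; lra.
have : v j <= V.
  by rewrite /V (bigD1 j)//= lerDl sumr_ge0.
move=> /le_trans; apply; rewrite mulrC -ler_pdivrMr//.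
apply: le_trans (ltW (truncnS_gt _)) _.
by rewrite -natrX ler_nat ltnW// ltn_expl.
Qed.

(** * Square sums of averages over balls with disjoint pieces *)

Section DisjointPieces.
Context (R : realType) (M : pointedMetricType R).
Variable mu : {measure set (borel M) -> \bar R}.
Hypothesis mu_pos : (0 < mu setT)%E.
Hypothesis mu_balls : balls_finite mu.
Hypothesis LDP : locally_doubling mu.
Variables (n : nat) (B : 'I_n -> M * R) (E : 'I_n -> set (borel M)) (b : R).
Hypothesis Bb : forall j, 0 < (B j).2 <= b.
Hypothesis mE : forall j, measurable (E j).
Hypothesis EB : forall j, E j `<=` ball (B j).1 (B j).2.
Hypothesis tE : trivIset setT E.
Implicit Types (w : borel M -> R).

Lemma sum_pieces_le (P : pred 'I_n) (A : set (borel M)) : measurable A ->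
  (forall j, P j -> ball (B j).1 (B j).2 `<=` A) ->
  (\sum_(j | P j) mu (E j) <= mu A)%E.
Proof.
move=> mA PA; rewrite -big_filter; set s := (X in bigop _ X _).
rewrite -(@measure_bigcup_seq _ _ _ mu _ s E)//; last 2 first.
- by rewrite filter_uniq// index_enum_uniq.
- exact: sub_trivIset tE.
rewrite le_measure ?inE//; first by rewrite bigcup_seq; exact: bigsetU_measurable.
apply: bigcup_sub => j /=; rewrite mem_filter => /andP[Pj _].
by move=> x /EB; exact: PA.
Qed.

(** The L^2 bound of the maximal function, discretised. The pieces with [v j] above a level are
    disjoint and lie in the maximal set of that level. The constant is 4 from [le_level_sum] at
    ratio 2 and power 2, times [2 * K] from [weak_type_truncated], times 4 from the levels below
    [2 * w x]. *)
Lemma sum_average_sqr_le w (v : 'I_n -> R) (K : R) : (forall x, 0 <= w x) ->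
  measurable_fun setT w ->
  (forall c r, 0 < r <= b -> vol mu c (16 * r) <= K * vol mu c r) -> 0 <= K ->
  (forall j, 0 <= v j) ->
  (forall j, ((v j * vol mu (B j).1 (B j).2)%:E <=
     \int[mu]_(x in ball (B j).1 (B j).2) (w x)%:E)%E) ->
  (\sum_j (v j ^+ 2)%:E * mu (E j) <= (32 * K)%:E * \int[mu]_x (w x ^+ 2)%:E)%E.
Proof.
move=> w0 mw HK K0 v0 Hv.
have [t t0 [N tN]] := geometric_range v0.
have t12 : 1 < 2 :> R by rewrite ltr1n.
have tk k : 0 < t * 2 ^+ k by rewrite mulr_gt0// exprn_gt0.
pose c k := (t * 2 ^+ k) ^+ 2.
pose L k (x : borel M) := (if t * 2 ^+ k / 2 < w x then w x else 0)%:E.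
have mL k : measurable_fun setT (L k).
  apply/measurable_EFinP; apply: measurable_fun_ifT => //.
  by apply: measurable_fun_ltr => //; exact: measurable_cst.
have L0 k x : (0 <= L k x)%E by rewrite lee_fin; case: ifP.
apply: (@le_trans _ _ (\sum_(j < n) \sum_(k < N)
    (4 * c k)%:E * (if (t * 2 ^+ k < v j)%R then mu (E j) else 0))%E).
  apply: lee_sum => j _; have [vj0|vj0] := eqVneq (v j) 0.
    rewrite vj0 expr0n mul0e; apply: sume_ge0 => k _.
    rewrite mule_ge0//; last by case: ifP.
    by rewrite lee_fin mulr_ge0// sqr_ge0.
  have vj : 0 < v j by rewrite lt_neqAle eq_sym vj0 v0.
  have := le_level_sum t12 (ltr0Sn R 1) t0 (tN _ vj).
  rewrite (@powR_mulrn _ _ 2)// (@powR_mulrn _ _ 2)// => H.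
  apply: (@le_trans _ _ ((\sum_(k < N) (4 * c k) *
      (if t * 2 ^+ k < v j then 1 else 0))%:E * mu (E j))%E).
    apply: lee_wpmul2r => //; rewrite lee_fin; apply: le_trans H _.
    rewrite mulr_sumr; apply: ler_sum => k _.
    rewrite (@powR_mulrn _ _ 2) ?(ltW (tk _))//.
    by case: ifP => _; rewrite ?mulr0 ?mulr1// /c; lra.
  rewrite -sumEFin ge0_sume_distrl; last first.
    move=> k _; rewrite lee_fin; apply: mulr_ge0; last by case: (_ < _).
    by apply: mulr_ge0 => //; exact: sqr_ge0.
  apply: lee_sum => k _; case: (_ < _); first by rewrite mulr1.
  by rewrite mulr0 mul0e mule0.
rewrite exchange_big/=.
apply: (@le_trans _ _ (\sum_(k < N) (8 * K)%:E * \int[mu]_x ((t * 2 ^+ k)%:E * L k x))%E).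
  apply: lee_sum => k _; rewrite -ge0_sume_distrr; last by move=> j _; case: ifP.
  rewrite -big_mkcond/=.
  rewrite ge0_integralZl_EFin ?(ltW (tk _))//.
  rewrite muleA -EFinM; apply: (@le_trans _ _ ((4 * c k)%:E *
      ((2 * K / (t * 2 ^+ k))%:E * \int[mu]_x L k x))%E).
    apply: lee_wpmul2l; first by rewrite lee_fin mulr_ge0// sqr_ge0.
    apply: le_trans (weak_type_truncated mu_pos mu_balls LDP w0 mw HK K0 (tk k)).
    apply: sum_pieces_le; first exact: measurable_balls_union.
    move=> j tv x xB; exists (B j) => //; split; first exact: Bb.
    apply: lt_le_trans (Hv j); rewrite lte_fin ltr_pM2r//.
    by apply: (vol_gt0 mu_pos mu_balls LDP); case/andP: (Bb j).
  rewrite muleA -EFinM le_eqVlt; apply/orP; left; apply/eqP; congr (_%:E * _)%E.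
  by rewrite /c; field; rewrite gt_eqF// gt_eqF// exprn_gt0.
rewrite -ge0_sume_distrr; last first.
  by move=> k _; apply: integral_ge0 => x _; rewrite mule_ge0// lee_fin ltW.
have -> : 32 * K = 8 * K * 4 by ring.
rewrite (EFinM _ 4) -muleA; apply: lee_wpmul2l; first by rewrite lee_fin mulr_ge0.
rewrite -ge0_integral_sum//; last first.
  by move=> k x _; rewrite mule_ge0// lee_fin ltW.
  by move=> k; apply: emeasurable_funM => //; exact: measurable_cst.
rewrite -ge0_integralZl_EFin//; last 2 first.
- by move=> x _; rewrite lee_fin sqr_ge0.
- by apply/measurable_EFinP; exact: measurable_funX.
apply: ge0_le_integral => //.
- by move=> x _; apply: sume_ge0 => k _; rewrite mule_ge0// lee_fin ltW.
- by apply: emeasurable_sum => k; apply: emeasurable_funM => //; exact: measurable_cst.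
- by apply/measurable_EFinP; apply: measurable_funM; [exact: measurable_cst|exact: measurable_funX].
- move=> x _; rewrite /L -EFinM.
  under eq_bigr do rewrite -EFinM.
  rewrite sumEFin lee_fin.
  apply: (@le_trans _ _ (w x * \sum_(k < N) (if t * 2 ^+ k < 2 * w x then (t * 2 ^+ k) `^ 1 else 0))).
    rewrite mulr_sumr; apply: ler_sum => k _.
    rewrite ltr_pdivrMr// (mulrC (w x) 2); case: ifP => _; last by rewrite !mulr0.
    by rewrite powRr1 ?(ltW (tk _))// mulrC.
  have w20 : 0 <= 2 * w x by rewrite mulr_ge0.
  apply: le_trans (ler_wpM2l (w0 x) (level_sum_le N t12 ltr01 t0 w20)) _.
  have -> : (4 : R) * w x ^+ 2 = w x * (2 / (2 - 1) * (2 * w x)) by field.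
  by rewrite (powRr1 w20) (powRr1 (ler0n R 2)).
Qed.

End DisjointPieces.

Section LpSpace.
Context d (X : measurableType d) (R : realType).
Variable mu : {measure set X -> \bar R}.
Implicit Types (f g h : X -> R[i]) (D : set X) (a c : R[i]) (p : R).

(** A sum is at most twice the larger modulus, whose p-th power is at most the sum of both. The
    resulting constant replaces Minkowski's inequality wherever approximations are compared. *)
Lemma moment_add_le p f g : 0 < p -> cmeasurable f -> cmeasurable g ->
  (moment mu p (fun x => f x + g x)%R <= (2 `^ p)%:E * (moment mu p f + moment mu p g))%E.
Proof.
move=> p0 mf mg.
have mfp := measurable_cnorm_powR p mf; have mgp := measurable_cnorm_powR p mg.
rewrite !momentE -ge0_integralD//; first last.
- exact/measurable_EFinP.
- by move=> x _; rewrite lee_fin powR_ge0.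
- exact/measurable_EFinP.
- by move=> x _; rewrite lee_fin powR_ge0.
rewrite -ge0_integralZl_EFin ?powR_ge0//; last 2 first.
- by move=> x _; rewrite -EFinD lee_fin addr_ge0// powR_ge0.
- by apply: emeasurable_funD; exact/measurable_EFinP.
apply: ge0_le_integral => //.
- by move=> x _; rewrite lee_fin powR_ge0.
- apply/measurable_EFinP; apply: measurable_cnorm_powR; exact: cmeasurableD.
- apply: emeasurable_funM; first exact: measurable_cst.
  by apply: emeasurable_funD; exact/measurable_EFinP.
- move=> x _; rewrite -EFinD -EFinM lee_fin.
  have := le_normcD (f x) (g x); have := cnorm_ge0 (f x); have := cnorm_ge0 (g x).
  move: (cnorm (f x)) (cnorm (g x)) => s t t0 s0 H.
  have mx : 0 <= Num.max s t by rewrite le_max s0.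
  apply: (@le_trans _ _ ((2 * Num.max s t) `^ p)).
    apply: ge0_ler_powR; rewrite ?nnegrE ?cnorm_ge0 ?mulr_ge0 ?(ltW p0)//.
    apply: le_trans H _; rewrite mulr_natl mulr2n.
    by apply: lerD; rewrite le_max lexx ?orbT.
  rewrite powRM// ler_wpM2l ?powR_ge0//.
  by case: (leP s t) => _; rewrite ?lerDr ?lerDl powR_ge0.
Qed.

Lemma momentZ p a f : cmeasurable f ->
  moment mu p (fun x => a * f x) = ((cnorm a `^ p)%:E * moment mu p f)%E.
Proof.
move=> mf; rewrite !momentE -ge0_integralZl_EFin ?powR_ge0//; last 2 first.
- by move=> x _; rewrite lee_fin powR_ge0.
- by apply/measurable_EFinP; exact: measurable_cnorm_powR.
by apply: eq_integral => x _; rewrite normcM powRM ?cnorm_ge0// EFinM.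
Qed.

Lemma in_LpD p f g : 0 < p -> in_Lp mu p%:E f -> in_Lp mu p%:E g ->
  in_Lp mu p%:E (fun x => f x + g x).
Proof.
move=> p0 /(in_LpP _ _ p0)[mf foo] /(in_LpP _ _ p0)[mg goo]; apply/(in_LpP _ _ p0).
split; first exact: cmeasurableD.
apply: le_lt_trans (moment_add_le p0 mf mg) _.
apply: lte_mul_pinfty; rewrite ?lee_fin ?powR_ge0 ?ltry//.
exact: lte_add_pinfty foo goo.
Qed.

Lemma in_LpZ p a f : 0 < p -> in_Lp mu p%:E f -> in_Lp mu p%:E (fun x => a * f x).
Proof.
move=> p0 /(in_LpP _ _ p0)[mf foo]; apply/(in_LpP _ _ p0).
split; first by apply: cmeasurableM => //; exact: cmeasurable_cst.
by rewrite momentZ// lte_mul_pinfty ?lee_fin ?powR_ge0.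
Qed.

Lemma in_Lp0 p : 0 < p -> in_Lp mu p%:E (fun=> 0).
Proof.
move=> p0; apply/in_LpP => //; split; first exact: cmeasurable_cst.
rewrite momentE; under eq_integral do rewrite normc0 powR0 ?gt_eqF//.
by rewrite integral0.
Qed.

Lemma in_Lp_sum p (I : Type) (s : seq I) (a : I -> R[i]) (h : I -> X -> R[i]) : 0 < p ->
  (forall i, in_Lp mu p%:E (h i)) ->
  in_Lp mu p%:E (fun x => \sum_(i <- s) a i * h i x).
Proof.
move=> p0 H; elim: s => [|i s IH].
  by under eq_fun do rewrite big_nil; exact: in_Lp0.
under eq_fun do rewrite big_cons.
by apply: in_LpD => //; exact: in_LpZ.
Qed.

Lemma Lp_operator0 p U : 0 < p -> Lp_operator mu p%:E U ->
  \forall x \ae mu, U (fun=> 0) x = 0.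
Proof.
move=> p0 [_ _ /(_ (-1) _ _ (in_Lp0 p0) (in_Lp0 p0))].
under [X in U X]eq_fun do rewrite mulr0 addr0.
by apply: filterS => x ->; rewrite mulN1r addNr.
Qed.

Lemma Lp_operator_sum p U (I : Type) (s : seq I) (a : I -> R[i]) (h : I -> X -> R[i]) :
  0 < p -> Lp_operator mu p%:E U -> (forall i, in_Lp mu p%:E (h i)) ->
  \forall x \ae mu, U (fun y => \sum_(i <- s) a i * h i y) x = \sum_(i <- s) a i * U (h i) x.
Proof.
move=> p0 HU H; elim: s => [|i s IH].
  under [X in U X]eq_fun do rewrite big_nil.
  by apply: filterS (Lp_operator0 p0 HU) => x ->; rewrite big_nil.
under [X in U X]eq_fun do rewrite big_cons.
have [_ _ /(_ (a i) _ _ (H i) (in_Lp_sum s a p0 H)) HL] := HU.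
by apply: filterS2 HL IH => x -> ->; rewrite big_cons.
Qed.

Lemma cintegral_sum_mul_L2 (I : Type) (s : seq I) (a : I -> R[i]) (h : I -> X -> R[i]) g :
  (forall i, in_Lp mu 2%:E (h i)) -> in_Lp mu 2%:E g ->
  cintegral mu setT (fun x => (\sum_(i <- s) a i * h i x) * g x) =
  \sum_(i <- s) a i * cintegral mu setT (fun x => h i x * g x).
Proof.
move=> H Hg; elim: s => [|i s IH].
  rewrite big_nil; rewrite (_ : (fun x => _) = (fun=> 0)); last first.
    by apply/funext => x; rewrite big_nil mul0r.
  by rewrite /cintegral /= /Rintegral integral0.
rewrite big_cons -IH.
rewrite (_ : (fun x => _ * g x) = (fun x => a i * (h i x * g x) +
    (\sum_(j <- s) a j * h j x) * g x)); last first.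
  by apply/funext => x; rewrite big_cons mulrDl mulrA.
rewrite cintegralD//; last 2 first.
- by apply: cintegrableZ => //; exact: cintegrable_mul_L2.
- by apply: cintegrable_mul_L2 => //; exact: in_Lp_sum.
by rewrite cintegralZ//; exact: cintegrable_mul_L2.
Qed.

End LpSpace.

Section StepFunctions.
Context d (X : measurableType d) (R : realType).
Variable mu : {measure set X -> \bar R}.
Variables (m : nat) (F : 'I_m -> set X).
Hypothesis mF : forall i, measurable (F i).
Hypothesis Foo : forall i, (mu (F i) < +oo)%E.
Hypothesis tF : trivIset setT F.
Implicit Types (a : 'I_m -> R[i]) (p : R).

Definition cindic (D : set X) (x : X) : R[i] := (\1_D x : R)%:C%C.

Definition step a (x : X) : R[i] := \sum_(i < m) a i * cindic (F i) x.

Lemma stepP x : (exists i, F i x /\ forall a, step a x = a i) \/ (forall a, step a x = 0).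
Proof.
have [[i Fi]|nF] := pselect (exists i, F i x).
- left; exists i; split => // a; rewrite /step (bigD1 i)//= big1 ?addr0.
    by rewrite /cindic indicE mem_set// mulr1.
  move=> j ji; rewrite /cindic indicE memNset ?mulr0// => Fj.
  by move: ji; rewrite (tF (i := j) (j := i))// ?eqxx//; exists x.
- right=> a; rewrite /step big1// => i _; rewrite /cindic indicE memNset ?mulr0// => Fi.
  by apply: nF; exists i.
Qed.

Lemma in_Lp_cindic i p : 0 < p -> in_Lp mu p%:E (cindic (F i)).
Proof.
move=> p0; apply/in_LpP => //; split.
  by apply: cmeasurable_real; exact: measurable_indic.
rewrite momentE (eq_integral (fun x => (\1_(F i) x)%:E)).
  by rewrite integral_indic// setIT.
move=> x _; rewrite cnorm_real indicE; case: (x \in F i) => /=.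
  by rewrite normr1 powR1.
by rewrite normr0 powR0// gt_eqF.
Qed.

Lemma in_Lp_step a p : 0 < p -> in_Lp mu p%:E (step a).
Proof.
by move=> p0; apply: in_Lp_sum => // i; exact: in_Lp_cindic.
Qed.

Lemma cLnorm_step_le a (c : R) : 0 <= c -> (forall i, cnorm (a i) <= c) ->
  (cLnorm mu +oo (step a) <= c%:E)%E.
Proof.
move=> c0 ac; rewrite /cLnorm unlock /=; case: ifPn => // _.
apply/ess_supP; apply: nearW => x /=; rewrite ger0_norm ?cnorm_ge0// lee_fin.
by have [[i [_ ->]]|->] := stepP x; rewrite ?normc0.
Qed.

End StepFunctions.

(** Cauchy-Schwarz with weights: the nonnegative sum of (X y_j - Z x_j)^2 e_j equals X (X Y -
    Z^2). *)
Lemma sum_sqr_weighted_le (R : realType) n (P : pred 'I_n) (x y e : 'I_n -> R) : (forall j, 0 <= e j) ->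
  0 < \sum_(j | P j) x j ^+ 2 * e j ->
  (\sum_(j | P j) x j * y j * e j) ^+ 2 <=
  (\sum_(j | P j) x j ^+ 2 * e j) * \sum_(j | P j) y j ^+ 2 * e j.
Proof.
move=> e0; set X := (X in 0 < X); set Y := \sum_(j | P j) y j ^+ 2 * e j.
set Z := (X in X ^+ 2) => X0.
have : 0 <= \sum_(j | P j) (X * y j - Z * x j) ^+ 2 * e j.
  by apply: sumr_ge0 => j _; rewrite mulr_ge0 ?sqr_ge0.
have -> : \sum_(j | P j) (X * y j - Z * x j) ^+ 2 * e j =
    X ^+ 2 * Y - 2 * X * Z * Z + Z ^+ 2 * X.
  have e1 : X ^+ 2 * Y = \sum_(j | P j) X ^+ 2 * (y j ^+ 2 * e j) by exact: mulr_sumr.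
  have e2 : 2 * X * Z * Z = \sum_(j | P j) 2 * X * Z * (x j * y j * e j) by exact: mulr_sumr.
  have e3 : Z ^+ 2 * X = \sum_(j | P j) Z ^+ 2 * (x j ^+ 2 * e j) by exact: mulr_sumr.
  rewrite e1 e2 e3 -sumrB -big_split/=.
  by apply: eq_bigr => j _; ring.
have -> : X ^+ 2 * Y - 2 * X * Z * Z + Z ^+ 2 * X = X * (X * Y - Z ^+ 2) by ring.
by rewrite pmulr_rge0// subr_ge0.
Qed.

(** * Complex interpolation of oscillation sums *)

Section Interpolation.
Context (R : realType) (M : pointedMetricType R).
Variable mu : {measure set (borel M) -> \bar R}.
Hypothesis mu_pos : (0 < mu setT)%E.
Hypothesis mu_balls : balls_finite mu.
Hypothesis LDP : locally_doubling mu.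
Variables (T : R[i] -> (M -> R[i]) -> (M -> R[i])) (A b : R).
Hypothesis adm : admissible_family mu T.
Hypothesis A0 : 0 < A.
Hypothesis T0 : forall s : R, Lp_opnorm_le mu 2%:E (T (Complex 0 s)) A.
Hypothesis T1 : forall s : R, Linfty_BMO_opnorm_le mu b (T (Complex 1 s)) A.
Implicit Types (f g h : borel M -> R[i]) (z : R[i]^o).

Lemma closed_strip_Complex (x y : R) : 0 <= x <= 1 -> @closed_strip R (Complex x y).
Proof. by move=> x01; apply: closed_strip_ReP. Qed.

(** The uniform bound [K] of the family enters qualitatively: it makes the pairing bounded on the
    strip, as the three lines theorem demands, and leaves no trace in the final constant. *)
Lemma strip_bounded_pairing f g : in_Lp mu 2%:E f -> in_Lp mu 2%:E g ->
  strip_bounded (fun z => cintegral mu setT (fun x => T z f x * g x)).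
Proof.
move=> f2 g2; have [HL [K HK] Hhol] := adm.
have [hol cont] := Hhol f g f2 g2; split => //.
pose K' := Num.max K 0; have K'0 : 0 <= K' by rewrite le_max lexx orbT.
move: (f2) (g2) => /(in_LpP _ _ (ltr0Sn _ 1))[mf foo] /(in_LpP _ _ (ltr0Sn _ 1))[mg goo].
pose N := ((K' `^ 2)%:E * moment mu 2 f + moment mu 2 g)%E.
have K20 : (0 <= (K' `^ 2)%:E)%E by rewrite lee_fin powR_ge0.
have N0 : (0 <= N)%E.
  by rewrite /N; apply: adde_ge0; [apply: mule_ge0 => //|]; exact: moment_ge0.
have Noo : (N < +oo)%E.
  by rewrite /N lte_add_pinfty ?goo//; apply: lte_mul_pinfty; rewrite ?K20 ?foo.
exists (fine N) => z cz.
have [Tz _ _] := HL z cz; have Tf := Tz f f2.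
rewrite -lee_fin fineK ?ge0_fin_numE//.
apply: le_trans (cnorm_cintegral_le _ _ _) _ => //.
- by apply: cmeasurableM => //; case: (Tf) => -[].
- exact: cintegrable_mul_L2.
apply: le_trans (integral_mul_L2 Tf g2) _; apply: leeD2r.
apply: (opnorm_moment_le (ltr0Sn _ 1) K'0) => //.
move=> h /(HK z cz h) /le_trans; apply; apply: lee_wpmul2r; first exact: Lnorm_ge0.
by rewrite lee_fin le_max lexx.
Qed.

Section Step.
Variables (m : nat) (F : 'I_m -> set (borel M)) (c : 'I_m -> R[i]).
Hypothesis mF : forall i, measurable (F i).
Hypothesis Foo : forall i, (mu (F i) < +oo)%E.
Hypothesis tF : trivIset setT F.
Hypothesis c_neq0 : forall i, c i != 0.

(** Admissibility speaks of fixed functions only. Expanding a step function whose coefficients vary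
    with [z] reduces holomorphy to fixed indicators; linearity holds almost everywhere, which
    suffices under the integral. *)
Lemma pairing_step z a g : @closed_strip R z -> in_Lp mu 2%:E g ->
  cintegral mu setT (fun x => T z (step F a) x * g x) =
  \sum_(i < m) a i * cintegral mu setT (fun x => T z (cindic R (F i)) x * g x).
Proof.
move=> cz g2; have [HL _ _] := adm; have HT := HL z cz.
have F2 i : in_Lp mu 2%:E (cindic R (F i)) by exact: in_Lp_cindic.
have T2 i : in_Lp mu 2%:E (T z (cindic R (F i))) by have [H _ _] := HT; exact: H.
have S2 : in_Lp mu 2%:E (T z (step F a)) by have [H _ _] := HT; apply: H; exact: in_Lp_step.
rewrite -(cintegral_sum_mul_L2 (mu := mu) (index_enum 'I_m) a T2 g2).
have [mg _] := g2; have [mS _] := S2.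
apply: eq_cintegral_ae => //.
- exact: cmeasurableM.
- apply: cmeasurableM => //.
  by have [] := in_Lp_sum (index_enum 'I_m) a (ltr0Sn R 1) T2.
- by apply: filterS (Lp_operator_sum (index_enum 'I_m) a (ltr0Sn R 1) HT F2) => x ->.
Qed.

Variables (theta p : R).
Hypothesis theta01 : 0 < theta < 1.
Hypothesis pE : p = 2 / (1 - theta).

(** The value of f_z on [F i]: the phase of [c i] times its modulus to the complex power p(1 - z)/2.
    The logarithm is why zero coefficients are excluded. *)
Definition step_family z (i : 'I_m) : R[i] :=
  c i * ((cnorm (c i))^-1)%:C%C *
  cexp ((p / 2 * ln (cnorm (c i)))%:C%C + (- (p / 2 * ln (cnorm (c i))))%:C%C * z).

Lemma cnorm_step_family (x y : R) i :
  cnorm (step_family (Complex x y) i) = cnorm (c i) `^ (p / 2 * (1 - x)).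
Proof.
have ci : 0 < cnorm (c i) by rewrite cnorm_gt0.
rewrite /step_family !normcM cnorm_real cnorm_cexp ReD ReM /= mul0r subr0.
rewrite (ger0_norm (_ : 0 <= (cnorm (c i))^-1)) ?invr_ge0 ?(ltW ci)// divff ?gt_eqF// mul1r.
by rewrite /powR gt_eqF//; congr expR; ring.
Qed.

Lemma step_family_theta i : step_family (Complex theta 0) i = c i.
Proof.
have ci : 0 < cnorm (c i) by rewrite cnorm_gt0.
have t1 : 1 - theta != 0 by rewrite gt_eqF// subr_gt0; case/andP: theta01.
rewrite /step_family.
have -> : ((p / 2 * ln (cnorm (c i)))%:C + (- (p / 2 * ln (cnorm (c i))))%:C * Complex theta 0)%C
    = (ln (cnorm (c i)))%:C%C.
  apply/eqP; rewrite eq_complex ReD ImD ReM ImM /=.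
  by apply/andP; split; apply/eqP; rewrite ?pE; [field|ring].
rewrite cexp_real lnK ?posrE// -mulrA -rmorphM/= mulVf ?gt_eqF//.
by rewrite rmorph1 mulr1.
Qed.

Lemma p_gt2 : 2 < p.
Proof.
have /andP[t0 t1] := theta01; have t1' : 0 < 1 - theta by rewrite subr_gt0.
by rewrite pE ltr_pdivlMr//; lra.
Qed.

Lemma strip_bounded_step_family i : strip_bounded (step_family ^~ i).
Proof.
apply: (strip_boundedM (phi := fun=> _)); first exact: strip_bounded_cst.
exact: strip_bounded_cexp.
Qed.

Lemma moment2_step_family (s : R) :
  moment mu 2 (step F (step_family (Complex 0 s))) = moment mu p (step F c).
Proof.
rewrite !momentE; apply: eq_integral => x _; congr EFin.
have p0 : 0 < p by exact: lt_trans p_gt2.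
have [[i [_ H]]|H] := stepP R tF x; rewrite !H.
  rewrite cnorm_step_family -powRrM subr0 mulr1; congr (_ `^ _).
  by rewrite divfK.
by rewrite normc0 !powR0 ?gt_eqF.
Qed.

Lemma cLnorm_step_family (s : R) :
  (cLnorm mu +oo (step F (step_family (Complex 1 s)%R)) <= 1)%E.
Proof.
apply: cLnorm_step_le => // i.
by rewrite cnorm_step_family subrr mulr0 powRr0.
Qed.

Section OscillationSum.
Variables (n : nat) (B : 'I_n -> M * R) (E : 'I_n -> set (borel M)) (K F0 : R).
Hypothesis Bb : forall j, 0 < (B j).2 <= b.
Hypothesis mE : forall j, measurable (E j).
Hypothesis EB : forall j, E j `<=` ball (B j).1 (B j).2.
Hypothesis tE : trivIset setT E.
Hypothesis HK : forall c r, 0 < r <= b -> vol mu c (16 * r) <= K * vol mu c r.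
Hypothesis K0 : 0 < K.
Hypothesis F00 : 0 < F0.
Hypothesis HF : (moment mu p (step F c) <= F0%:E)%E.

Let B_ j := ball (B j).1 (B j).2 : set (borel M).
Let v j := vol mu (B j).1 (B j).2.
Let e j := fine (mu (E j)).
Let g : borel M -> R[i] := T (Complex theta 0) (step F c).
Let o j := fine (mean_oscillation mu g (B_ j)).
Let k j := oscillation_kernel mu (B_ j) (v j) g.

Let mB j : measurable (B_ j). Proof. exact: measurable_ball_metric. Qed.
Let v0 j : 0 < v j.
Proof. by apply: (vol_gt0 mu_pos mu_balls LDP); case/andP: (Bb j). Qed.
Let muB j : mu (B_ j) = (v j)%:E. Proof. exact: mu_ballE. Qed.
Let e0 j : 0 <= e j. Proof. by rewrite fine_ge0. Qed.
Let muE j : mu (E j) = (e j)%:E.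
Proof.
rewrite /e fineK// ge0_fin_numE//; apply: (@le_lt_trans _ _ (mu (B_ j))).
  by rewrite le_measure ?inE//; exact: EB.
by rewrite muB ltry.
Qed.

Let ball_L2 f j : in_Lp mu 2%:E f -> (\int[mu]_(x in B_ j) (cnorm (f x))%:E < +oo)%E.
Proof. by apply: cintegrable_L2 => //; rewrite muB ltry. Qed.

Let step2 a : in_Lp mu 2%:E (step F a). Proof. exact: in_Lp_step. Qed.

Let T2 (x y : R) f : 0 <= x <= 1 -> in_Lp mu 2%:E f -> in_Lp mu 2%:E (T (Complex x y) f).
Proof.
move=> x01 f2; have [HL _ _] := adm.
by have [H _ _] := HL _ (@closed_strip_Complex x y x01); exact: H.
Qed.

Let theta01' : 0 <= theta <= 1.
Proof. by case/andP: theta01 => t0 t1; rewrite (ltW t0) (ltW t1). Qed.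

Let g2 : in_Lp mu 2%:E g. Proof. exact: T2. Qed.
Let mg : cmeasurable g. Proof. by case: g2. Qed.
Let k2 j : in_Lp mu 2%:E (k j). Proof. exact: oscillation_kernel_in_L2. Qed.
Let o0 j : 0 <= o j. Proof. by rewrite fine_ge0// mean_oscillation_ge0. Qed.

Let weight z j : R[i] :=
  cexp ((p / 2 * ln (o j))%:C%C + (p / 2 * ln (o j))%:C%C * z) * (e j)%:C%C.

(** Indices with [o j = 0] are left out because the complex powers in [weight] use the logarithm of
    [o j]; they contribute nothing to [S]. The kernels [k j] do not depend on [z]. *)
Let phi z := \sum_(j | 0 < o j) weight z j *
  \sum_(i < m) step_family z i * cintegral mu setT (fun x => T z (cindic R (F i)) x * k j x).

Let strip_bounded_phi : strip_bounded phi.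
Proof.
apply: strip_bounded_sum => j _; apply: strip_boundedM.
  apply: (strip_boundedM (psi := fun=> _)); first exact: strip_bounded_cexp.
  exact: strip_bounded_cst.
apply: strip_bounded_sum => i _; apply: strip_boundedM.
  exact: strip_bounded_step_family.
by apply: strip_bounded_pairing => //; exact: in_Lp_cindic.
Qed.

Let phiE (x y : R) : 0 <= x <= 1 -> let z := Complex x y in
  phi z = \sum_(j | 0 < o j) weight z j *
    cintegral mu setT (fun x => T z (step F (step_family z)) x * k j x).
Proof.
move=> x01 z; apply: eq_bigr => j _; rewrite pairing_step//.
exact: closed_strip_Complex.
Qed.

Let cnorm_weight (x y : R) j : 0 < o j ->
  cnorm (weight (Complex x y) j) = o j `^ (p / 2 * (1 + x)) * e j.
Proof.
move=> oj; rewrite /weight normcM cnorm_real ger0_norm// cnorm_cexp ReD ReM /= mul0r subr0.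
by rewrite /powR gt_eqF//; congr (expR _ * _); ring.
Qed.

Let cnorm_phi_le (x y : R) (w : 'I_n -> R) : 0 <= x <= 1 ->
  (forall j, (mean_oscillation mu (T (Complex x y)%R (step F (step_family (Complex x y)%R))) (B_ j)
     <= (w j)%:E)%E) ->
  cnorm (phi (Complex x y)) <= \sum_(j | 0 < o j) o j `^ (p / 2 * (1 + x)) * w j * e j.
Proof.
move=> x01 Hw; rewrite phiE//.
have u2 := T2 y x01 (step2 (step_family (Complex x y))).
apply: (@le_trans _ _ (\sum_(j | 0 < o j) cnorm (weight (Complex x y) j *
    cintegral mu setT (fun x' => T (Complex x y) (step F (step_family (Complex x y))) x' * k j x')))).
  elim/big_rec2: _ => [|j a a' _ H]; first by rewrite normc0.
  by apply: le_trans (le_normcD _ _) _; rewrite lerD2l.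
apply: ler_sum => j oj; rewrite normcM cnorm_weight// mulrAC.
apply: ler_wpM2r => //; apply: ler_wpM2l; first exact: powR_ge0.
rewrite -lee_fin; apply: le_trans (Hw j).
apply: (cnorm_cintegral_oscillation_kernel (mB j) (v0 j) (muB j) mg) => //.
  by case: u2.
exact: ball_L2.
Qed.

Let S := \sum_j o j `^ p * e j.

(** The exponent is a variable so that expressions merely equal to [p], such as [p / 2 * (1 + 1)],
    can be matched. *)
Let SE (x : R) : x = p -> S = \sum_(j | 0 < o j) o j `^ x * e j.
Proof.
move=> ->; rewrite /S [RHS]big_mkcond; apply: eq_bigr => j _.
case: ltP => // oj; have -> : o j = 0 by apply/eqP; rewrite eq_le oj o0.
by rewrite powR0 ?mul0r// gt_eqF// (lt_trans _ p_gt2).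
Qed.

(** At [theta] the exponent p(1 + theta)/2 of the weight is p - 1, and the pairing of [g] with its
    own kernel supplies the missing factor [o j]. *)
Let phi_theta : phi (Complex theta 0) = S%:C%C.
Proof.
have t1 : 1 - theta != 0 by rewrite gt_eqF// subr_gt0; case/andP: theta01.
rewrite phiE// (SE erefl) rmorph_sum; apply: eq_bigr => j oj.
have -> : step F (step_family (Complex theta 0)) = step F c.
  by apply/funext => x; apply: eq_bigr => i _; rewrite step_family_theta.
rewrite -/g (cintegral_oscillation_kernel_self (mB j) (muB j) mg) ?ball_L2//.
rewrite -/(o j) /weight.
have -> : ((p / 2 * ln (o j))%:C + (p / 2 * ln (o j))%:C * Complex theta 0)%C
    = ((p - 1) * ln (o j))%:C%C.
  apply/eqP; rewrite eq_complex ReD ImD ReM ImM /=.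
  by apply/andP; split; apply/eqP; rewrite ?pE; [field|ring].
rewrite cexp_real -!rmorphM/=; congr (_ %:C)%C.
have -> : expR ((p - 1) * ln (o j)) = o j `^ (p - 1) by rewrite /powR gt_eqF.
rewrite mulrAC; congr (_ * _).
rewrite -[X in _ * X](powRr1 (o0 j)) -powRD ?subrK//.
by rewrite (gt_eqF oj) implybT.
Qed.

(** The weights have square sum [S], which Cauchy-Schwarz splits off. Oscillations are at most twice
    the averages, so 128 is 4 times the 32 of [sum_average_sqr_le]. *)
Let phi0_le (s : R) : 0 < S -> cnorm (phi (Complex 0 s)) <= Num.sqrt (128 * K * A ^+ 2 * F0 * S).
Proof.
move=> S0; have x01 : 0 <= (0 : R) <= 1 by rewrite lexx ler01.
set u : borel M -> R[i] := T (Complex 0 s) (step F (step_family (Complex 0 s))).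
have u2 : in_Lp mu 2%:E u by exact: T2.
have [mu_ _] := u2; have mcu := measurable_cnorm mu_.
pose I j := fine (\int[mu]_(x in B_ j) (cnorm (u x))%:E).
have IE j : (\int[mu]_(x in B_ j) (cnorm (u x))%:E = (I j)%:E)%E.
  rewrite /I fineK// ge0_fin_numE ?ball_L2//.
  by apply: integral_ge0 => x _; rewrite lee_fin cnorm_ge0.
have I0 j : 0 <= I j.
  by rewrite fine_ge0//; apply: integral_ge0 => x _; rewrite lee_fin cnorm_ge0.
pose y j := I j / v j; have y0 j : 0 <= y j by rewrite divr_ge0// ltW.
have Hw j : (mean_oscillation mu u (B_ j) <= (2 * y j)%:E)%E.
  have -> : 2 * y j = 2 / v j * I j by rewrite /y; ring.
  rewrite EFinM -IE; apply: (mean_oscillation_le (mB j) (v0 j) (muB j) mu_).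
  exact: ball_L2.
apply: le_trans (cnorm_phi_le x01 Hw) _.
have SE' : \sum_(j | 0 < o j) (o j `^ (p / 2 * (1 + 0))) ^+ 2 * e j = S.
  rewrite (SE erefl); apply: eq_bigr => j _.
  by rewrite -(@powR_mulrn _ _ 2) ?powR_ge0// -powRrM addr0 mulr1 divfK.
rewrite -[leLHS]ger0_norm; last first.
  apply: sumr_ge0 => j _; apply: mulr_ge0 => //.
  by apply: mulr_ge0; [exact: powR_ge0|exact: mulr_ge0].
rewrite -sqrtr_sqr ler_wsqrtr//.
apply: le_trans (sum_sqr_weighted_le _ e0 _) _; first by rewrite SE'.
rewrite SE' mulrC; apply: ler_wpM2r; first exact: ltW.
have H : \sum_j y j ^+ 2 * e j <= 32 * K * (A ^+ 2 * F0).
  rewrite -lee_fin -sumEFin.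
  under eq_bigr do rewrite EFinM -muE.
  apply: le_trans (sum_average_sqr_le mu_pos mu_balls LDP Bb mE EB tE
    (fun x => cnorm_ge0 (u x)) mcu HK (ltW K0) y0 _) _.
    by move=> j; rewrite -/(B_ j) IE lee_fin -/(v j) /y divfK// gt_eqF.
  rewrite (EFinM (32 * K)); apply: lee_wpmul2l.
    by rewrite lee_fin mulr_ge0// ltW.
  have := opnorm_moment_le (ltr0Sn R 1) (ltW A0) (T0 s) (step2 (step_family (Complex 0 s))).
  rewrite moment2_step_family -/u momentE (@powR_mulrn _ A 2) ?(ltW A0)//.
  under eq_integral do rewrite (@powR_mulrn _ _ 2) ?cnorm_ge0//.
  move=> /le_trans; apply; rewrite (EFinM _ F0); apply: lee_wpmul2l => //.
  by rewrite lee_fin sqr_ge0.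
apply: (@le_trans _ _ (4 * \sum_j y j ^+ 2 * e j)); last by lra.
rewrite mulr_sumr [leLHS]big_mkcond; apply: ler_sum => j _.
case: ifP => _; last by rewrite mulr_ge0// mulr_ge0// sqr_ge0.
by rewrite le_eqVlt; apply/orP; left; apply/eqP; ring.
Qed.

Let phi1_le (s : R) : cnorm (phi (Complex 1 s)) <= A * S.
Proof.
have x01 : 0 <= (1 : R) <= 1 by rewrite lexx ler01.
have Hw j : (mean_oscillation mu (T (Complex 1 s)%R (step F (step_family (Complex 1 s)%R))) (B_ j) <= A%:E)%E.
  have Loo : in_Lp mu +oo%E (step F (step_family (Complex 1 s))).
    split; first by case: (step2 (step_family (Complex 1 s))).
    by apply: le_lt_trans (cLnorm_step_family s) _; rewrite ltry.
  have [_ H] := T1 s (step2 _) Loo.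
  apply: le_trans (_ : BMO_norm mu b (T (Complex 1 s)%R (step F (step_family (Complex 1 s)%R))) <= _)%E.
    by apply: ereal_sup_ubound; exists (B j) => //=; exact: Bb.
  apply: le_trans H _; rewrite -[leRHS]mule1; apply: lee_wpmul2l.
    by rewrite lee_fin ltW.
  exact: cLnorm_step_family.
apply: le_trans (cnorm_phi_le x01 Hw) _.
rewrite (@SE (p / 2 * (1 + 1))) ?mulr_sumr; last by field.
by apply: ler_sum => j _; rewrite le_eqVlt; apply/orP; left; apply/eqP; ring.
Qed.

(** As (1 - theta)p = 2 and theta p = p - 2, the p-th power of the three lines bound reads S^p <= Q
    (A S)^(p-2), with one more factor [S] in [Q]. Division by S^(p-1) is legitimate because [S] is a
    finite positive number. *)
Lemma oscillation_sum_le : \sum_j o j `^ p * e j <= 128 * K * A `^ p * F0.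
Proof.
rewrite -/S; have [S0|] := ltP 0 S; last first.
  by move=> /le_trans; apply; rewrite !mulr_ge0 ?powR_ge0// ltW.
have p2 := p_gt2; have p0 : 0 < p by exact: lt_trans p2.
have /andP[t0 t1] := theta01; have t1' : 1 - theta != 0 by rewrite gt_eqF// subr_gt0.
set Q := 128 * K * A ^+ 2 * F0 * S.
have Q0 : 0 < Q by rewrite !mulr_gt0 ?exprn_gt0.
have sQ0 : 0 < Num.sqrt Q by rewrite sqrtr_gt0.
have AS : 0 < A * S by rewrite mulr_gt0.
have := three_lines strip_bounded_phi sQ0 AS (fun s => phi0_le s S0) phi1_le theta01.
rewrite phi_theta cnorm_real gtr0_norm// => H.
have {}H : S `^ p <= Q * (A * S) `^ (p - 2).
  apply: (@le_trans _ _ ((Num.sqrt Q `^ (1 - theta) * (A * S) `^ theta) `^ p)).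
    apply: ge0_ler_powR; rewrite ?nnegrE ?mulr_ge0 ?powR_ge0// ltW//.
  rewrite powRM ?powR_ge0// -!powRrM.
  have -> : (1 - theta) * p = 2 by rewrite pE; field.
  have -> : theta * p = p - 2 by rewrite pE; field.
  by rewrite (@powR_mulrn _ _ 2) ?sqrtr_ge0// sqr_sqrtr// ltW.
have E2 (x : R) : 0 < x -> x `^ p = x ^+ 2 * x `^ (p - 2).
  move=> x0; rewrite -(@powR_mulrn _ _ 2) ?(ltW x0)// -powRD ?subrKC//.
  by rewrite (gt_eqF x0) implybT.
rewrite (E2 A)//; move: H; rewrite (E2 S)// powRM ?(ltW A0) ?(ltW S0)//.
have SP : 0 < S * S `^ (p - 2) by rewrite mulr_gt0 ?powR_gt0.
rewrite /Q => H; rewrite -(ler_pM2r SP).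
apply: le_trans (_ : S ^+ 2 * S `^ (p - 2) <= _).
  by rewrite le_eqVlt; apply/orP; left; apply/eqP; ring.
by apply: le_trans H _; rewrite le_eqVlt; apply/orP; left; apply/eqP; ring.
Qed.

End OscillationSum.

End Step.

End Interpolation.

(** * The L^p bound on step functions *)

Section StepBound.
Context (R : realType) (M : pointedMetricType R).
Variable mu : {measure set (borel M) -> \bar R}.
Hypothesis mu_pos : (0 < mu setT)%E.
Hypothesis mu_balls : balls_finite mu.
Hypothesis LDP : locally_doubling mu.
Hypothesis ISO : isoperimetric mu.

(* Removing from each ball the balls on which [o] is larger leaves disjoint
   pieces, and no superlevel set of [o] loses any point. *)
Lemma decreasing_pieces (s : seq (M * R)) (o : M * R -> R) :
  exists n (B : 'I_n -> M * R) (E : 'I_n -> set (borel M)),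
  [/\ forall j, B j \in s, forall j, measurable (E j),
      forall j, E j `<=` ball (B j).1 (B j).2, trivIset setT E &
      forall B' x, B' \in s -> ball B'.1 B'.2 x ->
        exists2 j, E j x & o B' <= o (B j)].
Proof.
pose le (B1 B2 : M * R) := o B2 <= o B1.
have le_tr : transitive le by move=> x y z; rewrite /le => yx /le_trans; apply.
have le_refl : reflexive le by move=> x; exact: lexx.
have le_total : total le by move=> x y; exact: le_total.
pose t := sort le s; pose B i := nth (point, 0) t i.
pose bB i := ball (B i).1 (B i).2 : set (borel M).
have mB i : measurable (bB i) by exact: measurable_ball_metric.
pose E i : set (borel M) := bB i `\` \bigcup_(k in `I_i) bB k.
have tE (i j : nat) x : (i < j)%N -> E i x -> E j x -> False.
  by move=> ij [Ex _] [_ H]; apply: H; exists i.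
exists (size t), (fun j => B j), (fun j => E j); split.
- by move=> j; rewrite -(mem_sort le) mem_nth.
- by move=> j; apply: measurableD => //; exact: bigcup_measurable.
- by move=> j x [].
- move=> i j _ _ [x [Ei Ej]]; apply/val_inj; case: (ltngtP i j) => // [ij|ji]; exfalso.
    exact: tE ij Ei Ej.
  exact: tE ji Ej Ei.
- move=> B' x; rewrite -(mem_sort le) -/t => B't xB'.
  have ex : exists i, (i < size t)%N && `[< bB i x >].
    exists (index B' t); rewrite index_mem B't; apply/asboolP.
    by rewrite /bB /B nth_index.
  (* The first ball of the sorted list that contains [x] owns it; [B'] comes no earlier in the list,
     so its value of [o] is no larger. *)
  case: (ex_minnP ex) => i /andP[it /asboolP xi] mini.
  exists (Ordinal it); first by split => // -[k /= ki xk];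
    have := mini k; rewrite (ltn_trans ki it) asboolT//= leqNgt ki => /(_ isT).
  have ii : (i <= index B' t)%N.
    apply: mini; rewrite index_mem B't; apply/asboolP.
    by rewrite /bB /B nth_index.
  have := sorted_leq_nth le_tr le_refl (point, 0) (sort_sorted le_total s) i (index B' t).
  rewrite -/t !inE it index_mem B't => /(_ isT isT ii).
  by rewrite nth_index.
Qed.

Lemma normrB_cnorm (z w : R[i]) : `|cnorm z - cnorm w| <= cnorm (z - w).
Proof.
have := cnorm_triangle z w; have := cnorm_triangle w z; rewrite (cnormB w z).
by move=> H1 H2; rewrite ler_norml; apply/andP; split; lra.
Qed.

(** The constant [m] is taken to be the modulus of the complex average; the reverse triangle
    inequality passes from the modulus of [f] to [f] itself. *)
Lemma sharp_balls_oscillation (f : borel M -> R[i]) s l (B : M * R) : in_Lp mu 2%:E f ->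
  sharp_balls mu (fun x => cnorm (f x)) s l B ->
  l < fine (mean_oscillation mu f (ball B.1 B.2)).
Proof.
move=> f2 [/andP[r0 _] H]; have [mf _] := f2.
set D : set (borel M) := ball B.1 B.2; set v := vol mu B.1 B.2.
have mD : measurable D by exact: measurable_ball_metric.
have v0 : 0 < v by exact: (vol_gt0 mu_pos mu_balls LDP).
have muD : mu D = v%:E by exact: mu_ballE.
have iD : (\int[mu]_(x in D) (cnorm (f x))%:E < +oo)%E.
  by apply: cintegrable_L2 => //; rewrite muD ltry.
rewrite -lte_fin fineK; last exact: (mean_oscillation_fin_num mD v0 muD mf iD).
rewrite /mean_oscillation muD /= muleC lte_pdivlMr// -EFinM.
apply: lt_le_trans (H (cnorm (average mu f D))) _.
have mfm : cmeasurable (fun x => f x - average mu f D).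
  by apply: cmeasurableB => //; exact: cmeasurable_cst.
apply: ge0_le_integral => //.
- apply/measurable_EFinP; apply: measurable_funTS; apply: measurableT_comp => //.
  by apply: measurable_funB; [exact: measurable_cnorm|exact: measurable_cst].
- by apply/measurable_EFinP; apply: measurable_funTS; exact: measurable_cnorm.
- by move=> x _; rewrite lee_fin normrB_cnorm.
Qed.

(** [D] is fixed before [T], [A] and the step function. The balls of all levels of a ladder are put
    into one list and cut into disjoint pieces, so that a single application of [oscillation_sum_le]
    serves every level; summing the levels piece by piece gives the [Q] of [sharp_inequality]. *)
Lemma Lp_bound_step (b theta p : R) : 0 < b -> 0 < theta < 1 -> p = 2 / (1 - theta) ->
  exists2 D : R, 0 <= D &
  forall (T : R[i] -> (M -> R[i]) -> (M -> R[i])) (A : R), 0 < A ->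
    admissible_family mu T ->
    (forall s : R, Lp_opnorm_le mu 2%:E (T (Complex 0 s)) A) ->
    (forall s : R, Linfty_BMO_opnorm_le mu b (T (Complex 1 s)) A) ->
    forall (m : nat) (F : 'I_m -> set (borel M)) (c : 'I_m -> R[i]),
      (forall i, measurable (F i)) -> (forall i, (mu (F i) < +oo)%E) ->
      trivIset setT F -> (forall i, c i != 0) ->
      (moment mu p (T (Complex theta 0)%R (step F c)) <=
       (D * A `^ p)%:E * moment mu p (step F c))%E.
Proof.
move=> b0 th pE; have p2 := p_gt2 th pE; have p0 : 0 < p by exact: lt_trans p2.
have [eta [g [C [eta1 g0 C0 HS]]]] := sharp_inequality mu_pos mu_balls LDP b0 p2 ISO.
have [K K1 HK] := doubling16 mu_pos mu_balls LDP b0.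
have K0 : 0 < K by exact: lt_le_trans K1.
have eta0 : 0 < eta by exact: lt_trans eta1.
pose L := eta `^ p / (eta `^ p - 1).
have L0 : 0 <= L.
  rewrite /L divr_ge0 ?powR_ge0// subr_ge0 -[leLHS](powRr0 eta) ler_powR// ?(ltW eta1)//.
  exact: ltW.
pose D := C * (L / g `^ p * (128 * K)).
have Lg : 0 <= L / g `^ p by rewrite divr_ge0 ?powR_ge0.
have D0 : 0 <= D.
  by apply: mulr_ge0 => //; apply: mulr_ge0 => //; apply: mulr_ge0 => //; exact: ltW.
exists D => // T A A0 adm T0 T1 m F c mF Foo tF c0.
set f := step F c; pose G : borel M -> R[i] := T (Complex theta 0) f.
have f2 : in_Lp mu 2%:E f by exact: in_Lp_step.
have fp : in_Lp mu p%:E f by exact: in_Lp_step.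
have G2 : in_Lp mu 2%:E G.
  have [HL _ _] := adm; have th' : 0 <= theta <= 1.
    by case/andP: th => t0 t1; rewrite (ltW t0) (ltW t1).
  by have [H _ _] := HL _ (@closed_strip_Complex R theta 0 th'); exact: H.
have [mG _] := G2.
have W2 : (\int[mu]_x (cnorm (G x) ^+ 2)%:E < +oo)%E.
  have /(in_LpP _ _ (ltr0Sn R 1))[_] := G2; rewrite momentE.
  by under eq_integral do rewrite (@powR_mulrn _ _ 2) ?cnorm_ge0//.
pose f0 := fine (moment mu p f).
have fE : moment mu p f = f0%:E.
  rewrite /f0 fineK// ge0_fin_numE ?moment_ge0//.
  by move: fp => /(in_LpP _ _ p0)[].
have f00 : 0 <= f0 by rewrite fine_ge0 ?moment_ge0.
(* Interpolation needs a strictly positive bound, whereas [f0] is 0 for a null step function; [F0]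
   is let down to [f0] at the end. *)
have key F0 : 0 < F0 -> f0 <= F0 -> (moment mu p G <= (D * A `^ p * F0)%:E)%E.
  move=> F00 fF0; pose Q := L / g `^ p * (128 * K * A `^ p * F0).
  have -> : D * A `^ p * F0 = C * Q by rewrite /D /Q; ring.
  rewrite momentE; apply: HS => //.
  - by move=> x; exact: cnorm_ge0.
  - exact: measurable_cnorm.
  move=> t n u t0 Hu.
  pose o (B : M * R) := fine (mean_oscillation mu G (ball B.1 B.2)).
  pose s := flatten [seq u k | k <- iota 0 n].
  have sP B : B \in s -> exists2 k, (k < n)%N & B \in u k.
    by move=> /flatten_mapP[k]; rewrite mem_iota => /andP[_ kn] Bk; exists k.
  have Ps k B : (k < n)%N -> B \in u k -> B \in s.
    by move=> kn Bk; apply/flatten_mapP; exists k => //; rewrite mem_iota.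
  have [N [B [E [Bs mE EB tE HE]]]] := decreasing_pieces s o.
  have Bb j : 0 < (B j).2 <= b by have [k kn /(Hu _ _ kn)[]] := sP _ (Bs j).
  have Fp : (moment mu p f <= F0%:E)%E by rewrite fE lee_fin.
  have := oscillation_sum_le mu_pos mu_balls LDP adm A0 T0 T1 mF Foo tF c0 th pE
    Bb mE EB tE HK K0 F00 Fp.
  set e := fun j => fine (mu (E j)).
  have muE j : mu (E j) = (e j)%:E.
    rewrite /e fineK// ge0_fin_numE//; apply: (@le_lt_trans _ _ (mu (ball (B j).1 (B j).2))).
      by rewrite le_measure ?inE//; exact: (@measurable_ball_metric R M).
    by rewrite mu_ballE// ltry.
  move=> HO; have o0 j : 0 <= o (B j) by rewrite fine_ge0// mean_oscillation_ge0.
  have e0 j : 0 <= e j by rewrite fine_ge0.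
  (* Every point of a ball in [u k] lies in a piece whose [o] is at least that of the ball, hence
     above [g * (t * eta ^+ k)]. *)
  have Hk k : (k < n)%N -> (mu (balls_union [set` u k]) <=
      (\sum_(j < N) if g * (t * eta ^+ k) < o (B j) then e j else 0)%:E)%E.
    move=> kn; pose r := [seq j <- index_enum 'I_N | g * (t * eta ^+ k) < o (B j)].
    apply: (@le_trans _ _ (\sum_(j <- r) mu (E j))%E).
      apply: le_trans (measure_bigcup_seq_le mu r mE); rewrite le_measure ?inE//.
      - exact: measurable_balls_union.
      - by rewrite bigcup_seq; exact: bigsetU_measurable.
      - move=> x [B' B'u xB']; have [j Ej oj] := HE _ _ (Ps _ _ kn B'u) xB'.
        exists j => //=; rewrite mem_filter mem_index_enum andbT.
        by apply: lt_le_trans oj; exact: (sharp_balls_oscillation G2 (Hu _ _ kn B'u)).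
    rewrite big_filter -big_mkcond/= -sumEFin.
    by apply: lee_sum => j _; rewrite muE.
  apply: (@le_trans _ _ (\sum_(k < n) ((t * eta ^+ k) `^ p *
      (\sum_(j < N) if g * (t * eta ^+ k) < o (B j) then e j else 0))%:E)%E).
    apply: lee_sum => k _; rewrite EFinM; apply: lee_wpmul2l; last exact: Hk.
    by rewrite lee_fin powR_ge0.
  rewrite sumEFin lee_fin.
  under eq_bigr do rewrite mulr_sumr.
  rewrite exchange_big/=.
  apply: (@le_trans _ _ (\sum_(j < N) L / g `^ p * (o (B j) `^ p * e j))); last first.
    rewrite -mulr_sumr; exact: ler_wpM2l.
  (* For a fixed piece the levels below [o (B j) / g] form a geometric sum, to which [level_sum_le]
     applies. *)
  apply: ler_sum => j _.
  have og : 0 <= o (B j) / g by rewrite divr_ge0// ltW.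
  have := level_sum_le n eta1 p0 t0 og; rewrite -/L => H.
  have -> : L / g `^ p * (o (B j) `^ p * e j) = L * (o (B j) / g) `^ p * e j.
    rewrite powRM ?invr_ge0 ?(ltW g0)// -[in RHS](powR_inv1 (ltW g0)) -powRrM mulN1r powRN.
    by ring.
  apply: le_trans (ler_wpM2r (e0 j) H); rewrite mulr_suml.
  apply: ler_sum => k _; rewrite ltr_pdivlMr// [X in _ <= (if X < _ then _ else _) * _]mulrC.
  by case: ifP => _; rewrite ?mulr0 ?mul0r.
apply/lee_addgt0Pr => e e0.
pose d := e / (D * A `^ p + 1).
have DA : 0 <= D * A `^ p by rewrite mulr_ge0 ?powR_ge0.
have d0 : 0 < d by rewrite divr_gt0// ltr_pwDr.
apply: le_trans (key (f0 + d) _ _) _; [lra|lra|].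
rewrite fE -EFinM -EFinD lee_fin mulrDr lerD2l /d mulrCA ler_piMr ?(ltW e0)//.
by rewrite ler_pdivrMr ?ltr_pwDr// mul1r lerDl.
Qed.

End StepBound.

(** * Extension to L^p *)

Section SimpleFunctions.
Context d (X : measurableType d) (R : realType).
Variable mu : {measure set X -> \bar R}.
Implicit Types (f g h : X -> R[i]) (a : R[i]).

(** A finite range, rather than a representation, makes stability under linear combinations
    immediate; [csimple_step] recovers a representation. *)
Definition csimple (p : R) h :=
  in_Lp mu p%:E h /\ exists s : seq R[i], forall x, h x \in s.

Lemma csimple_lin (p : R) a h g : 0 < p -> csimple p h -> csimple p g ->
  csimple p (fun x => a * h x + g x).
Proof.
move=> p0 [hp [s hs]] [gp [t gt]]; split.
  by apply: in_LpD => //; exact: in_LpZ.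
exists [seq a * u + w | u <- s, w <- t] => x.
by apply: allpairs_f.
Qed.

Lemma measurable_fiber h a : cmeasurable h -> measurable [set x | h x = a].
Proof.
move=> mh; have mha : cmeasurable (fun x => h x - a).
  by apply: cmeasurableB => //; exact: cmeasurable_cst.
rewrite (_ : [set x | _] = setT `&` (fun x => cnorm (h x - a)) @^-1` [set 0]).
  exact: (measurable_cnorm mha).
apply/seteqP; split=> x /=.
  by move=> ->; rewrite subrr normc0.
by move=> [_ /eq0_normc/eqP]; rewrite subr_eq0 => /eqP.
Qed.

(** The sets are the fibres over the nonzero values. Removing the value 0 yields nonzero
    coefficients and, by Chebyshev's inequality, fibres of finite measure. *)
Lemma csimple_step (p : R) h : 0 < p -> csimple p h ->
  exists m (F : 'I_m -> set X) (c : 'I_m -> R[i]),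
  [/\ forall i, measurable (F i), forall i, (mu (F i) < +oo)%E, trivIset setT F,
      forall i, c i != 0 & h = step F c].
Proof.
move=> p0 [hp [s hs]]; have [mh _] := hp.
pose t := [seq u <- undup s | u != 0].
have ut : uniq t by rewrite filter_uniq// undup_uniq.
pose c (i : 'I_(size t)) := t`_i; pose F i := [set x | h x = c i].
have mF i : measurable (F i) by exact: measurable_fiber.
have c0 i : c i != 0.
  by have : c i \in t by [rewrite mem_nth]; rewrite mem_filter => /andP[].
have tF : trivIset setT F.
  move=> i j _ _ [x [xi xj]]; apply/val_inj/eqP.
  by rewrite -(nth_uniq 0 (ltn_ord i) (ltn_ord j) ut) -/(c i) -/(c j) -xi -xj.
exists (size t), F, c; split => //.
- move=> i; have /(in_LpP _ _ p0)[_ hoo] := hp.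
  have ci : 0 < cnorm (c i) `^ p by rewrite powR_gt0// cnorm_gt0.
  have H : ((cnorm (c i) `^ p)%:E * mu (F i) <= moment mu p h)%E.
    rewrite momentE -[X in mu X]setIT -integral_indic// -ge0_integralZl_EFin//; last 2 first.
    - by apply/measurable_EFinP; exact: measurable_indic.
    - exact: ltW.
    apply: ge0_le_integral => //.
    - by move=> x _; rewrite mule_ge0// lee_fin ltW.
    - apply/measurable_EFinP; apply: measurable_funM; first exact: measurable_cst.
      exact: measurable_indic.
    - by apply/measurable_EFinP; exact: measurable_cnorm_powR.
    - move=> x _; rewrite -EFinM lee_fin indicE.
      have [xF|xF] := boolP (x \in F i); last by rewrite mulr0 powR_ge0.
      by move: xF; rewrite inE /F/= => ->; rewrite mulr1.
  rewrite ltNge leye_eq; apply/negP => /eqP E.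
  by move: H; rewrite E gt0_muley ?lte_fin// leye_eq => /eqP H; rewrite H in hoo.
- apply/funext => x; have [[i [Fi ->]]|H] := stepP R tF x; first exact: Fi.
  rewrite H; apply/eqP/negP => /negP hx0.
  have ht : h x \in t by rewrite mem_filter hx0 mem_undup hs.
  have it : (index (h x) t < size t)%N by rewrite index_mem.
  have := H (fun=> 1); rewrite /step (bigD1 (Ordinal it))//= big1.
    rewrite addr0 /cindic indicE mem_set ?mulr1; last by rewrite /F /c /= nth_index.
    by move=> /eqP; rewrite oner_eq0.
  move=> j ji; rewrite /cindic indicE memNset ?mulr0// => Fj.
  move/eqP: ji; apply; apply/val_inj => /=.
  by rewrite [h x]Fj index_uniq.
Qed.

Lemma csimple_L2 (p : R) h : 0 < p -> csimple p h -> in_Lp mu 2%:E h.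
Proof.
move=> p0 /(csimple_step p0)[m [F [c [mF Foo tF _ ->]]]].
exact: in_Lp_step.
Qed.

End SimpleFunctions.

(** * Approximation by simple functions *)

Section SimpleApproximation.
Context d (X : measurableType d) (R : realType).
Implicit Types (f g h : X -> R[i]).

Lemma nonneg_simple_approx (r : X -> R) : measurable_fun setT r -> (forall x, 0 <= r x) ->
  exists a : nat -> X -> R, [/\ forall n, measurable_fun setT (a n),
    forall n, exists s : seq R, forall x, a n x \in s,
    forall n x, 0 <= a n x <= r x & forall x, a n x @[n --> \oo] --> r x].
Proof.
move=> mr r0; have mEr : measurable_fun setT (EFin \o r) by exact/measurable_EFinP.
pose a n : X -> R := nnsfun_approx measurableT mEr n.
have cv x : a n x @[n --> \oo] --> r x.
  have := @cvg_nnsfun_approx _ _ _ _ measurableT _ mEr (fun x _ => r0 x) x I.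
  by move=> /fine_cvgP[_].
exists a; split => //.
- move=> n; have /finite_seqP[s E] := fimfunP (nnsfun_approx measurableT mEr n).
  by exists s => x; have : [set` s] (a n x) by rewrite -E; exists x.
- move=> n x; apply/andP; split; first exact: fun_ge0.
  rewrite -(cvg_lim (@Rhausdorff R) (cv x)); apply: nondecreasing_cvgn_le.
    by move=> m k mk; have /lefP := nd_nnsfun_approx measurableT mEr mk; exact.
  by apply/cvg_ex; exists (r x); exact: cv.
Qed.

Lemma real_simple_approx (r : X -> R) : measurable_fun setT r ->
  exists a : nat -> X -> R, [/\ forall n, measurable_fun setT (a n),
    forall n, exists s : seq R, forall x, a n x \in s,
    forall n x, `|a n x - r x| <= `|r x| & forall x, a n x @[n --> \oo] --> r x].
Proof.
move=> mr.
have mn : measurable_fun setT (fun x => Num.max (- r x) 0).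
  by apply: measurable_maxr; [exact: measurable_funN|exact: measurable_cst].
have mp : measurable_fun setT (fun x => Num.max (r x) 0).
  by apply: measurable_maxr => //; exact: measurable_cst.
have ge0 (t : R) : 0 <= Num.max t 0 by rewrite le_max lexx orbT.
have [a [ma sa a0 ca]] := nonneg_simple_approx mp (fun x => ge0 _).
have [b [mb sb b0 cb]] := nonneg_simple_approx mn (fun x => ge0 _).
have rE x : r x = Num.max (r x) 0 - Num.max (- r x) 0.
  by case: (leP (r x) 0) => H; case: (leP (- r x) 0) => H'; lra.
exists (fun n x => a n x - b n x); split.
- by move=> n; exact: measurable_funB.
- move=> n; have [s Hs] := sa n; have [t Ht] := sb n.
  by exists [seq u - v | u <- s, v <- t] => x; exact: allpairs_f.
- move=> n x; have /andP[a1 a2] := a0 n x; have /andP[b1 b2] := b0 n x.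
  move: a2 b2; case: (leP (r x) 0) => H; case: (leP (- r x) 0) => H' a2 b2.
  + have -> : r x = 0 by lra.
    by rewrite normr0 normr_le0; apply/eqP; lra.
  + by rewrite (ler0_norm H) ler_norml; apply/andP; split; lra.
  + by rewrite (gtr0_norm H) ler_norml; apply/andP; split; lra.
  + by exfalso; lra.
- by move=> x; rewrite [X in _ --> X]rE; apply: cvgB.
Qed.

Lemma complex_simple_approx f : cmeasurable f ->
  exists h : nat -> X -> R[i], [/\ forall n, cmeasurable (h n),
    forall n, exists s : seq R[i], forall x, h n x \in s,
    forall n x, cnorm (h n x - f x) <= 2 * cnorm (f x) &
    forall x, cnorm (h n x - f x) @[n --> \oo] --> (0 : R)].
Proof.
move=> [f1 f2].
have [a [ma sa a0 ca]] := real_simple_approx f1.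
have [b [mb sb b0 cb]] := real_simple_approx f2.
have le n x : cnorm (Complex (a n x) (b n x) - f x) <=
    `|a n x - complex.Re (f x)| + `|b n x - complex.Im (f x)|.
  by apply: le_trans (cnorm_le_ReIm _) _; rewrite ReD ImD ReN ImN.
exists (fun n x => Complex (a n x) (b n x)); split.
- by move=> n; split; [exact: ma|exact: mb].
- move=> n; have [s Hs] := sa n; have [t Ht] := sb n.
  by exists [seq Complex u v | u <- s, v <- t] => x; exact: allpairs_f.
- move=> n x; apply: le_trans (le _ _) _.
  have := a0 n x; have := b0 n x; have := normr_Re_le (f x); have := normr_Im_le (f x).
  by lra.
- move=> x; apply: (@squeeze_cvgr _ _ _ _ (cst 0) (fun n =>
    `|a n x - complex.Re (f x)| + `|b n x - complex.Im (f x)|)).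
  + by apply: nearW => n; rewrite cnorm_ge0 le.
  + exact: cvg_cst.
  + rewrite -[X in _ --> X](addr0 0); apply: cvgD.
      have -> : (0 : R) = `|complex.Re (f x) - complex.Re (f x)| by rewrite subrr normr0.
      by apply: cvg_norm; apply: cvgB; [exact: ca|exact: cvg_cst].
    have -> : (0 : R) = `|complex.Im (f x) - complex.Im (f x)| by rewrite subrr normr0.
    by apply: cvg_norm; apply: cvgB; [exact: cb|exact: cvg_cst].
Qed.

Variable mu : {measure set X -> \bar R}.

Lemma moment_cvg0 (p : R) f (h : nat -> X -> R[i]) : 0 < p -> in_Lp mu p%:E f ->
  (forall n, cmeasurable (h n)) ->
  (forall n x, cnorm (h n x - f x) <= 2 * cnorm (f x)) ->
  (forall x, cnorm (h n x - f x) @[n --> \oo] --> (0 : R)) ->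
  (moment mu p (fun x => h n x - f x)) @[n --> \oo] --> 0%E.
Proof.
move=> p0 /(in_LpP _ _ p0)[mf foo] mh hf hc.
have mhf n : cmeasurable (fun x => h n x - f x) by exact: cmeasurableB.
pose G x := ((2 * cnorm (f x)) `^ p)%:E.
pose H n x := (cnorm (h n x - f x) `^ p)%:E.
have mH n : measurable_fun setT (H n).
  by apply/measurable_EFinP; exact: measurable_cnorm_powR.
have GE : G = fun x => ((2 `^ p)%:E * (cnorm (f x) `^ p)%:E)%E.
  by apply/funext => x; rewrite /G powRM ?cnorm_ge0// EFinM.
have iG : mu.-integrable setT G.
  rewrite GE; apply: integrableZl => //; apply/integrableP; split.
    by apply/measurable_EFinP; exact: measurable_cnorm_powR.
  under eq_integral do rewrite /= ger0_norm ?powR_ge0//.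
  by rewrite -momentE.
have cH x : H n x @[n --> \oo] --> 0%E.
  apply: cvg_EFin; first exact: nearW.
  apply/cvgrPdist_lt => e e0; have e1 : 0 < e `^ p^-1 by rewrite powR_gt0.
  have /cvgrPdist_lt/(_ _ e1) := hc x; apply: filterS => n /=.
  rewrite !sub0r !normrN !ger0_norm ?powR_ge0 ?cnorm_ge0// => H1.
  rewrite -[ltRHS](powRr1 (ltW e0)) -(mulVf (lt0r_neq0 p0)) powRrM.
  by apply: gt0_ltr_powR; rewrite ?nnegrE ?cnorm_ge0 ?(ltW e1).
have HG n x : (`|H n x| <= G x)%E.
  rewrite gee0_abs ?lee_fin ?powR_ge0//; apply: ge0_ler_powR; rewrite ?nnegrE ?cnorm_ge0 ?(ltW p0)//.
  by rewrite mulr_ge0 ?cnorm_ge0.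
have [_ _] := dominated_convergence measurableT mH (measurable_cst 0%E)
  (aeW mu (fun x _ => cH x)) iG (aeW mu (fun x n _ => HG n x)).
rewrite integral0.
by under eq_fun do rewrite /H -momentE.
Qed.

End SimpleApproximation.

Section Density.
Context d (X : measurableType d) (R : realType).
Variable mu : {measure set X -> \bar R}.
Implicit Types (f g h : X -> R[i]) (a : R[i]) (p e : R).

Lemma moment_sub_le p f g h : 0 < p -> cmeasurable f -> cmeasurable g -> cmeasurable h ->
  (moment mu p (fun x => f x - g x)%R <=
   (2 `^ p)%:E * (moment mu p (fun x => f x - h x)%R + moment mu p (fun x => h x - g x)%R))%E.
Proof.
move=> p0 mf mg mh; rewrite (_ : (fun x => f x - g x) = (fun x => (f x - h x) + (h x - g x))).
  by apply: moment_add_le => //; exact: cmeasurableB.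
by apply/funext => x; rewrite addrA subrK.
Qed.

Lemma moment_subC p f g : moment mu p (fun x => f x - g x) = moment mu p (fun x => g x - f x).
Proof. by rewrite !momentE; apply: eq_integral => x _; rewrite cnormB. Qed.

Lemma moment0_ae p f : 0 < p -> cmeasurable f -> moment mu p f = 0%E ->
  \forall x \ae mu, f x = 0.
Proof.
move=> p0 mf; rewrite momentE => f0.
have mfp : measurable_fun setT (fun x => (cnorm (f x) `^ p)%:E).
  by apply/measurable_EFinP; exact: measurable_cnorm_powR.
have /ae_eq_integral_abs : measurable_fun setT (fun x => (cnorm (f x) `^ p)%:E) by [].
move=> /(_ mu measurableT)[+ _].
under eq_integral do rewrite gee0_abs ?lee_fin ?powR_ge0//.
move=> /(_ f0); apply: filterS => x /(_ I) [/eqP].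
by rewrite powR_eq0 => /andP[/eqP/eq0_normc].
Qed.

Lemma small_moment_ae p (C : R) f g : 0 < p -> cmeasurable f -> cmeasurable g ->
  (forall e, 0 < e -> (moment mu p (fun x => f x - g x)%R <= (C * e)%:E)%E) ->
  \forall x \ae mu, f x = g x.
Proof.
move=> p0 mf mg H; have mfg : cmeasurable (fun x => f x - g x) by exact: cmeasurableB.
have : moment mu p (fun x => f x - g x) = 0%E.
  apply/eqP; rewrite eq_le moment_ge0 andbT; apply/lee_addgt0Pr => e e0; rewrite add0e.
  have C1 : 0 < `|C| + 1 by rewrite ltr_wpDl.
  apply: le_trans (H (e / (`|C| + 1)) _) _; first by rewrite divr_gt0.
  rewrite lee_fin mulrCA ler_piMr ?(ltW e0)// ler_pdivrMr// mul1r.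
  by apply: le_trans (ler_norm _) _; rewrite lerDl.
by move=> /(moment0_ae p0 mfg); apply: filterS => x /eqP; rewrite subr_eq0 => /eqP.
Qed.

(** One sequence converges in every L^q that contains [f]. Having L^p and L^2 simultaneously is what
    identifies the extension with [T] in [graph_closure_L2]. *)
Lemma csimple_dense p f : 0 < p -> in_Lp mu p%:E f ->
  exists h : nat -> X -> R[i], [/\ forall n, csimple mu p (h n),
    moment mu p (fun x => h n x - f x) @[n --> \oo] --> 0%E &
    forall q, 0 < q -> in_Lp mu q%:E f ->
      moment mu q (fun x => h n x - f x) @[n --> \oo] --> 0%E].
Proof.
move=> p0 fp; have [mf _] := fp.
have [h [mh sh hf hc]] := complex_simple_approx mf.
have cv q : 0 < q -> in_Lp mu q%:E f -> moment mu q (fun x => h n x - f x) @[n --> \oo] --> 0%E.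
  by move=> q0 fq; exact: (moment_cvg0 q0 fq mh hf hc).
exists h; split => //; last exact: cv.
move=> n; split => //.
rewrite (_ : h n = (fun x => (h n x - f x) + f x)); last first.
  by apply/funext => x; rewrite subrK.
apply: in_LpD => //; apply/in_LpP => //; have mhf : cmeasurable (fun x => h n x - f x).
  exact: cmeasurableB.
split => //.
have /(in_LpP _ _ p0)[m2 +] := in_LpZ 2%:R p0 fp; apply: le_lt_trans.
apply: le_moment => // x; rewrite normcM; apply: le_trans (hf n x) _.
by rewrite (_ : 2%:R = (2 : R)%:C%C) ?cnorm_real ?ger0_norm// rmorph_nat.
Qed.

Lemma cvg0_small (u : nat -> \bar R) e : (forall n, (0 <= u n)%E) -> u @ \oo --> 0%E -> 0 < e ->
  \forall n \near \oo, (u n <= e%:E)%E.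
Proof.
move=> u0 /fine_cvgP[fu /cvgrPdist_lt/(_ _)] H e0.
near=> n; rewrite -(@fineK _ (u n)); last by near: n.
rewrite lee_fin ltW//; near: n; apply: filterS (H _ e0) => n /=.
by rewrite sub0r normrN ger0_norm// fine_ge0.
Unshelve. all: by end_near. Qed.

End Density.

Lemma geometric_cauchy (R : realType) (v : nat -> R) (c : R) :
  (forall n, `|v n.+1 - v n| <= c * 2 ^- n) -> cvgn v.
Proof.
move=> H.
have cG : cvgn (series (fun n => c * (2^-1) ^+ n)).
  apply: is_cvg_geometric_series; rewrite ger0_norm ?invr_ge0//.
  by rewrite invf_lt1// ltr1n.
have cT : cvgn (series (telescope v)).
  apply: normed_cvg; apply: (series_le_cvg _ _ _ cG) => n /=.
  - exact: normr_ge0.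
  - by rewrite exprVn; apply: le_trans (H n).
  - by rewrite exprVn; exact: H.
rewrite (_ : v = (fun n => v 0%N + series (telescope v) n)); last first.
  by apply/funext => n; exact: eq_sum_telescope.
by apply: is_cvgD => //; exact: is_cvg_cst.
Qed.

(** * Completeness of L^p for rapidly converging sequences *)

Section Completeness.
Context d (X : measurableType d) (R : realType).
Variable mu : {measure set X -> \bar R}.

Lemma geometric_tail (u : nat -> R[i]) (z : R[i]) (c : R) : 0 <= c ->
  (forall n, cnorm (u n.+1 - u n) <= c * 2 ^- n) ->
  complex.Re (u n) @[n --> \oo] --> complex.Re z ->
  complex.Im (u n) @[n --> \oo] --> complex.Im z ->
  forall n, cnorm (u n - z) <= 2 * c * 2 ^- n.
Proof.
move=> c0 H cR cI n.
have step k : cnorm (u n - u (n + k)%N) <= 2 * c * 2 ^- n - 2 * c * 2 ^- (n + k).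
  elim: k => [|k IH]; first by rewrite addn0 !subrr normc0.
  rewrite addnS; have -> : u n - u (n + k).+1 = (u n - u (n + k)%N) + (u (n + k)%N - u (n + k).+1).
    by rewrite addrA subrK.
  apply: le_trans (le_normcD _ _) _; rewrite (cnormB (u (n + k)%N)).
  have := H (n + k)%N; have -> : 2 * c * 2 ^- (n + k).+1 = c * 2 ^- (n + k).
    by rewrite exprS invfM; field; rewrite expf_neq0.
  by lra.
have pos k : 0 <= 2 * c * 2 ^- k.
  by rewrite mulr_ge0 ?mulr_ge0// invr_ge0 exprn_ge0.
apply/ler_addgt0Pr => e e0; have e2 : 0 < e / 2 by rewrite divr_gt0.
have /cvgrPdist_lt/(_ _ e2)[N1 _ H1] := cR.
have /cvgrPdist_lt/(_ _ e2)[N2 _ H2] := cI.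
pose k := (N1 + N2)%N.
have -> : u n - z = (u n - u (n + k)%N) + (u (n + k)%N - z) by rewrite addrA subrK.
apply: le_trans (le_normcD _ _) _; apply: lerD.
  by apply: le_trans (step k) _; rewrite lerBlDr lerDl.
rewrite cnormB; apply: le_trans (cnorm_le_ReIm _) _; rewrite ReD ImD ReN ImN.
have h1 : (N1 <= n + k)%N by rewrite /k addnA addnAC leq_addl.
have h2 : (N2 <= n + k)%N by rewrite /k addnA leq_addl.
by have := H1 _ h1; have := H2 _ h2; rewrite /=; lra.
Qed.

(** Riesz-Fischer with a rate. Increments of size 4^-n, weighted by 2^n, still have a convergent sum
    of p-th moments. Where the sum [F] of the weighted powers is finite, the n-th increment is at
    most the p-th root of [F] times 2^-n, so the values converge geometrically. *)
Lemma Lp_complete (p C : R) (u : nat -> X -> R[i]) : 0 < p -> 0 <= C ->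
  (forall n, cmeasurable (u n)) ->
  (forall n, (moment mu p (fun x => u n.+1 x - u n x)%R <= (C * (4 ^- n) `^ p)%:E)%E) ->
  exists g B, [/\ cmeasurable g, 0 <= B &
    forall n, (moment mu p (fun x => u n x - g x)%R <= (B * (2 ^- n) `^ p)%:E)%E].
Proof.
move=> p0 C0 mu_ Hu.
have mD n : cmeasurable (fun x => u n.+1 x - u n x) by exact: cmeasurableB.
pose G n x := ((2 ^+ n * cnorm (u n.+1 x - u n x)) `^ p)%:E.
have G0 n x : (0 <= G n x)%E by rewrite lee_fin powR_ge0.
have GE n x : G n x = (((2 ^+ n) `^ p)%:E * (cnorm (u n.+1 x - u n x) `^ p)%:E)%E.
  by rewrite /G powRM ?exprn_ge0 ?cnorm_ge0.
have mG n : measurable_fun setT (G n).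
  rewrite (_ : G n = fun x => (((2 ^+ n) `^ p)%:E * (cnorm (u n.+1 x - u n x) `^ p)%:E)%E).
    apply/measurable_EFinP; apply: measurable_funM; first exact: measurable_cst.
    exact: measurable_cnorm_powR.
  by apply/funext => x; exact: GE.
pose q : R := 2^-1 `^ p; have q0 : 0 <= q by exact: powR_ge0.
have q1 : 0 < 1 - q.
  by rewrite subr_gt0 /q; apply: powR_lt_1 => //; rewrite invr_ge0 ler0n invf_lt1 ?ltr1n.
have qn n : (2 ^- n) `^ p = q ^+ n.
  rewrite -exprVn; elim: n => [|n IH]; first by rewrite !expr0 powR1.
  by rewrite !exprS powRM ?IH// ?exprn_ge0// invr_ge0.
have IG n : (\int[mu]_x G n x <= (C * q ^+ n)%:E)%E.
  under eq_integral do rewrite GE.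
  rewrite ge0_integralZl_EFin ?powR_ge0//; last 2 first.
  - by move=> x _; rewrite lee_fin powR_ge0.
  - by apply/measurable_EFinP; exact: measurable_cnorm_powR.
  rewrite -momentE; apply: le_trans (lee_wpmul2l _ (Hu n)) _.
    by rewrite lee_fin powR_ge0.
  rewrite -EFinM lee_fin mulrCA; apply: ler_wpM2l => //.
  rewrite -powRM ?exprn_ge0 ?invr_ge0 ?exprn_ge0// -qn le_eqVlt; apply/orP; left; apply/eqP.
  congr (_ `^ _); rewrite (_ : 4 = 2 * 2); last by ring.
  by rewrite exprMn invfM mulrA divff ?mul1r// expf_neq0.
pose F x := (\sum_(0 <= n <oo) G n x)%E.
have mF : measurable_fun setT F.
  rewrite /F; apply: ge0_emeasurable_sum => //.
have F0 x : (0 <= F x)%E by apply: nneseries_ge0.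
pose B := C / (1 - q).
have IF : (\int[mu]_x F x <= B%:E)%E.
  rewrite integral_nneseries//; apply: lime_le; first by apply: is_cvg_nneseries => k _ _; exact: integral_ge0.
  apply: nearW => n; apply: (@le_trans _ _ (\sum_(0 <= k < n) (C * q ^+ k)%:E)%E).
    by apply: lee_sum => k _; exact: IG.
  rewrite sumEFin lee_fin /B ler_pdivlMr// -mulr_sumr -mulrA; apply: ler_piMr => //.
  have := subrX1 q n; rewrite big_mkord; have : 0 <= q ^+ n by rewrite exprn_ge0.
  by lra.
have aeF : \forall x \ae mu, F x \is a fin_num.
  have iF : mu.-integrable setT F.
    apply/integrableP; split => //.
    under eq_integral do rewrite gee0_abs//.
    by apply: le_lt_trans IF _; rewrite ltry.
  by have := integrable_ae measurableT iF; apply: filterS => x; exact.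
(* An upper limit exists and is measurable everywhere, also on the null set where the sequence may
   diverge. *)
pose g x := Complex (fine (limn_esup (fun n => (complex.Re (u n x))%:E)))
                    (fine (limn_esup (fun n => (complex.Im (u n x))%:E))).
have mg : cmeasurable g.
  split; apply: (measurableT_comp (fine_measurable measurableT)).
  - by apply: measurable_fun_limn_esup => n; apply/measurable_EFinP; case: (mu_ n).
  - by apply: measurable_fun_limn_esup => n; apply/measurable_EFinP; case: (mu_ n).
have fine_limn (v : nat -> R) : cvgn v -> v @ \oo --> fine (limn_esup (fun n => (v n)%:E)).
  move=> /cvg_ex[l vl]; have vlE : (v n)%:E @[n --> \oo] --> l%:E.
    by apply: cvg_EFin => //; exact: nearW.
  by have [_ ->] := cvg_limn_einf_sup vlE.
have key x n : F x \is a fin_num ->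
    ((cnorm (u n x - g x) `^ p)%:E <= (2 `^ p * q ^+ n)%:E * F x)%E.
  move=> Fx; pose c := fine (F x) `^ p^-1; have c0 : 0 <= c by exact: powR_ge0.
  have cp : c `^ p = fine (F x).
    by rewrite /c -powRrM mulVf ?gt_eqF// powRr1// fine_ge0.
  have Dc k : cnorm (u k.+1 x - u k x) <= c * 2 ^- k.
    rewrite ler_pdivlMr ?exprn_gt0// mulrC leNgt; apply/negP => H.
    have : (G k x <= F x)%E.
      apply: le_trans (nneseries_lim_ge k.+1 _); last by move=> *; exact: G0.
      by rewrite big_nat_recr//= leeDr// sume_ge0.
    rewrite -(fineK Fx) lee_fin -cp leNgt => /negP; apply.
    apply: gt0_ltr_powR; rewrite ?nnegrE ?c0//.
    by rewrite mulr_ge0 ?exprn_ge0 ?cnorm_ge0.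
  have cR : complex.Re (u n x) @[n --> \oo] --> complex.Re (g x).
    apply: fine_limn; apply: (@geometric_cauchy _ _ c) => k.
    by apply: le_trans (Dc k); rewrite -ReN -ReD; exact: normr_Re_le.
  have cI : complex.Im (u n x) @[n --> \oo] --> complex.Im (g x).
    apply: fine_limn; apply: (@geometric_cauchy _ _ c) => k.
    by apply: le_trans (Dc k); rewrite -ImN -ImD; exact: normr_Im_le.
  have := geometric_tail c0 Dc cR cI n => H.
  rewrite -(fineK Fx) -EFinM lee_fin -cp -qn -!powRM ?invr_ge0 ?exprn_ge0//.
  apply: ge0_ler_powR; rewrite ?nnegrE ?cnorm_ge0 ?(ltW p0)//.
    by rewrite !mulr_ge0// invr_ge0 exprn_ge0.
  by rewrite mulrAC.
exists g, (2 `^ p * B); split => //.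
  by rewrite mulr_ge0 ?powR_ge0// divr_ge0// ltW.
move=> n; rewrite momentE.
apply: (@le_trans _ _ (\int[mu]_x ((2 `^ p * q ^+ n)%:E * F x))%E).
  apply: ae_ge0_le_integral => //.
  - by move=> x _; rewrite lee_fin powR_ge0.
  - by apply/measurable_EFinP; apply: measurable_cnorm_powR; exact: cmeasurableB.
  - by move=> x _; rewrite mule_ge0// lee_fin mulr_ge0 ?powR_ge0 ?exprn_ge0.
  - by apply: emeasurable_funM => //; exact: measurable_cst.
  - by apply: filterS aeF => x Fx _; exact: key.
rewrite ge0_integralZl_EFin//; last by rewrite mulr_ge0 ?powR_ge0 ?exprn_ge0.
apply: le_trans (lee_wpmul2l _ IF) _; first by rewrite lee_fin mulr_ge0 ?powR_ge0 ?exprn_ge0.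
by rewrite -EFinM lee_fin qn mulrAC.
Qed.

End Completeness.

(** * Extension of an operator on L^2 from simple functions to L^p *)

Section Extension.
Context d (X : measurableType d) (R : realType).
Variable mu : {measure set X -> \bar R}.
Variables (T : (X -> R[i]) -> X -> R[i]) (p K : R).
Hypothesis p2 : 2 <= p.
Hypothesis K0 : 0 <= K.
Hypothesis HT : Lp_operator mu 2%:E T.
Hypothesis TK : forall h, csimple mu p h -> (moment mu p (T h) <= K%:E * moment mu p h)%E.
Implicit Types (f g h : X -> R[i]) (a : R[i]) (e : R).

Let p0 : 0 < p. Proof. exact: lt_le_trans p2. Qed.

(** The closure in L^p of the graph of [T] on simple functions. It is a relation because images are
    determined only almost everywhere; membership of [g] in L^p comes from [graph_closure_bound]. *)
Definition in_graph_closure f g := cmeasurable g /\ forall e, 0 < e -> exists h,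
  [/\ csimple mu p h, (moment mu p (fun x => h x - f x)%R <= e%:E)%E &
      (moment mu p (fun x => T h x - g x)%R <= e%:E)%E].

Let Tmeas h : csimple mu p h -> cmeasurable (T h).
Proof. by move=> /(csimple_L2 p0) h2; have [/(_ _ h2)[]] := HT. Qed.

Let csimple_meas h : csimple mu p h -> cmeasurable h. Proof. by case=> -[]. Qed.

Lemma moment_T_sub_le h h' : csimple mu p h -> csimple mu p h' ->
  (moment mu p (fun x => T h x - T h' x)%R <=
   K%:E * moment mu p (fun x => h x - h' x)%R)%E.
Proof.
move=> hs h's; have [H1 _ H3] := HT.
have ss : csimple mu p (fun x => -1 * h' x + h x) by exact: csimple_lin.
have := H3 (-1) h' h (csimple_L2 p0 h's) (csimple_L2 p0 hs) => ae.
have -> : moment mu p (fun x => T h x - T h' x) = moment mu p (T (fun x => -1 * h' x + h x)).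
  apply: eq_moment; first by apply: cmeasurableB; exact: Tmeas.
  - exact: Tmeas.
  - by apply: filterS ae => x ->; rewrite mulN1r addrC.
apply: le_trans (TK ss) _; rewrite (_ : (fun x => h x - h' x) = (fun x => -1 * h' x + h x))//.
by apply/funext => x; rewrite mulN1r addrC.
Qed.

Let c2 : R := 2 `^ p.
Let c20 : 0 <= c2. Proof. exact: powR_ge0. Qed.

Let sub3 f g h (x y : R) : cmeasurable f -> cmeasurable g -> cmeasurable h ->
  (moment mu p (fun t => f t - h t)%R <= x%:E)%E ->
  (moment mu p (fun t => h t - g t)%R <= y%:E)%E ->
  (moment mu p (fun t => f t - g t)%R <= (c2 * (x + y))%:E)%E.
Proof.
move=> mf mg mh Hx Hy; apply: le_trans (moment_sub_le mu p0 mf mg mh) _.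
rewrite EFinM EFinD; apply: lee_wpmul2l; first by rewrite lee_fin.
exact: leeD.
Qed.

(** Every simple [h] near [f] has image near [g], not only the witnesses of the definition: [h] and
    a witness are compared through [f]. Uniqueness and agreement with [T] on L^2 rest on this. *)
Lemma graph_closure_near f g h e : in_graph_closure f g -> cmeasurable f ->
  csimple mu p h -> 0 < e ->
  (moment mu p (fun x => h x - f x)%R <= e%:E)%E ->
  (moment mu p (fun x => T h x - g x)%R <= (c2 * (K * (c2 * (e + e)) + e))%:E)%E.
Proof.
move=> [mg Hg] mf hs e0 he; have [h' [h's h'f h'g]] := Hg e e0.
apply: (sub3 (Tmeas hs) mg (Tmeas h's) _ h'g).
apply: le_trans (moment_T_sub_le hs h's) _; rewrite EFinM; apply: lee_wpmul2l.
  by rewrite lee_fin.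
apply: (sub3 (csimple_meas hs) (csimple_meas h's) mf he).
by rewrite moment_subC; exact: h'f.
Qed.

Lemma graph_closure_unique f f' g g' : cmeasurable f -> cmeasurable f' ->
  in_graph_closure f g -> in_graph_closure f' g' ->
  (\forall x \ae mu, f x = f' x) -> \forall x \ae mu, g x = g' x.
Proof.
move=> mf mf' fg fg' ff'; have [mg Hg] := fg; have [mg' _] := fg'.
pose N := c2 * (K * (c2 * 2) + 1).
apply: (@small_moment_ae _ _ _ mu p (c2 * (N + N))) => // e e0.
have [h [hs hf _]] := Hg e e0.
have hf' : (moment mu p (fun x => h x - f' x)%R <= e%:E)%E.
  rewrite -(@eq_moment _ _ _ mu p (fun x => h x - f x) (fun x => h x - f' x))//.
  - by apply: cmeasurableB => //; exact: csimple_meas.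
  - by apply: cmeasurableB => //; exact: csimple_meas.
  - by apply: filterS ff' => x ->.
have NE : c2 * (K * (c2 * (e + e)) + e) = N * e by rewrite /N; ring.
have H1 := graph_closure_near fg mf hs e0 hf; rewrite NE in H1.
have H2 := graph_closure_near fg' mf' hs e0 hf'; rewrite NE in H2.
have -> : c2 * (N + N) * e = c2 * (N * e + N * e) by ring.
apply: (sub3 mg mg' (Tmeas hs) _ H2).
by rewrite moment_subC; exact: H1.
Qed.

Lemma graph_closure_lin a f f' g g' : cmeasurable f -> cmeasurable f' ->
  in_graph_closure f g -> in_graph_closure f' g' ->
  in_graph_closure (fun x => a * f x + f' x) (fun x => a * g x + g' x).
Proof.
move=> mf mf' [mg Hg] [mg' Hg']; have ma : cmeasurable (fun _ : X => a) by exact: cmeasurable_cst.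
split; first by apply: cmeasurableD => //; exact: cmeasurableM.
move=> e e0; pose b := c2 * (cnorm a `^ p + 1) + 1.
have b0 : 0 < b by rewrite ltr_wpDl// mulr_ge0// addr_ge0 ?powR_ge0.
have eb : 0 < e / b by rewrite divr_gt0.
have [h [hs hf hg]] := Hg _ eb; have [h' [h's h'f h'g]] := Hg' _ eb.
have lin u u' v v' : cmeasurable u -> cmeasurable u' -> cmeasurable v -> cmeasurable v' ->
    (moment mu p (fun x => u x - v x)%R <= (e / b)%:E)%E ->
    (moment mu p (fun x => u' x - v' x)%R <= (e / b)%:E)%E ->
    (moment mu p (fun x => (a * u x + u' x) - (a * v x + v' x))%R <= e%:E)%E.
  move=> mu_ mu' mv mv' H H'.
  rewrite (_ : (fun x => _) = (fun x => a * (u x - v x) + (u' x - v' x))); last first.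
    by apply/funext => x; ring.
  have muv : cmeasurable (fun x => u x - v x) by exact: cmeasurableB.
  apply: le_trans (moment_add_le _ p0 _ _) _.
  - exact: cmeasurableM.
  - exact: cmeasurableB.
  rewrite momentZ//; apply: (@le_trans _ _ (c2%:E * ((cnorm a `^ p)%:E * (e / b)%:E + (e / b)%:E))%E).
    apply: lee_wpmul2l; first by rewrite lee_fin.
    apply: leeD; last exact: H'.
    apply: lee_wpmul2l; last exact: H.
    by rewrite lee_fin; exact: powR_ge0.
  rewrite -(EFinM (cnorm a `^ p)) -EFinD -(EFinM c2) lee_fin.
  have -> : c2 * (cnorm a `^ p * (e / b) + e / b) = e * ((b - 1) / b) by rewrite /b; ring.
  rewrite ler_piMr ?(ltW e0)// ler_pdivrMr// mul1r; lra.
exists (fun x => a * h x + h' x); split.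
- exact: csimple_lin.
- exact: (lin _ _ _ _ (csimple_meas hs) (csimple_meas h's) mf mf' hf h'f).
- have [_ _ H3] := HT.
  have ae := H3 a h h' (csimple_L2 p0 hs) (csimple_L2 p0 h's).
  rewrite (@eq_moment _ _ _ mu p _ (fun x => (a * T h x + T h' x) - (a * g x + g' x))).
  + exact: (lin _ _ _ _ (Tmeas hs) (Tmeas h's) mg mg' hg h'g).
  + apply: cmeasurableB; first by apply: Tmeas; exact: csimple_lin.
    by apply: cmeasurableD => //; exact: cmeasurableM.
  + apply: cmeasurableB; apply: cmeasurableD => //; try exact: Tmeas;
      by apply: cmeasurableM => //; exact: Tmeas.
  + by apply: filterS ae => x ->.
Qed.

(** The factor [c2] appears twice, in comparing [h] with [f] and [T h] with [g]; the errors [e / b]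
    are set so that what remains is at most [e]. *)
Lemma graph_closure_bound f g : in_Lp mu p%:E f -> in_graph_closure f g ->
  (moment mu p g <= (c2 * (K * c2))%:E * moment mu p f)%E.
Proof.
move=> fp [mg Hg]; have /(in_LpP _ _ p0)[mf foo] := fp.
pose m := fine (moment mu p f).
have mE : moment mu p f = m%:E by rewrite /m fineK// ge0_fin_numE ?moment_ge0.
rewrite mE -EFinM; apply/lee_addgt0Pr => e e0.
pose b := c2 * (1 + K * c2) + 1.
have b0 : 0 < b by rewrite ltr_wpDl// mulr_ge0// addr_ge0// mulr_ge0.
have eb : 0 < e / b by rewrite divr_gt0.
have [h [hs hf hg]] := Hg _ eb.
have mh := csimple_meas hs; have mTh := Tmeas hs.
have Hh : (moment mu p h <= (c2 * (e / b + m))%:E)%E.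
  rewrite (_ : h = (fun x => (h x - f x) + f x)); last first.
    by apply/funext => x; rewrite subrK.
  apply: le_trans (moment_add_le _ p0 (cmeasurableB mh mf) mf) _.
  rewrite EFinM EFinD; apply: lee_wpmul2l; first by rewrite lee_fin.
  by apply: leeD; [exact: hf|rewrite mE].
rewrite (_ : g = (fun x => (g x - T h x) + T h x)); last first.
  by apply/funext => x; rewrite subrK.
apply: le_trans (moment_add_le _ p0 (cmeasurableB mg mTh) mTh) _.
apply: (@le_trans _ _ (c2%:E * ((e / b)%:E + K%:E * (c2 * (e / b + m))%:E))%E).
  apply: lee_wpmul2l; first by rewrite lee_fin.
  apply: leeD; first by rewrite moment_subC; exact: hg.
  by apply: le_trans (TK hs) _; apply: lee_wpmul2l; [rewrite lee_fin|exact: Hh].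
rewrite -(EFinM K) -EFinD -(EFinM c2) -EFinD lee_fin.
have -> : c2 * (e / b + K * (c2 * (e / b + m))) = c2 * (K * c2) * m + e * ((b - 1) / b).
  by rewrite /b; ring.
by rewrite lerD2l ler_piMr ?(ltW e0)// ler_pdivrMr// mul1r; lra.
Qed.

(** Simple approximations at the rate 4^-n have images that satisfy the hypothesis of [Lp_complete];
    their limit is [g]. *)
Lemma graph_closure_exists f : in_Lp mu p%:E f -> exists g, in_graph_closure f g.
Proof.
move=> fp; have [mf _] := fp; have [h [hs hc _]] := csimple_dense p0 fp.
have ex n : exists k, (moment mu p (fun x => h k x - f x)%R <= ((4 ^- n) `^ p)%:E)%E.
  have e0 : 0 < (4 ^- n) `^ p by rewrite powR_gt0// invr_gt0 exprn_gt0.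
  have [k _ Hk] := cvg0_small (fun n => moment_ge0 _ _ _) hc e0.
  by exists k; exact: Hk (leqnn k).
have [k Hk] := choice ex.
pose u n := T (h (k n)).
have mono n : (4 ^- n.+1) `^ p <= (4 ^- n) `^ p :> R.
  apply: ge0_ler_powR; rewrite ?nnegrE ?invr_ge0 ?exprn_ge0 ?(ltW p0)//.
  by rewrite lef_pV2 ?posrE ?exprn_gt0// ler_weXn2l// ler1n.
have [] := @Lp_complete _ _ _ mu p (K * (c2 * 2)) u p0.
- by rewrite !mulr_ge0.
- by move=> n; exact: Tmeas.
- move=> n; apply: le_trans (moment_T_sub_le (hs _) (hs _)) _.
  rewrite -mulrA EFinM; apply: lee_wpmul2l; first by rewrite lee_fin.
  apply: le_trans (sub3 (csimple_meas (hs _)) (csimple_meas (hs _)) mf (Hk n.+1) _) _.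
    by rewrite moment_subC; exact: Hk.
  rewrite lee_fin -mulrA; apply: ler_wpM2l => //.
  by rewrite mulr_natl mulr2n lerD2r.
move=> g [B [mg B0 Hg]]; exists g; split => // e e0.
pose q : R := 2^-1 `^ p; have q0 : 0 <= q by exact: powR_ge0.
have q1 : q < 1.
  by rewrite /q; apply: powR_lt_1 => //; rewrite invr_ge0 ler0n invf_lt1 ?ltr1n.
have qn n : (2 ^- n) `^ p = q ^+ n.
  rewrite -exprVn; elim: n => [|n IH]; first by rewrite !expr0 powR1.
  by rewrite !exprS powRM ?IH// ?exprn_ge0// invr_ge0.
have B1 : 0 < 1 + B by rewrite ltr_pwDl.
have eB : 0 < e / (1 + B) by rewrite divr_gt0.
have [n Hn] : exists n, q ^+ n <= e / (1 + B).
  have /cvgrPdist_lt/(_ _ eB)[n _ H] : q ^+ n @[n --> \oo] --> (0 : R).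
    by apply: cvg_expr; rewrite ger0_norm.
  exists n; have := H n (leqnn n); rewrite /= sub0r normrN ger0_norm ?exprn_ge0// => /ltW.
  exact.
exists (h (k n)); split => //.
- apply: le_trans (Hk n) _; rewrite lee_fin.
  apply: (@le_trans _ _ (q ^+ n)).
    rewrite -qn; apply: ge0_ler_powR; rewrite ?nnegrE ?invr_ge0 ?exprn_ge0 ?(ltW p0)//.
    by rewrite lef_pV2 ?posrE ?exprn_gt0// lerXn2r ?nnegrE// ler_nat.
  apply: le_trans Hn _; rewrite ler_pdivrMr// mulrDr mulr1 lerDl.
  by rewrite mulr_ge0// ltW.
- apply: le_trans (Hg n) _; rewrite lee_fin qn.
  apply: le_trans (ler_wpM2l B0 Hn) _.
  by rewrite mulrA ler_pdivrMr// mulrC ler_pM2l// lerDr.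
Qed.

(* [min (t ^ p) (t ^ 2)] is the quasi-subadditive function comparing an
   approximation in L^p with one in L^2. *)
Lemma min_powR_add_le (s t : R) : 0 <= s -> 0 <= t ->
  Num.min ((s + t) `^ p) ((s + t) `^ 2) <= c2 * (s `^ p + t `^ 2).
Proof.
move=> s0 t0; have p0' := ltW p0.
have [st|ts] := leP t s.
- apply: (@le_trans _ _ ((2 * s) `^ p)); last first.
    by rewrite powRM// ler_wpM2l// lerDl powR_ge0.
  rewrite ge_min; apply/orP; left.
  apply: ge0_ler_powR; rewrite ?nnegrE ?addr_ge0 ?mulr_ge0//.
  by rewrite mulr_natl mulr2n lerD2l.
- apply: (@le_trans _ _ ((2 * t) `^ 2)).
    rewrite ge_min; apply/orP; right.
    apply: ge0_ler_powR; rewrite ?nnegrE ?addr_ge0 ?mulr_ge0//.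
    by rewrite mulr_natl mulr2n lerD2r ltW.
  rewrite powRM//; apply: ler_pM; rewrite ?powR_ge0//.
    by rewrite /c2 ler_powR// ler1n.
  by rewrite lerDr powR_ge0.
Qed.

(** The images of one approximating sequence tend to [g] in L^p and to [T f] in L^2. No single
    exponent compares the two limits, but the integral of the smaller of the two powers of their
    distance is arbitrarily small, hence 0. *)
Lemma graph_closure_L2 (K2 : R) f g : 0 <= K2 -> Lp_opnorm_le mu 2%:E T K2 ->
  in_Lp mu p%:E f -> in_Lp mu 2%:E f -> in_graph_closure f g ->
  \forall x \ae mu, g x = T f x.
Proof.
move=> K20 TK2 fp f2 fg; have [mf _] := fp; have [mg _] := fg.
have [HT1 _ HT3] := HT; have [mTf _] := HT1 f f2.
have [h [hs hp hq]] := csimple_dense p0 fp; have h2 := hq 2 (ltr0Sn R 1) f2.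
pose N := c2 * (K * (c2 * 2) + 1); pose N2 := K2 `^ 2.
have mgT : cmeasurable (fun x => g x - T f x) by exact: cmeasurableB.
pose m x := Num.min (cnorm (g x - T f x) `^ p) (cnorm (g x - T f x) `^ 2).
have m0 x : 0 <= m x by rewrite le_min !powR_ge0.
have mm : measurable_fun setT m.
  by apply: measurable_minr; exact: measurable_cnorm_powR.
have small e : 0 < e -> (\int[mu]_x (m x)%:E <= (c2 * (N + N2) * e)%:E)%E.
  move=> e0.
  have [n [Hn1 Hn2]] : exists n, (moment mu p (fun x => h n x - f x)%R <= e%:E)%E /\
      (moment mu 2 (fun x => h n x - f x)%R <= e%:E)%E.
    have [n1 _ H1] := cvg0_small (fun n => moment_ge0 _ _ _) hp e0.
    have [n2 _ H2] := cvg0_small (fun n => moment_ge0 _ _ _) h2 e0.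
    exists (n1 + n2)%N; split; first by apply: H1; exact: leq_addr.
    by apply: H2; exact: leq_addl.
  have hn2 := csimple_L2 p0 (hs n); have mTh := Tmeas (hs n).
  have NE : c2 * (K * (c2 * (e + e)) + e) = N * e by rewrite /N; ring.
  have H1 := graph_closure_near fg mf (hs n) e0 Hn1; rewrite NE moment_subC in H1.
  have H2 : (moment mu 2 (fun x => T (h n) x - T f x)%R <= (N2 * e)%:E)%E.
    have s2 : in_Lp mu 2%:E (fun x => -1 * f x + h n x).
      by apply: in_LpD => //; exact: in_LpZ.
    have sE : (fun x => h n x - f x) = (fun x => -1 * f x + h n x).
      by apply/funext => x; rewrite mulN1r addrC.
    rewrite (@eq_moment _ _ _ mu 2 _ (T (fun x => -1 * f x + h n x))).
    - apply: le_trans (opnorm_moment_le (ltr0Sn R 1) K20 TK2 s2) _.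
      rewrite -sE EFinM; apply: lee_wpmul2l; last exact: Hn2.
      by rewrite lee_fin; exact: powR_ge0.
    - exact: cmeasurableB.
    - by have [] := HT1 _ s2.
    - by apply: filterS (HT3 (-1) f (h n) f2 hn2) => x ->; rewrite mulN1r addrC.
  have mgh : cmeasurable (fun x => g x - T (h n) x) by exact: cmeasurableB.
  have mhf : cmeasurable (fun x => T (h n) x - T f x) by exact: cmeasurableB.
  have mA : measurable_fun setT (fun x => (cnorm (g x - T (h n) x) `^ p)%:E).
    by apply/measurable_EFinP; exact: measurable_cnorm_powR.
  have mB : measurable_fun setT (fun x => (cnorm (T (h n) x - T f x) `^ 2)%:E).
    by apply/measurable_EFinP; exact: measurable_cnorm_powR.
  apply: (@le_trans _ _ (\int[mu]_x (c2%:E * ((cnorm (g x - T (h n) x) `^ p)%:E +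
      (cnorm (T (h n) x - T f x) `^ 2)%:E)))%E).
    apply: ge0_le_integral.
    - exact: measurableT.
    - by move=> x _; rewrite lee_fin.
    - exact/measurable_EFinP.
    - by apply: emeasurable_funM; [exact: measurable_cst|exact: emeasurable_funD].
    - move=> x _; rewrite -EFinD -EFinM lee_fin.
      apply: le_trans (min_powR_add_le (cnorm_ge0 _) (cnorm_ge0 _)).
      have le : cnorm (g x - T f x) <= cnorm (g x - T (h n) x) + cnorm (T (h n) x - T f x).
        have -> : g x - T f x = (g x - T (h n) x) + (T (h n) x - T f x).
          by rewrite addrA subrK.
        exact: le_normcD.
      have mono (q : R) : 0 <= q -> cnorm (g x - T f x) `^ q <=
          (cnorm (g x - T (h n) x) + cnorm (T (h n) x - T f x)) `^ q.
        by move=> q0; apply: ge0_ler_powR; rewrite ?nnegrE ?addr_ge0 ?cnorm_ge0.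
      by rewrite le_min !ge_min !mono ?orbT//; exact: ltW.
  rewrite ge0_integralZl_EFin//; last 2 first.
  - by move=> x _; rewrite -EFinD lee_fin addr_ge0// powR_ge0.
  - exact: emeasurable_funD.
  rewrite ge0_integralD//; last 2 first.
  - by move=> x _; rewrite lee_fin powR_ge0.
  - by move=> x _; rewrite lee_fin powR_ge0.
  rewrite -!momentE.
  have -> : c2 * (N + N2) * e = c2 * (N * e + N2 * e) by ring.
  rewrite (EFinM c2) EFinD; apply: lee_wpmul2l; first by rewrite lee_fin.
  by apply: leeD; [exact: H1|exact: H2].
have int0 : (\int[mu]_x (m x)%:E = 0)%E.
  apply/eqP; rewrite eq_le integral_ge0 ?andbT; last by move=> x _; rewrite lee_fin.
  apply/lee_addgt0Pr => e e0; rewrite add0e.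
  pose b := c2 * (N + N2) + 1.
  have b0 : 0 < b.
    rewrite ltr_wpDl// mulr_ge0// addr_ge0 ?powR_ge0// mulr_ge0// addr_ge0// mulr_ge0//.
    exact: mulr_ge0.
  apply: le_trans (small (e / b) _) _; first by rewrite divr_gt0.
  rewrite lee_fin mulrCA ler_piMr ?(ltW e0)// ler_pdivrMr// mul1r /b; lra.
have /ae_eq_integral_abs : measurable_fun setT (fun x => (m x)%:E) by exact/measurable_EFinP.
move=> /(_ mu measurableT)[+ _].
under eq_integral do rewrite gee0_abs ?lee_fin//.
move=> /(_ int0); apply: filterS => x /(_ I) [] /eqP.
have [->//|/eqP gT] := eqVneq (g x) (T f x).
have c0 : 0 < cnorm (g x - T f x) by rewrite cnorm_gt0 subr_eq0; apply/eqP.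
by rewrite gt_eqF// lt_min !powR_gt0.
Qed.

End Extension.

(** The exponent [p^-1] turns the moment constant of [graph_closure_bound] into an operator norm. *)
Lemma Lp_extension d (X : measurableType d) (R : realType) (mu : {measure set X -> \bar R})
    (T : (X -> R[i]) -> X -> R[i]) (p K K2 : R) : 2 <= p -> 0 <= K -> 0 <= K2 ->
  Lp_operator mu 2%:E T -> Lp_opnorm_le mu 2%:E T K2 ->
  (forall h, csimple mu p h -> (moment mu p (T h) <= K%:E * moment mu p h)%E) ->
  Lp_extension_opnorm_le mu p%:E T ((2 `^ p * (K * 2 `^ p)) `^ p^-1).
Proof.
move=> p2 K0 K20 HT TK2 TK; have p0 : 0 < p by exact: lt_le_trans p2.
(* A representative is chosen in the graph closure; the default 0 can occur only outside L^p. *)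
pose U f : X -> R[i] :=
  if pselect (exists g, in_graph_closure mu T p f g) is left ex then projT1 (cid ex)
  else fun=> 0.
have UP f : in_Lp mu p%:E f -> in_graph_closure mu T p f (U f).
  move=> fp; rewrite /U; case: pselect => [ex|[]]; first exact: projT2 (cid ex).
  exact: graph_closure_exists TK _ fp.
have Ubound f : in_Lp mu p%:E f ->
    (moment mu p (U f) <= (2 `^ p * (K * 2 `^ p))%:E * moment mu p f)%E.
  by move=> fp; exact: (graph_closure_bound p2 K0 HT TK fp (UP _ fp)).
have Up f : in_Lp mu p%:E f -> in_Lp mu p%:E (U f).
  move=> fp; apply/(in_LpP _ _ p0); split; first by case: (UP _ fp).
  apply: le_lt_trans (Ubound _ fp) _; have /(in_LpP _ _ p0)[_ foo] := fp.
  apply: lte_mul_pinfty; rewrite ?foo// lee_fin.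
  by apply: mulr_ge0; [exact: powR_ge0|apply: mulr_ge0 => //; exact: powR_ge0].
exists U; split.
- split=> [//|f g fp gp fg|a f g fp gp].
    have [mf _] := fp; have [mg _] := gp.
    exact: (graph_closure_unique p2 K0 HT TK mf mg (UP _ fp) (UP _ gp) fg).
  have lp : in_Lp mu p%:E (fun y => a * f y + g y).
    by apply: in_LpD => //; exact: in_LpZ.
  have [mf _] := fp; have [mg _] := gp; have [ml _] := lp.
  apply: (graph_closure_unique p2 K0 HT TK ml ml (UP _ lp)).
    exact: (graph_closure_lin p2 HT a mf mg (UP _ fp) (UP _ gp)).
  exact: aeW.
- move=> f f2 fp; exact: (graph_closure_L2 p2 K0 HT TK K20 TK2 fp f2 (UP _ fp)).
- move=> f fp; rewrite cLnorm_le_moment ?powR_ge0//.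
  rewrite -powRrM mulVf ?gt_eqF// powRr1; first exact: Ubound.
  by apply: mulr_ge0; [exact: powR_ge0|apply: mulr_ge0 => //; exact: powR_ge0].
Qed.

Theorem theorem7p5 (R : realType) (M : pointedMetricType R)
    (mu : {measure set (borel M) -> \bar R}) (R0 beta b0 : R)
    (M_unbounded : unbounded_space M)
    (mu_pos : (0 < mu setT)%E)
    (mu_balls : balls_finite mu)
    (LDP : locally_doubling mu)
    (ISO : isoperimetric mu)
    (R0_ge0 : 0 <= R0)
    (beta_itv : 2^-1 < beta < 1)
    (AMP : approximate_midpoint M R0 beta)
    (b0_gt : R0 / (1 - beta) < b0) :
  exists Abound : R -> R -> R,
  forall (T : R[i] -> (M -> R[i]) -> (M -> R[i])) (A : R),
    admissible_family mu T ->
    (forall s : R, Lp_opnorm_le mu 2%:E (T (Complex 0 s)) A) ->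
    (forall s : R, Linfty_BMO_opnorm_le mu b0 (T (Complex 1 s)) A) ->
    forall theta : R, 0 < theta < 1 ->
      Lp_extension_opnorm_le mu (2 / (1 - theta))%:E (T (Complex theta 0))
        (Abound A theta).
Proof.
have b00 : 0 < b0.
  apply: le_lt_trans b0_gt; apply: divr_ge0 => //.
  by rewrite subr_ge0 ltW//; case/andP: beta_itv.
(* The constant is chosen as a function of [theta] before [T] and [A] appear, which gives [Abound]
   its uniformity; outside (0, 1) any number serves. *)
have /choice[D HD] : forall theta : R, exists D : R, 0 < theta < 1 -> 0 <= D /\
    forall (T : R[i] -> (M -> R[i]) -> (M -> R[i])) (A : R), 0 < A ->
    admissible_family mu T ->
    (forall s : R, Lp_opnorm_le mu 2%:E (T (Complex 0 s)) A) ->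
    (forall s : R, Linfty_BMO_opnorm_le mu b0 (T (Complex 1 s)) A) ->
    forall (m : nat) (F : 'I_m -> set (borel M)) (c : 'I_m -> R[i]),
      (forall i, measurable (F i)) -> (forall i, (mu (F i) < +oo)%E) ->
      trivIset setT F -> (forall i, c i != 0) ->
      (moment mu (2 / (1 - theta)) (T (Complex theta 0)%R (step F c)) <=
       (D * A `^ (2 / (1 - theta)))%:E * moment mu (2 / (1 - theta)) (step F c))%E.
  move=> theta; have [th|nth] := boolP (0 < theta < 1); last by exists 0.
  have [D D0 HD] := Lp_bound_step mu_pos mu_balls LDP ISO b00 th erefl.
  by exists D.
(* Interpolation requires a positive bound, while [A] may be 0 or negative; [|A| + 1] is positive,
   dominates [A] and still depends on [A] alone. *)
pose B (A theta : R) : R := D theta * (`|A| + 1) `^ (2 / (1 - theta)).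
exists (fun A theta => (2 `^ (2 / (1 - theta)) * (B A theta * 2 `^ (2 / (1 - theta))))
  `^ (2 / (1 - theta))^-1).
move=> T A adm T0 T1 theta th; have [D0 {}HD] := HD theta th.
have A0 : 0 < `|A| + 1 by rewrite ltr_wpDl.
have AA : A <= `|A| + 1 by apply: le_trans (ler_norm _) _; rewrite lerDl.
have [HL [K2 HK2] _] := adm.
have cth : @closed_strip R (Complex theta 0).
  by apply: closed_strip_ReP; case/andP: th => t0 t1; rewrite /= (ltW t0) (ltW t1).
apply: (@Lp_extension _ _ _ _ _ _ _ (Num.max K2 0)).
- exact: ltW (p_gt2 th erefl).
- by rewrite mulr_ge0 ?powR_ge0.
- by rewrite le_max lexx orbT.
- exact: HL.
- move=> f /(HK2 _ cth f) /le_trans; apply; apply: lee_wpmul2r; first exact: Lnorm_ge0.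
  by rewrite lee_fin le_max lexx.
- have p0 : 0 < 2 / (1 - theta) by exact: lt_trans (p_gt2 th erefl).
  move=> h /(csimple_step p0)[m [F [c [mF Foo tF c0 ->]]]].
  apply: (HD T _ A0 adm _ _ m F c mF Foo tF c0) => s f.
  + move=> /(T0 s f) /le_trans; apply; apply: lee_wpmul2r; first exact: Lnorm_ge0.
    by rewrite lee_fin.
  + move=> f2 foo; have [HB HN] := T1 s f f2 foo; split => //.
    apply: le_trans HN _; apply: lee_wpmul2r; first exact: Lnorm_ge0.
    by rewrite lee_fin.
Qed.
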